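(* For fixed $\alpha\in(0,1)$, suppose that $\epsilon_n\ge K_n\sigma\sqrt{n^{-1}\log d}$, where $K_n$ is a positive sequence increasing to infinity at any rate. Then $$\lim_{n\to\infty}\sup_{P\in\mathcal{P}_{0,d}}\mathbb{E}_P[\phi_{\mathrm{sparse}}]=\alpha\quad\text{and}\quad\lim_{n\to\infty}\sup_{P\in\mathcal{Q}_{\mathrm{sparse},d}(\epsilon_n)}\mathbb{E}_P[1-\phi_{\mathrm{sparse}}]=0 ,$$ where it is assumed that $\kappa_\ast\le m_1/n\le\kappa^\ast$ for some $\kappa_\ast,\kappa^\ast>0$. In particular, $p_n=1-\Phi(T_{\mathrm{sparse}})$ is a dimension-agnostic $p$-value, i.e. $\limsup_{n\to\infty}\sup_{P\in\mathcal{P}_{0,d_n}}P(p_n\le a)\le a$ for any $a\in[0,1]$, regardless of the sequence $(d_n)_{n\ge1}$.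
   Context: $\Phi$ is the cumulative distribution function of $N(0,1)$ and $z_\beta$ its $\beta$-quantile. $X_1,\dots,X_n$ are i.i.d. from $P$ on $\mathbb{R}^d$, where the dimension $d=d_n$ may depend on $n$; $m_1$ and $m_2=n-m_1$ are positive integers; $x^{(j)}$ denotes the $j$th coordinate of a vector $x$. For $\mu\in\mathbb{R}^d$, $\mathcal{P}_{\mu,d}$ is the set of all continuous distributions $P$ on $\mathbb{R}^d$ with mean $\mu$ such that, for $X\sim P$, $$\sup_{u\in\mathbb{S}^{d-1}}\frac{\{\mathbb{E}_P[|u^\top(X-\mu)|^3]\}^{1/3}}{\{\mathbb{E}_P[|u^\top(X-\mu)|^2]\}^{1/2}}\le L^{1/3},$$ where $\mathbb{S}^{d-1}$ is the unit sphere and $L>1$ is a fixed constant (say $L=2$); $\mathcal{P}_{0,d}$ is this class with $\mu=0$. For a common sub-Gaussian parameter $\sigma>0$, the sparse alternatives are $$\mathcal{Q}_{\mathrm{sparse},d}(\epsilon_n)=\Bigl\{P\in\mathcal{P}_{\mu,d}:\ \|\mu\|_\infty\ge\epsilon_n\ \text{and}\ \max_{1\le j\le d}\mathbb{E}_P\bigl[e^{\lambda(X^{(j)}-\mu^{(j)})}\bigr]\le e^{\lambda^2\sigma^2}\ \text{for all }\lambda\in\mathbb{R}\Bigr\},$$ where $\mu$ ranges over $\mathbb{R}^d$. Let $\widehat\mu_2=\frac1{m_2}\sum_{j=m_1+1}^{n}X_j$, $i^\star=\arg\max_{1\le j\le d}|\widehat\mu_2^{(j)}|$, and let $\widehat v\in\mathbb{R}^d$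 have $\widehat v^{(i^\star)}=\mathrm{sign}(\widehat\mu_2^{(i^\star)})$ and $\widehat v^{(j)}=0$ for $j\ne i^\star$. Put $f_{\mathrm{sparse}}(x)=\widehat v^\top x$, $\overline f_{\mathrm{sparse}}=\frac1{m_1}\sum_{i=1}^{m_1}f_{\mathrm{sparse}}(X_i)$, $$T_{\mathrm{sparse}}=\frac{\sqrt{m_1}\,\overline f_{\mathrm{sparse}}}{\sqrt{m_1^{-1}\sum_{i=1}^{m_1}\{f_{\mathrm{sparse}}(X_i)-\overline f_{\mathrm{sparse}}\}^2}},$$ and $\phi_{\mathrm{sparse}}=\mathbf 1(T_{\mathrm{sparse}}>z_{1-\alpha})$.
   Formalization: The type II error claim is stated for d_n ≥ 2 (at d = 1, log d = 0) and κ^* < 1 (so m_2/n stays bounded below); the limit α for the size assumes, when L < 2, that P_{0,d_n} is eventually nonempty (it can be empty for L near 1); ''continuous'' means having a density. *)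

(* Defs.v *)
From HB Require Import structures.
From mathcomp Require Import all_boot all_order all_algebra.
From mathcomp Require Import all_classical all_reals all_analysis.

Set Implicit Arguments.
Unset Strict Implicit.
Unset Printing Implicit Defensive.
Import Order.TTheory GRing.Theory Num.Theory.
Import numFieldNormedType.Exports.
Local Open Scope classical_set_scope.
Local Open Scope ring_scope.

(* T^n is n.-tuple T with the product sigma-algebra; in particular R^d is
   d.-tuple R, with its Borel sets. *)
Section iid_sample.
Context d (T : measurableType d) (R : realType).

Definition tcons n (x : T * n.-tuple T) : n.+1.-tuple T :=
  [tuple of x.1 :: x.2].

Lemma measurable_tcons n : measurable_fun [set: T * n.-tuple T] (@tcons n).
Proof. exact: measurable_cons measurable_fst measurable_snd. Qed.

HB.instance Definition _ n :=
  @isMeasurableFun.Build _ _ _ _ (@tcons n) (@measurable_tcons n).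

(* The n-fold product of P, i.e. the joint law of n i.i.d. draws from P. *)
Fixpoint iid (P : probability T R) (n : nat) : probability (n.-tuple T) R :=
  if n is n'.+1 then distribution (P \x iid P n')%E (@tcons n')
  else \d_[tuple].

End iid_sample.

Section lebesgue_vec.
Context (R : realType).

(* The d-fold product of the Lebesgue measure of R. *)
Fixpoint lebesgue_vec (d : nat) : set (d.-tuple R) -> \bar R :=
  if d is d'.+1 then
    pushforward (@lebesgue_measure R \x @lebesgue_vec d')%E (@tcons _ R d')
  else \d_[tuple].

End lebesgue_vec.
Arguments lebesgue_vec : clear implicits.

Section gaussian.
Context {R : realType}.

Definition Phi (x : R) : R := fine (normal_prob 0 1 `]-oo, x]).

Definition gauss_quantile (beta : R) : R := inf [set x : R | beta <= Phi x].

End gaussian.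

Section distribution_classes.
Context {R : realType} (d : nat).
Implicit Types (P : probability (d.-tuple R) R) (mu u x : d.-tuple R).

Definition dotv u x : R := \sum_(j < d) tnth u j * tnth x j.

Definition unit_sphere : set (d.-tuple R) := [set u | dotv u u = 1].

Definition supnorm mu : R := \big[Num.max/0]_(j < d) `|tnth mu j|.

Definition has_mean P mu := forall j : 'I_d,
  P.-integrable setT (fun x => (tnth x j)%:E) /\
  ('E_P[fun x => tnth x j] = (tnth mu j)%:E)%E.

(* (E_P |u^T (X - mu)|^p)^(1/p) *)
Definition proj_norm P mu u (p : R) : \bar R :=
  Lnorm P p%:E (fun x => (dotv u x - dotv u mu)%:E).

(* P_{mu,d}. A continuous distribution is one that is absolutely continuous
   with respect to Lebesgue measure, so that proj_norm P mu u 2 is never 0.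
   Finiteness of the third moments, implicit in the bound on the ratio, has to
   be required separately because +oo / +oo = 0 in \bar R. *)
Definition calP (L : R) mu : set (probability (d.-tuple R) R) :=
  [set P : probability (d.-tuple R) R | [/\ P `<< lebesgue_vec R d,
    has_mean P mu,
    (forall u, unit_sphere u -> proj_norm P mu u 3 < +oo)%E &
    (ereal_sup [set proj_norm P mu u 3 / proj_norm P mu u 2
               | u in unit_sphere] <= (L `^ 3^-1)%R%:E)%E]].

Definition calP0 (L : R) := calP L [tuple 0 | _ < d].

Definition subgaussian P mu (sigma : R) := forall (lambda : R) (j : 'I_d),
  ('E_P[fun x => expR (lambda * (tnth x j - tnth mu j))] <=
   (expR (lambda ^+ 2 * sigma ^+ 2))%:E)%E.

Definition calQ_sparse (L sigma eps : R) : set (probability (d.-tuple R) R) :=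
  [set P : probability (d.-tuple R) R | exists mu : d.-tuple R,
    [/\ calP L mu P, eps <= supnorm mu & subgaussian P mu sigma]].

End distribution_classes.

(* m is m_1: the first m observations form the first split and the remaining
   n - m the second one. *)
Section sparse_test.
Context {R : realType} (d n m : nat).
Implicit Types X : n.-tuple (d.-tuple R).

Definition muhat2 X (j : 'I_d) : R :=
  (n - m)%:R^-1 * \sum_(i < n | (m <= i)%N) tnth (tnth X i) j.

(* None only if d = 0; ties are broken by pick. *)
Definition istar X : option 'I_d :=
  [pick j | [forall k, `|muhat2 X k| <= `|muhat2 X j|]].

Definition vhat X : d.-tuple R :=
  [tuple if istar X == Some j then Num.sg (muhat2 X j) else 0 | j < d].

Definition fsparse X (x : d.-tuple R) : R := dotv (vhat X) x.

Definition fbar X : R :=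
  m%:R^-1 * \sum_(i < n | (i < m)%N) fsparse X (tnth X i).

Definition Tsparse X : R :=
  Num.sqrt m%:R * fbar X /
  Num.sqrt (m%:R^-1 *
    \sum_(i < n | (i < m)%N) (fsparse X (tnth X i) - fbar X) ^+ 2).

Definition phi_sparse (alpha : R) X : R :=
  (gauss_quantile (1 - alpha) < Tsparse X)%R%:R.

Definition pvalue X : R := 1 - Phi (Tsparse X).

End sparse_test.
Arguments phi_sparse {R d n} m alpha X.
Arguments pvalue {R d n} m X.

(* Main.v *)
Require Import Defs.
From HB Require Import structures.
From mathcomp Require Import all_boot all_order all_algebra.
From mathcomp Require Import all_classical all_reals all_analysis.
From mathcomp Require Import measurable_realfun.
From mathcomp Require Import ring lra.
Import Order.TTheory GRing.Theory Num.Theory.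
Import numFieldNormedType.Exports.
Local Open Scope classical_set_scope.
Local Open Scope ring_scope.
Set Implicit Arguments.
Unset Strict Implicit.
Unset Printing Implicit Defensive.

(** The direction of projection depends on the second part of the sample only.
Given that part, the statistic is the studentized mean of one-dimensional
i.i.d. variables: a single coordinate of the observations, up to sign
([Tsparse_cat], [vhatP]). All limit theorems therefore concern real variables,
and the dimension does not enter them. The class supplies, for each
coordinate, a positive variance s^2 and a third absolute moment of at most
L s^3 ([calP_moments]). Absolute continuity gives the positivity, and it also
makes the event that the direction is zero negligible.

Under the null hypothesis the coordinate is centred, and a central limit
theorem that is uniform over laws with variance 1 and third absolute moment at
most L gives both tails of the statistic up to an error that vanishes with the
size of the first part ([studentized_tail], [level_bound]). The numerator is
handled by Lindeberg replacement against a smooth step ([lindeberg],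
[smooth_step]). For the denominator a weak law for the squares is needed
although the squares may have infinite variance. It comes from replacing the
square function in Chebyshev's argument by a Huber function
([sum_sqr_lln]). With both tails, the rejection probability is within any
prescribed error of alpha, uniformly over the class. Over a nonempty class the
supremum then has the same limit, and for L >= 2 the class contains the uniform
law on a cube ([calP0_nonempty]). The claim on p-values follows from the upper
tail, because Phi is continuous and nondecreasing.

Under a sparse alternative let M be the largest absolute mean. Off an event of
probability at most 2 d exp (- k (M / 4)^2 / (4 sigma^2)), where k is the size
of the second part, all coordinates of its mean vector are within M / 4 of their
expectations ([muhat2_deviation]). Then the selected coordinate has the right
sign and an absolute mean of at least M / 2, and its standard deviation is at
most a multiple of sigma, so that the studentized mean has a drift of order
sqrt m M / sigma, which tends to infinity ([power_bound]). As M is at least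
K_n sigma sqrt (log d / n) and k is at least a fixed fraction of n, the
exceptional probability is at most 2 d^(1 - c K_n^2) for some c > 0, and this
tends to 0 uniformly in d >= 2 ([power_near]).

A single induction, [iid_sum_le] with its equality form [iid_sum_eq], integrates
out the sample points one by one; the replacement argument, Chebyshev's
inequality, the weak law for the squares, the Chernoff bound and the moments of
the uniform law on the cube are its instances. *)

(** * Sections and sums of an i.i.d. sample *)

Section iid_integral.
Context d (T : measurableType d) (R : realType) (P : probability T R).
Local Open Scope ereal_scope.

Lemma integral_iidS n (F : n.+1.-tuple T -> \bar R) :
  measurable_fun [set: n.+1.-tuple T] F -> (forall X, 0 <= F X) ->
  \int[iid P n.+1]_X F X = \int[P]_x \int[iid P n]_X F (tcons (x, X)).
Proof.
move=> mF F0 /=.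
rewrite ge0_integral_distribution//.
rewrite fubini_tonelli1//.
- exact: measurableT_comp.
- by move=> x /=.
Qed.

Lemma integral_iid0 (F : 0.-tuple T -> \bar R) :
  measurable_fun setT F -> \int[iid P 0]_X F X = F [tuple].
Proof. by move=> mF /=; rewrite integral_dirac// diracT mul1e. Qed.

Lemma measurable_cat m k :
  measurable_fun setT (fun x : m.-tuple T * k.-tuple T => cat_tuple x.1 x.2).
Proof.
apply/measurable_fun_tnthP => i.
case: (split_ordP i) => j ->.
- rewrite (_ : _ \o _ = (fun x : m.-tuple T * k.-tuple T => tnth x.1 j)).
    by apply: (measurableT_comp (measurable_tnth j)); exact: measurable_fst.
  by apply/funext => x /=; rewrite tnth_lshift.
- rewrite (_ : _ \o _ = (fun x : m.-tuple T * k.-tuple T => tnth x.2 j)).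
    by apply: (measurableT_comp (measurable_tnth j)); exact: measurable_snd.
  by apply/funext => x /=; rewrite tnth_rshift.
Qed.

Lemma measurable_catl m k (W : k.-tuple T) :
  measurable_fun setT (fun Z : m.-tuple T => cat_tuple Z W).
Proof. exact: (measurableT_comp (@measurable_cat m k) (pair2_measurable W)). Qed.

Lemma measurable_tconsl n (x : T) :
  measurable_fun setT (fun X : n.-tuple T => tcons (x, X)).
Proof. exact: (measurableT_comp (@measurable_tcons _ T n) (pair1_measurable x)). Qed.

(** Induction on the length of the first part: its head is peeled off on both sides and
moved across the integral over the second part by Tonelli's theorem. *)
Lemma integral_iid_cat m k (F : (m + k).-tuple T -> \bar R) :
  measurable_fun setT F -> (forall X, 0 <= F X) ->
  \int[iid P (m + k)]_X F X =
  \int[iid P k]_W \int[iid P m]_Z F (cat_tuple Z W).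
Proof.
elim: m F => [|m IH] F mF F0.
  apply: eq_integral => W _; rewrite integral_iid0.
    by congr F; exact/val_inj.
  exact: (measurableT_comp mF (@measurable_catl 0 k (W : k.-tuple T))).
have mcons x : measurable_fun setT (fun X : (m + k).-tuple T => F (tcons (x, X))).
  exact: (measurableT_comp mF (@measurable_tconsl (m + k) x)).
rewrite (@integral_iidS (m + k))//.
under eq_integral => x _ do rewrite (IH (fun X => F (tcons (x, X))))//.
have mcc : measurable_fun setT
    (fun z : (T * k.-tuple T) * m.-tuple T => F (tcons (z.1.1, cat_tuple z.2 z.1.2))).
  have mZW : measurable_fun setT
      (fun z : (T * k.-tuple T) * m.-tuple T => (z.2, z.1.2)).
    apply: measurable_fun_pair; first exact: measurable_snd.
    exact: (measurableT_comp measurable_snd measurable_fst).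
  have mxZW : measurable_fun setT
      (fun z : (T * k.-tuple T) * m.-tuple T => (z.1.1, cat_tuple z.2 z.1.2)).
    apply: measurable_fun_pair.
      exact: (measurableT_comp measurable_fst measurable_fst).
    exact: (measurableT_comp (@measurable_cat m k) mZW).
  exact: (measurableT_comp mF
    (measurableT_comp (@measurable_tcons _ T (m + k)) mxZW)).
rewrite (fubini_tonelli (fun xW : T * k.-tuple T =>
  \int[iid P m]_X F (tcons (xW.1, cat_tuple X xW.2)))); last 2 first.
- exact: (measurable_fun_fubini_tonelli_F (m2 := iid P m) _ mcc).
- by move=> x; exact: integral_ge0.
apply: eq_integral => W _ /=.
rewrite integral_iidS//; last first.
  exact: (measurableT_comp mF (@measurable_catl m.+1 k (W : k.-tuple T))).
apply: eq_integral => x _; apply: eq_integral => Z _.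
by congr F; exact/val_inj.
Qed.

(** Conditioning on the second part of the sample: a bound for the first part that is
uniform in the second one, off an exceptional event, survives integration. This is how
the data-dependent direction is frozen. *)
Lemma iid_cat_le m k (A : set ((m + k).-tuple T)) (B : set (k.-tuple T)) (c : R) :
  measurable A -> measurable B -> (0 <= c)%R ->
  (forall W, ~ B W -> iid P m [set Z | A (cat_tuple Z W)] <= c%:E) ->
  iid P (m + k) A <= c%:E + iid P k B.
Proof.
move=> mA mB c0 AB.
have mcA W : measurable [set Z : m.-tuple T | A (cat_tuple Z W)].
  by rewrite -[X in measurable X]setTI; exact: measurable_catl.
rewrite (_ : iid P (m + k) A = \int[iid P (m + k)]_X (\1_A X)%:E); last first.
  by rewrite integral_indic// setIT.
rewrite (integral_iid_cat (F := fun X => (\1_A X)%:E))//; last first.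
  by apply/measurable_EFinP; exact: measurable_indic.
rewrite (_ : c%:E + _ = \int[iid P k]_W (c + \1_B W)%:E); last first.
  under eq_integral do rewrite EFinD.
  rewrite ge0_integralD//; last first.
    by apply/measurable_EFinP; exact: measurable_indic.
  rewrite integral_indic// setIT; congr (_ + _).
  rewrite integral_cst// -[LHS]mule1; congr (_ * _).
  exact/esym/(@probability_setT _ _ _ (iid P k)).
apply: ge0_le_integral => //.
- by move=> W _; apply: integral_ge0 => Z _; rewrite lee_fin.
- apply: (measurable_fun_fubini_tonelli_F (m2 := iid P m)
    (fun WZ => (\1_A (cat_tuple WZ.2 WZ.1))%:E)) => [|WZ]; last by rewrite lee_fin.
  apply/measurable_EFinP; apply: (measurableT_comp (measurable_indic mA)).
  exact: (measurableT_comp (@measurable_cat m k)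
    (measurable_fun_pair measurable_snd measurable_fst)).
- by apply/measurable_EFinP; apply: measurable_funD => //; exact: measurable_indic.
move=> W _.
rewrite (eq_integral (fun Z => (\1_[set Z | A (cat_tuple Z W)] Z)%:E))//.
rewrite integral_indic// setIT.
rewrite indicE; have [WB|WB] := boolP (W \in B).
  rewrite (le_trans (probability_le1 _ _))//.
  by rewrite lee_fin lerDr.
by rewrite addr0; apply: AB => /mem_set; rewrite (negbTE WB).
Qed.
End iid_integral.

Section iid_sum.
Context d (T : measurableType d) (R : realType) (P : probability T R).
Local Open Scope ereal_scope.

Lemma measurable_sum_tnth n (h : 'I_n -> T -> R) :
  (forall i, measurable_fun setT (h i)) ->
  measurable_fun setT (fun X : n.-tuple T => \sum_(i < n) h i (tnth X i))%R.
Proof.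
move=> mh; apply: (@measurable_sum _ _ _ _ _ _ (fun i X => h i (tnth X i))) => i.
exact: (measurableT_comp (mh i) (measurable_tnth i)).
Qed.

Let S (g : nat -> T -> R) n (X : n.-tuple T) : R :=
  (\sum_(i < n) g (n - i.+1)%N (tnth X i))%R.

Let mS g n : (forall k, measurable_fun setT (g k)) ->
  measurable_fun setT (@S g n).
Proof.
move=> mg; exact: (measurable_sum_tnth (h := fun i : 'I_n => g (n - i.+1)%N)).
Qed.

Let integral_sumS (g : nat -> T -> R) (F : R -> \bar R) n (s : R) :
  (forall k, measurable_fun setT (g k)) -> measurable_fun setT F ->
  (forall t, 0 <= F t) ->
  \int[iid P n.+1]_X F (s + S g X)%R =
  \int[P]_x \int[iid P n]_X F ((s + g n x) + S g X)%R.
Proof.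
move=> mg mF F0; rewrite integral_iidS//; last first.
  apply: measurableT_comp => //; apply: measurable_funD => //; exact: mS.
apply: eq_integral => x _; apply: eq_integral => X _; congr F.
rewrite /S big_ord_recl /= -addrA subn1 /=; congr (_ + (g _ _ + _))%R.
by apply: eq_bigr => i _; rewrite tnthS.
Qed.

Let measurable_inner (g : nat -> T -> R) (F : R -> \bar R) n (s : R) :
  (forall k, measurable_fun setT (g k)) -> measurable_fun setT F ->
  (forall t, 0 <= F t) ->
  measurable_fun setT (fun x => \int[iid P n]_X F ((s + g n x) + S g X)%R).
Proof.
move=> mg mF F0.
apply: (measurable_fun_fubini_tonelli_F (m2 := iid P n)
  (fun xX => F ((s + g n xX.1) + S g xX.2)%R)) => //.
apply: (measurableT_comp mF); apply: measurable_funD.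
  apply: measurable_funD => //; exact: (measurableT_comp (mg n) measurable_fst).
exact: (measurableT_comp (mS mg) measurable_snd).
Qed.

(** F k s plays the role of a bound for the expectation of F 0 at the final sum, given that
the partial sum is s and that k summands are still to come; this is why indices are
counted from the end of the sample. A single step of this backward recursion involves a
single draw from P. *)
Lemma iid_sum_le (g : nat -> T -> R) (F : nat -> R -> \bar R) :
  (forall k, measurable_fun setT (g k)) ->
  (forall k, measurable_fun setT (F k)) -> (forall k s, 0 <= F k s) ->
  (forall k s, \int[P]_x F k (s + g k x)%R <= F k.+1 s) ->
  forall n s, \int[iid P n]_X
    F 0%N (s + \sum_(i < n) g (n - i.+1)%N (tnth X i))%R <= F n s.
Proof.
move=> mg mF F0 FS; elim=> [|n IH] s.
  rewrite integral_iid0 ?big_ord0 ?addr0//.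
  apply: measurableT_comp => //; apply: measurable_funD => //; exact: mS.
have := integral_sumS n s mg (mF 0%N) (F0 0%N); rewrite /S => ->.
apply: le_trans (FS n s).
apply: ge0_le_integral => //.
- by move=> x _; exact: integral_ge0.
- exact: (measurable_inner n s mg (mF 0%N) (F0 0%N)).
- by apply: measurableT_comp => //; exact: measurable_funD.
Qed.

Lemma iid_sum_eq (g : nat -> T -> R) (F : nat -> R -> \bar R) :
  (forall k, measurable_fun setT (g k)) ->
  (forall k, measurable_fun setT (F k)) -> (forall k s, 0 <= F k s) ->
  (forall k s, \int[P]_x F k (s + g k x)%R = F k.+1 s) ->
  forall n s, \int[iid P n]_X
    F 0%N (s + \sum_(i < n) g (n - i.+1)%N (tnth X i))%R = F n s.
Proof.
move=> mg mF F0 FS; elim=> [|n IH] s.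
  rewrite integral_iid0 ?big_ord0 ?addr0//.
  apply: measurableT_comp => //; apply: measurable_funD => //; exact: mS.
have := integral_sumS n s mg (mF 0%N) (F0 0%N); rewrite /S => ->.
by rewrite -FS; apply: eq_integral => x _; rewrite IH.
Qed.

End iid_sum.

(** * Gaussian integrals *)

Section density.
Context d (T : measurableType d) (R : realType).
Context (nu : {finite_measure set T -> \bar R})
  (mu : {sigma_finite_measure set T -> \bar R}) (p : T -> R).
Local Open Scope ereal_scope.
Context (mp : measurable_fun setT p) (p0 : forall x, (0 <= p x)%R)
  (nup : forall A, measurable A -> nu A = \int[mu]_(x in A) (p x)%:E).

Let mpE : measurable_fun setT (fun x => (p x)%:E).
Proof. exact/measurable_EFinP. Qed.

(** Both p and the Radon-Nikodym derivative integrate to nu over every measurable set, so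
they agree almost everywhere. *)
Lemma ge0_integral_density (f : T -> \bar R) :
  measurable_fun setT f -> (forall x, 0 <= f x) ->
  \int[nu]_x f x = \int[mu]_x (f x * (p x)%:E).
Proof.
move=> mf f0.
have numu : nu `<< mu.
  apply/null_content_dominatesP => A mA muA0; rewrite nup//.
  by apply: null_set_integral => //; exact: measurable_funTS.
rewrite -(Radon_Nikodym_SigmaFinite.change_of_variables numu)//.
have RNi := Radon_Nikodym_SigmaFinite.f_integrable numu.
have mRN := measurable_int _ RNi.
have RN0 := Radon_Nikodym_SigmaFinite.f_ge0 numu.
apply: ge0_ae_eq_integral => //.
- exact: emeasurable_funM.
- exact: emeasurable_funM.
- by move=> x _; rewrite mule_ge0.
- by move=> x _; rewrite mule_ge0// lee_fin.
have := integral_ae_eq measurableT RNi mpE.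
move=> /(_ _)[|N [mN N0 subN]].
  move=> E _ mE.
  by rewrite -nup// (Radon_Nikodym_SigmaFinite.f_integral numu).
exists N; split => // x /= fx; apply: subN => /= px; apply: fx => _.
by rewrite px.
Qed.

End density.

Section lebesgue_translation.
Context (R : realType).
Local Open Scope ereal_scope.
Notation mu := (@lebesgue_measure R).

Definition translation (c : R) : measurableTypeR R -> measurableTypeR R :=
  fun x => (x + c)%R.

Lemma measurable_translation c : measurable_fun setT (translation c).
Proof. exact: measurable_funD. Qed.

HB.instance Definition _ c :=
  @isMeasurableFun.Build _ _ _ _ (translation c) (measurable_translation c).

Lemma lebesgue_measure_translation (c : R) (A : set R) : measurable A ->
  pushforward mu (translation c) A = mu A.
Proof.
move=> mA; apply/esym/lebesgue_measure_unique => //= _ [[a b]] _ <-.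
rewrite /pushforward.
rewrite (_ : translation c @^-1` _ = `](a - c)%R, (b - c)%R]%classic).
  rewrite !lebesgue_measure_itv/= !lte_fin ltrD2r.
  by case: ifPn => // _; rewrite -!EFinD opprB addrA subrK.
apply/funext => x; apply/propext.
by rewrite /= /translation !in_itv/= ltrBlDr lerBrDr.
Qed.

Lemma ge0_integral_translation (c : R) (f : R -> \bar R) :
  measurable_fun setT f -> (forall x, 0 <= f x) ->
  \int[mu]_x f (x + c)%R = \int[mu]_x f x.
Proof.
move=> mf f0.
transitivity (\int[pushforward mu (translation c)]_x f x).
  by rewrite ge0_integral_pushforward.
by apply: eq_measure_integral => //= A mA _; exact: lebesgue_measure_translation.
Qed.

Lemma ge0_integral_reflection (f : R -> \bar R) :
  measurable_fun setT f -> (forall x, 0 <= f x) ->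
  \int[mu]_x f (- x)%R = \int[mu]_x f x.
Proof.
move=> mf f0.
transitivity (\int[pushforward mu (-%R : _ -> measurableTypeR R)]_x f x).
  by rewrite ge0_integral_pushforward.
by apply: eq_measure_integral => //= A mA _; exact: lebesgue_measureN.
Qed.

End lebesgue_translation.

Section gaussian_laws.
Context (R : realType).
Local Open Scope ereal_scope.
Notation mu := (@lebesgue_measure R).
Notation N := (@normal_prob R 0%R).
Implicit Types s x y z : R.

Lemma ge0_integral_normal s (f : R -> \bar R) :
  measurable_fun setT f -> (forall x, 0 <= f x) ->
  \int[N s]_x f x = \int[mu]_x (f x * (normal_pdf 0 s x)%:E).
Proof.
move=> mf f0; apply: ge0_integral_density => //.
- exact: measurable_normal_pdf.
- exact: normal_pdf_ge0.
Qed.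

(** Completing the square in x: the joint density of the first summand and the sum is the
density of the sum times the conditional density of the first summand. *)
Lemma normal_pdf_conv s1 s2 s3 x z : (0 < s1)%R -> (0 < s2)%R -> (0 < s3)%R ->
  (s3 ^+ 2 = s1 ^+ 2 + s2 ^+ 2)%R ->
  (normal_pdf 0 s1 x * normal_pdf 0 s2 (z - x) =
   normal_pdf 0 s3 z * normal_pdf (s1 ^+ 2 / s3 ^+ 2 * z) (s1 * s2 / s3) x)%R.
Proof.
move=> s10 s20 s30 s3E.
have n1 := lt0r_neq0 s10; have n2 := lt0r_neq0 s20; have n3 := lt0r_neq0 s30.
rewrite !normal_pdfE//; last by rewrite mulf_neq0 ?invr_neq0 ?mulf_neq0.
rewrite mulrACA [RHS]mulrACA; congr (_ * _)%R.
  rewrite /normal_peak -!invfM; congr (_^-1)%R.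
  have pi0 := @pi_gt0 R.
  rewrite -!sqrtrM ?mulrn_wge0 ?mulr_ge0 ?sqr_ge0 ?ltW//.
  congr (Num.sqrt _).
  move: (pi : R) => p; rewrite expr_div_n exprMn !mulr2n.
  by field.
rewrite /normal_fun -!expRD; congr expR.
rewrite !expr_div_n exprMn s3E !mulr2n; field.
by rewrite !lt0r_neq0 ?addr_gt0 ?exprn_gt0 ?mulr_gt0.
Qed.

(** After the translation y = z - x and an exchange of integrals, the conditional density of
[normal_pdf_conv] integrates to 1. *)
Lemma normal_convolution s1 s2 s3 (f : R -> \bar R) :
  (0 < s1)%R -> (0 < s2)%R -> (0 < s3)%R ->
  (s3 ^+ 2 = s1 ^+ 2 + s2 ^+ 2)%R ->
  measurable_fun setT f -> (forall x, 0 <= f x) ->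
  \int[N s1]_x \int[N s2]_y f (x + y)%R = \int[N s3]_z f z.
Proof.
move=> s10 s20 s30 s3E mf f0.
have mp m s := @measurable_normal_pdf R m s.
have p0 m s x := @normal_pdf_ge0 R m s x.
have mpE m s : measurable_fun setT (fun x => (normal_pdf m s x)%:E).
  exact/measurable_EFinP.
transitivity (\int[mu]_x \int[mu]_z
    (f z * (normal_pdf 0 s1 x * normal_pdf 0 s2 (z - x))%:E)).
  rewrite ge0_integral_normal//; last 2 first.
  - have := @measurable_fun_fubini_tonelli_F _ _
      (measurableTypeR R) (measurableTypeR R) R (N s2)
      (fun xy => f (xy.1 + xy.2)%R); apply => //.
    by apply: (measurableT_comp mf); apply: measurable_funD.
  - by move=> x; exact: integral_ge0.
  apply: eq_integral => x _.
  rewrite ge0_integral_normal//; last first.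
    by apply: (measurableT_comp mf); apply: measurable_funD.
  have mg : measurable_fun setT (fun z => f z * (normal_pdf 0 s2 (z - x))%:E).
    apply: emeasurable_funM => //; apply/measurable_EFinP.
    by apply: (measurableT_comp (mp _ _)); exact: measurable_funB.
  (* The substitution y = z - x in the inner integral. *)
  rewrite -(@ge0_integral_translation _ x (fun z => f z * (normal_pdf 0 s1 x * normal_pdf 0 s2 (z - x))%:E)); last 2 first.
  - apply: emeasurable_funM => //; apply/measurable_EFinP.
    apply: measurable_funM => //.
    by apply: (measurableT_comp (mp _ _)); exact: measurable_funB.
  - by move=> z; rewrite mule_ge0// lee_fin mulr_ge0.
  rewrite -ge0_integralZr//.
  + apply: eq_integral => y _; rewrite addrK EFinM (addrC y) -!muleA.
    by congr (_ * _); rewrite muleC.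
  + apply: emeasurable_funM; last exact: mpE.
    by apply: (measurableT_comp mf); apply: measurable_funD.
  + by move=> y _; rewrite mule_ge0// lee_fin.
  + by rewrite lee_fin.
rewrite (fubini_tonelli (m1 := mu) (m2 := mu)
  (fun xz : measurableTypeR R * measurableTypeR R => f xz.2 *
    (normal_pdf 0 s1 xz.1 * normal_pdf 0 s2 (xz.2 - xz.1))%:E)); last 2 first.
- apply: emeasurable_funM; first exact: (measurableT_comp mf measurable_snd).
  apply/measurable_EFinP; apply: measurable_funM.
    exact: (measurableT_comp (mp _ _) measurable_fst).
  by apply: (measurableT_comp (mp _ _)); exact: measurable_funB.
- by move=> xz; rewrite mule_ge0// lee_fin mulr_ge0.
rewrite ge0_integral_normal//; apply: eq_integral => z _ /=.
under eq_integral do rewrite (normal_pdf_conv _ _ s10 s20 s30 s3E) EFinM muleA.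
rewrite ge0_integralZl//.
- by rewrite integral_normal_pdf mule1.
- exact: mpE.
- by move=> x _; rewrite lee_fin.
- by rewrite mule_ge0// lee_fin.
Qed.

End gaussian_laws.

Lemma is_derive_continuous (R : realType) (f : R -> R) (x a : R) :
  is_derive x (1 : R) f a -> {for x, continuous f}.
Proof. by case=> df _; exact/differentiable_continuous/derivable1_diffP. Qed.

Lemma ge0_integral_antiderivative (R : realType) (f F : R -> R) (l : R) :
  (forall x, 0 <= x -> 0 <= f x) -> continuous f ->
  (forall x, is_derive x (1 : R) F (f x)) -> F x @[x --> +oo%R] --> l ->
  (\int[@lebesgue_measure R]_(x in `[0%R, +oo[) (f x)%:E = (l - F 0)%:E)%E.
Proof.
move=> f0 cf dF Fl; rewrite (@ge0_continuous_FTC2y _ f F 0 l)//.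
- exact: continuous_subspaceT.
- exact/cvg_at_right_filter/(is_derive_continuous (dF 0)).
- by move=> x _; rewrite derive1E; have [_ ->] := dF x.
Qed.

Section gaussian_moments.
Context (R : realType).
Local Open Scope ereal_scope.
Notation mu := (@lebesgue_measure R).
Notation N := (@normal_prob R 0%R).
Context (s : R) (s0 : (0 < s)%R).

Let p := @normal_pdf R 0 s.
Let k : R := normal_peak s.
Let k0 : (0 < k)%R. Proof. by apply: normal_peak_gt0; rewrite gt_eqF. Qed.

Let pE x : p x = (k * expR (- (x ^+ 2 / (s ^+ 2 *+ 2))))%R.
Proof. by rewrite /p normal_pdfE ?gt_eqF// /normal_fun subr0 mulNr. Qed.

Let ss0 : (0 < s ^+ 2)%R. Proof. exact: exprn_gt0. Qed.

Let p_le c x : (p x <= k * expR (c ^+ 2 * s ^+ 2 / 2) * expR (- (c * x)))%R.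
Proof.
rewrite pE -mulrA -expRD ler_pM2l// ler_expR mulr2n -subr_ge0.
rewrite (_ : _ - _ = (x - c * s ^+ 2) ^+ 2 / (s ^+ 2 + s ^+ 2))%R.
  by rewrite divr_ge0 ?sqr_ge0// addr_ge0// ltW.
by field; rewrite !gt_eqF ?addr_gt0.
Qed.

Let is_derive_p (x : R) : is_derive x (1%R : R) p (- (x / s ^+ 2) * p x)%R.
Proof.
have -> : p = (fun x => k * expR (- (x ^+ 2 / (s ^+ 2 *+ 2))))%R.
  by apply/funext => y; exact: pE.
have H : is_derive x (1%R : R) (fun x => - (x ^+ 2 / (s ^+ 2 *+ 2)))%R (- (x / s ^+ 2))%R.
  apply: is_derive_eq.
  rewrite scaler0 add0r -[x%:A]/(x * 1)%R mulr1 -[_ *: _]/(_ * _)%R mulr2n.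
  by field; rewrite !gt_eqF ?addr_gt0.
have H1 := is_derive1_comp (is_derive_expR _) H.
have H2 := is_deriveZ k H1.
apply: (is_derive_eq H2).
by rewrite -[_ *: _]/(_ * _)%R; ring.
Qed.

Let continuous_p : continuous p.
Proof. by apply: continuous_normal_pdf; rewrite gt_eqF. Qed.

Let K : R := (k * expR (s ^+ 2 / 2))%R.
Let K0 : (0 < K)%R. Proof. by rewrite mulr_gt0 ?expR_gt0. Qed.

Let is_derive_KexpN (x : R) :
  is_derive x (1%R : R) (fun x => - (s ^+ 2 * K * expR (- x)))%R
    (s ^+ 2 * K * expR (- x))%R.
Proof.
have H := is_derive1_comp (is_derive_expR (- x)) (is_deriveN (is_derive_id x (1%R : R))).
have H2 := is_deriveN (is_deriveZ (s ^+ 2 * K)%R H).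
apply: (is_derive_eq H2).
by rewrite -[_ *: _]/(_ * _)%R; ring.
Qed.

Let continuous_KexpN : continuous (fun x => s ^+ 2 * K * expR (- x))%R.
Proof.
move=> x; rewrite (_ : (fun _ => _) = - (fun x => - (s ^+ 2 * K * expR (- x))))%R.
  exact/continuousN/(is_derive_continuous (is_derive_KexpN x)).
by apply/funext => y; rewrite /= opprK.
Qed.

Let cvg_KexpN (c : R) : (c * expR (- x))%R @[x --> +oo%R] --> (0%R : R).
Proof. by rewrite -(mulr0 c); apply: cvgMr; exact: cvgr_expR. Qed.

Let integral_KexpN :
  \int[mu]_(x in `[0%R, +oo[) (s ^+ 2 * K * expR (- x))%:E = (s ^+ 2 * K)%:E.
Proof.
rewrite (ge0_integral_antiderivative _ continuous_KexpN is_derive_KexpN (l := 0%R)).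
- by rewrite oppr0 expR0 mulr1 sub0r opprK.
- by move=> x _; rewrite !mulr_ge0 ?expR_ge0// ltW.
- by rewrite -oppr0; apply: cvgN; exact: cvg_KexpN.
Qed.

Let f x := ((x ^+ 2 - s ^+ 2) * p x + s ^+ 2 * K * expR (- x))%R.

Let f_ge0 x : (0 <= f x)%R.
Proof.
have := p_le 1 x; rewrite expr1n !mul1r -/K => pK.
have p0 : (0 <= p x)%R by exact: normal_pdf_ge0.
have : (s ^+ 2 * p x <= s ^+ 2 * (K * expR (- x)))%R by rewrite ler_pM2l.
by rewrite /f; have := mulr_ge0 (sqr_ge0 x) p0; lra.
Qed.

Let is_derive_F (x : R) :
  is_derive x (1%R : R)
    (fun x => - (s ^+ 2 * (x * p x)) + - (s ^+ 2 * K * expR (- x)))%R (f x).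
Proof.
have H := is_deriveN (is_deriveZ (s ^+ 2) (is_deriveM (is_derive_id x (1%R : R)) (is_derive_p x))).
have H2 := is_deriveD H (is_derive_KexpN x).
apply: (is_derive_eq H2).
rewrite -![_ *: _]/(_ * _)%R /f; field.
by rewrite gt_eqF.
Qed.

Let continuous_f : continuous f.
Proof.
move=> x; apply: (@cvgD _ R^o); last exact: continuous_KexpN.
apply: cvgM; last exact: continuous_p.
by apply: (@cvgB _ R^o); [exact: sqr_continuous|exact: cvg_cst].
Qed.

Let cvg_xp : (x * p x)%R @[x --> +oo%R] --> (0%R : R).
Proof.
apply: (@squeeze_cvgr _ _ _ _ (cst 0%R) (fun x => k * expR (2 ^+ 2 * s ^+ 2 / 2) * expR (- x))%R).
- near=> x; have x0 : (0 <= x)%R by near: x; exact: nbhs_pinfty_ge.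
  rewrite /= mulr_ge0 ?normal_pdf_ge0//=.
  have xe : (x <= expR x)%R by have := expR_ge1Dx x; lra.
  apply: (le_trans (ler_pM _ _ xe (p_le 2 x))) => //; first exact: normal_pdf_ge0.
  by rewrite mulrCA -expRD ler_pM2l ?mulr_gt0 ?expR_gt0// ler_expR; lra.
- exact: cvg_cst.
- exact: cvg_KexpN.
Unshelve. all: by end_near. Qed.

Let integral_f : \int[mu]_(x in `[0%R, +oo[) (f x)%:E = (s ^+ 2 * K)%:E.
Proof.
rewrite (ge0_integral_antiderivative _ continuous_f is_derive_F (l := 0%R)).
- by rewrite mul0r mulr0 oppr0 expR0 mulr1 !sub0r opprK.
- by move=> x _; exact: f_ge0.
- rewrite (_ : 0%R = (- (s ^+ 2 * 0) + - 0)%R); last by rewrite mulr0 oppr0 addr0.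
  apply: (@cvgD _ R^o); apply: cvgN; last exact: cvg_KexpN.
  by apply: cvgMr; exact: cvg_xp.
Qed.

Let integral_p_half :
  2%:E * \int[mu]_(x in `[0%R, +oo[) (p x)%:E = 1.
Proof.
rewrite -(integral_normal_pdf 0 s) [RHS]ge0_symfun_integralT//.
- by rewrite -set_itvcy.
- exact: normal_pdf_ge0.
- by move=> x; rewrite /= -!/(p _) !pE sqrrN.
Qed.

(** (x^2 - s^2) p x has the antiderivative - s^2 x p x, which vanishes at 0 and at infinity.
Adding s^2 K expR (- x), which dominates s^2 p x on the half-line, makes the integrand
nonnegative, as the fundamental theorem requires; that term is subtracted afterwards. *)
Lemma normal_sqr : \int[N s]_x (x ^+ 2)%:E = (s ^+ 2)%:E.
Proof.
have mp : measurable_fun setT p by exact: measurable_normal_pdf.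
have p0 x : (0 <= p x)%R by exact: normal_pdf_ge0.
have mx2p : measurable_fun setT (fun x : R => x ^+ 2 * p x)%R.
  by apply: measurable_funM => //; exact: measurable_funX.
have mK : measurable_fun setT (fun x : R => s ^+ 2 * K * expR (- x))%R.
  exact: continuous_measurable_fun continuous_KexpN.
have mf : measurable_fun setT f by exact: continuous_measurable_fun continuous_f.
have fE : \int[mu]_(x in `[0%R, +oo[) (f x)%:E +
    (s ^+ 2)%:E * \int[mu]_(x in `[0%R, +oo[) (p x)%:E =
    \int[mu]_(x in `[0%R, +oo[) (x ^+ 2 * p x)%:E + (s ^+ 2 * K)%:E.
  rewrite -integral_KexpN -ge0_integralZl//=; last 3 first.
  - by apply/measurable_EFinP; exact: measurable_funTS.
  - by move=> x _; rewrite lee_fin.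
  - by rewrite lee_fin ltW.
  rewrite -!ge0_integralD//=.
  - by apply: eq_integral => x _; rewrite -EFinM -!EFinD /f; congr EFin; ring.
  - by move=> x _; rewrite lee_fin mulr_ge0// sqr_ge0.
  - by apply/measurable_EFinP; exact: measurable_funTS.
  - by move=> x _; rewrite lee_fin !mulr_ge0 ?expR_ge0// ltW.
  - by apply/measurable_EFinP; exact: measurable_funTS.
  - by move=> x _; rewrite lee_fin.
  - by apply/measurable_EFinP; exact: measurable_funTS.
  - by move=> x _; rewrite mule_ge0// lee_fin// ltW.
  - by apply: emeasurable_funM => //; apply/measurable_EFinP; exact: measurable_funTS.
move: fE; rewrite integral_f addeC => /(congr1 (fun t => t - (s ^+ 2 * K)%:E)).
rewrite !addeK// => fE.
rewrite ge0_integral_normal//; last 2 first.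
- by apply/measurable_EFinP; exact: measurable_funX.
- by move=> x; rewrite lee_fin sqr_ge0.
under eq_integral do rewrite -EFinM.
rewrite ge0_symfun_integralT//.
- by rewrite -set_itvcy// -fE// muleCA integral_p_half mule1.
- by move=> x; rewrite mulr_ge0// sqr_ge0.
- by move=> x; apply: cvgM; [exact: sqr_continuous|exact: continuous_p].
- by move=> x; rewrite /= -!/(p _) !pE sqrrN.
Qed.

Let abs3_le (t : R) : (`|t| ^+ 3 <= 32 * s ^+ 3 * expR (t ^+ 2 / (4 * s ^+ 2)))%R.
Proof.
pose u := (`|t| / s)%R.
have u0 : (0 <= u)%R by rewrite divr_ge0// ltW.
have -> : (`|t| ^+ 3 = s ^+ 3 * u ^+ 3)%R.
  by rewrite /u expr_div_n mulrCA divff ?mulr1// expf_neq0// gt_eqF.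
have -> : (t ^+ 2 / (4 * s ^+ 2) = u ^+ 2 / 4)%R.
  rewrite /u expr_div_n -[(t ^+ 2)%R]real_normK ?num_real//; field.
  by rewrite gt_eqF.
rewrite [leRHS](_ : _ = s ^+ 3 * (32 * expR (u ^+ 2 / 4)))%R; last by ring.
rewrite ler_pM2l ?exprn_gt0//.
have := @expR_ge1Dxn R (u ^+ 2 / 4) 1 _; rewrite divr_ge0 ?sqr_ge0// => /(_ isT).
rewrite (_ : 2`! = 2)%N//.
have : (u ^+ 3 <= 1 + u ^+ 4)%R by nra.
move=> h1 h2; have := sqr_ge0 u; nra.
Qed.

(** Only the order s^3 matters: the cube is absorbed by a factor exp (x^2 / (4 s^2)), which
turns the density into one of variance 2 s^2. *)
Lemma normal_abs3 : \int[N s]_x (`|x| ^+ 3)%:E <= (64 * s ^+ 3)%:E.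
Proof.
pose s' := (s * Num.sqrt 2)%R.
have s'0 : (0 < s')%R by rewrite mulr_gt0// sqrtr_gt0.
have s'2 : (s' ^+ 2 = 2 * s ^+ 2)%R by rewrite exprMn sqr_sqrtr// mulrC.
have mabs3 : measurable_fun [set: R] (fun x : R => (`|x| ^+ 3)%:E).
  by apply/measurable_EFinP; apply: measurable_funX; exact: normr_measurable.
rewrite ge0_integral_normal//.
have -> : (64 * s ^+ 3)%:E = (64 * s ^+ 3)%:E * \int[mu]_x (normal_pdf 0 s' x)%:E.
  by rewrite integral_normal_pdf mule1.
have s30 : (0 < s ^+ 3)%R by rewrite exprn_gt0.
have mpdf t : measurable_fun [set: R] (fun x => (normal_pdf 0 t x)%:E).
  by apply/measurable_EFinP; exact: measurable_normal_pdf.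
rewrite -ge0_integralZl//; last 3 first.
- exact: mpdf.
- by move=> x _; rewrite lee_fin normal_pdf_ge0.
- by rewrite lee_fin; lra.
apply: ge0_le_integral => //.
- by move=> x _; rewrite lee_fin mulr_ge0 ?normal_pdf_ge0// exprn_ge0.
- by apply: emeasurable_funM; [exact: mabs3|exact: mpdf].
- by apply: emeasurable_funM => //; exact: mpdf.
move=> x _; rewrite -!EFinM lee_fin.
have pk : (k = Num.sqrt 2 * normal_peak s')%R.
  rewrite /k /normal_peak s'2 (_ : 2 * _ * _ *+ 2 = 2 * (s ^+ 2 * pi *+ 2))%R; last by ring.
  by rewrite (@sqrtrM _ 2)// invfM mulrA divff ?mul1r// gt_eqF// sqrtr_gt0.
rewrite -/(p x) pE pk normal_pdfE ?gt_eqF// /normal_fun subr0 s'2.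
have q2 : (Num.sqrt 2 <= 2 :> R)%R.
  have := @sqr_sqrtr R 2; rewrite ler0n => /(_ isT); have := sqrtr_ge0 (2 : R).
  by move: (Num.sqrt 2) => q; nra.
have k'0 := normal_peak_ge0 s'.
have := ler_wpM2r (expR_ge0 (- (x ^+ 2 / (s ^+ 2 *+ 2)))) (abs3_le x).
rewrite -[X in (_ <= X)%R -> _]mulrA -expRD.
rewrite (_ : x ^+ 2 / (4 * s ^+ 2) - x ^+ 2 / (s ^+ 2 *+ 2) = - x ^+ 2 / (2 * s ^+ 2 *+ 2))%R; last first.
  by rewrite !mulr2n; field; rewrite ?gt_eqF ?addr_gt0// mulr_gt0.
set e1 := expR _; set e2 := expR _ => h.
rewrite (_ : `|x| ^+ 3 * (_) = (Num.sqrt 2 * normal_peak s') * (`|x| ^+ 3 * e1))%R; last by ring.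
apply: (@le_trans _ _ (2 * normal_peak s' * (32 * s ^+ 3 * e2))%R).
  apply: ler_pM => //.
  - by rewrite mulr_ge0.
  - by rewrite mulr_ge0 ?exprn_ge0// expR_ge0.
  - by rewrite ler_wpM2r.
by rewrite le_eqVlt; apply/orP; left; apply/eqP; ring.
Qed.

Lemma ge0_normal_reflection (h : R -> \bar R) :
  measurable_fun setT h -> (forall x, 0 <= h x) ->
  \int[N s]_x h (- x)%R = \int[N s]_x h x.
Proof.
move=> mh h0; have mh' : measurable_fun setT (fun x : R => h (- x)%R).
  exact: measurableT_comp.
have mpE : measurable_fun setT (fun x => (p x)%:E).
  by apply/measurable_EFinP; exact: measurable_normal_pdf.
rewrite !ge0_integral_normal// -[RHS](@ge0_integral_reflection R (fun x => h x * (normal_pdf 0 s x)%:E)).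
- by apply: eq_integral => x _; rewrite -!/(p _) !pE sqrrN.
- exact: emeasurable_funM.
- by move=> x; rewrite mule_ge0// lee_fin normal_pdf_ge0.
Qed.

End gaussian_moments.

(** * Lindeberg replacement *)

(** The variance is prescribed and the third absolute moment only bounded: uniformity over
these laws is what makes the limit theorems independent of the dimension. *)
Definition moments d (T : measurableType d) (R : realType) (P : probability T R)
    (g : T -> R) (v l : R) :=
  [/\ measurable_fun setT g, P.-integrable setT (EFin \o g),
      (\int[P]_x (g x)%:E = 0)%E, (\int[P]_x (g x ^+ 2)%:E = v%:E)%E &
      (\int[P]_x (`|g x| ^+ 3)%:E <= l%:E)%E].

Lemma integral_probability_cst d (T : measurableType d) (R : realType)
  (P : probability T R) (c : R) : (\int[P]_x c%:E = c%:E)%E.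
Proof.
rewrite integral_cst// -[RHS]mule1; congr (_ * _)%E; exact: probability_setT.
Qed.

Lemma ge0_integral_addcst d (T : measurableType d) (R : realType)
  (P : probability T R) (h : T -> \bar R) (c : R) :
  measurable_fun setT h -> (forall x, 0 <= h x)%E -> 0 <= c ->
  (\int[P]_x (h x + c%:E) = \int[P]_x h x + c%:E)%E.
Proof. by move=> mh h0 c0; rewrite ge0_integralD// integral_probability_cst. Qed.

Section moments.
Context d (T : measurableType d) (R : realType) (P : probability T R).
Local Open Scope ereal_scope.
Implicit Types (g : T -> R).

Let integrable_ge0 (h : T -> R) (c : R) : measurable_fun setT h ->
  (forall x, 0 <= h x)%R -> \int[P]_x (h x)%:E <= c%:E ->
  P.-integrable setT (EFin \o h).
Proof.
move=> mh h0 hc; apply/integrableP; split; first exact/measurable_EFinP.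
under eq_integral do rewrite /= ger0_norm//.
exact: le_lt_trans hc (ltry _).
Qed.

Lemma moments_integrable g v l : moments P g v l ->
  P.-integrable setT (fun x => (g x ^+ 2)%:E) /\
  P.-integrable setT (fun x => (`|g x| ^+ 3)%:E).
Proof.
move=> [mg _ _ g2 g3]; split.
- apply: (@integrable_ge0 (fun x => g x ^+ 2)%R v).
  + exact: measurable_funX.
  + by move=> x; exact: sqr_ge0.
  + by rewrite g2.
- apply: (@integrable_ge0 (fun x => `|g x| ^+ 3)%R l) => //.
  + by apply: measurable_funX; exact: measurableT_comp.
Qed.

(** A cubic majorant is integrated term by term, and the linear term vanishes because g is
centred. *)
Lemma moments_taylor g v l (f : R -> R) (c a b C : R) :
  moments P g v l -> measurable_fun setT f -> (forall y, 0 <= f y)%R ->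
  (0 <= C)%R ->
  (forall y, f y <= c + a * y + b * y ^+ 2 + C * `|y| ^+ 3)%R ->
  \int[P]_x (f (g x))%:E <= (c + b * v + C * l)%:E.
Proof.
move=> gm mf f0 C0 fle; have [i2 i3] := moments_integrable gm.
have [mg i1 g1 g2 g3] := gm.
have ic : P.-integrable setT (cst c%:E) by exact: finite_measure_integrable_cst.
have i1a : P.-integrable setT (fun x => a%:E * (g x)%:E) by exact: integrableZl.
have i2b : P.-integrable setT (fun x => b%:E * (g x ^+ 2)%:E) by exact: integrableZl.
have i3c : P.-integrable setT (fun x => C%:E * (`|g x| ^+ 3)%:E) by exact: integrableZl.
pose q x := c%:E + a%:E * (g x)%:E + b%:E * (g x ^+ 2)%:E + C%:E * (`|g x| ^+ 3)%:E.
have i12 := integrableD measurableT (integrableD measurableT ic i1a) i2b.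
have iq : P.-integrable setT q by exact: (integrableD measurableT i12 i3c).
apply: (@le_trans _ _ (\int[P]_x q x)).
  apply: ge0_le_integral => //.
  - by move=> x _; rewrite lee_fin.
  - by apply/measurable_EFinP; exact: measurableT_comp.
  - exact: measurable_int iq.
  - by move=> x _; rewrite /q -!EFinM -!EFinD lee_fin.
rewrite integralD// integralD//; last exact: integrableD.
rewrite integralD// !integralZl// g1 g2 mule0 adde0.
rewrite integral_probability_cst -EFinM -EFinD.
by rewrite [leRHS]EFinD leeD2l// EFinM lee_wpmul2l.
Qed.

Lemma momentsZ g v l (c : R) : moments P g v l ->
  moments P (fun x => c * g x)%R (c ^+ 2 * v)%R (`|c| ^+ 3 * l)%R.
Proof.
move=> gm; have [i2 i3] := moments_integrable gm; have [mg i1 g1 g2 g3] := gm.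
split.
- exact: measurable_funM.
- exact: (integrableZl measurableT c i1).
- by under eq_integral do rewrite EFinM; rewrite integralZl// g1 mule0.
- by under eq_integral do rewrite exprMn EFinM; rewrite integralZl// g2 EFinM.
- under eq_integral do rewrite normrM exprMn EFinM.
  by rewrite integralZl// [leRHS]EFinM; exact: lee_wpmul2l.
Qed.

End moments.

Section gaussian_central_limit.
Context (R : realType).
Local Open Scope ereal_scope.
Notation N := (@normal_prob R 0%R).

Lemma moments_normal (s : R) : (0 < s)%R ->
  moments (N s) (fun x => x) (s ^+ 2) (64 * s ^+ 3).
Proof.
move=> s0.
have i2 : (N s).-integrable setT (fun x : R => (1 + x ^+ 2)%:E).
  apply/integrableP; split.
    apply/measurable_EFinP; apply: measurable_funD => //; exact: measurable_funX.
  under eq_integral => x _.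
    rewrite gee0_abs ?lee_fin ?addr_ge0 ?sqr_ge0// EFinD; over.
  rewrite ge0_integralD//; last 2 first.
  - by move=> x _; rewrite lee_fin sqr_ge0.
  - by apply/measurable_EFinP; exact: measurable_funX.
  by rewrite normal_sqr// integral_probability_cst -EFinD ltry.
have i1 : (N s).-integrable setT (EFin \o (fun x : R => x)).
  apply: le_integrable i2 => //; first exact/measurable_EFinP.
  move=> x _; rewrite lee_fin /= [leRHS]ger0_norm ?addr_ge0 ?sqr_ge0//.
  by rewrite ler_norml; apply/andP; split; nra.
split => //.
- have pos : measurable_fun [set: R] (fun x : R => (Num.max x 0)%:E).
    by apply/measurable_EFinP; exact: measurable_maxr.
  have ip : (N s).-integrable setT (fun x : R => (Num.max x 0)%:E).
    apply: le_integrable i1 => // x _; rewrite lee_fin /=.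
    by rewrite maxEge; case: ifPn => // _; rewrite normr0.
  have im : (N s).-integrable setT (fun x : R => (Num.max (- x) 0)%:E).
    apply: le_integrable i1 => //.
      by apply/measurable_EFinP; apply: measurable_maxr => //; exact: measurableT_comp.
    move=> x _; rewrite lee_fin /=.
    by rewrite maxEge; case: ifPn => // _; rewrite ?normr0// normrN.
  transitivity (\int[N s]_x ((Num.max x 0)%:E - (Num.max (- x) 0)%:E)).
    apply: eq_integral => x _; rewrite -EFinB; congr EFin.
    rewrite !maxEge; have [x0|x0] := leP 0%R (x : R); have [y0|y0] := leP 0%R (- (x : R))%R; lra.
  rewrite integralB// (ge0_normal_reflection s0 pos) ?subee//.
    exact: integrable_fin_num.
  by move=> x; rewrite lee_fin le_max lexx orbT.
- exact: normal_sqr.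
- exact: normal_abs3.
Qed.

(** The coefficients a and b are left free because they cancel in the replacement argument;
a piecewise cubic function is then smooth enough. *)
Definition taylor3 (f : R -> R) (C : R) := forall x, exists a b, forall y,
  (`|f (x + y) - f x - a * y - b * y ^+ 2| <= C * `|y| ^+ 3)%R.

(** The expansions of f at x have the same expectation for g and for a centred Gaussian of the
same variance, so that only the remainders are left. The Gaussian integral is bounded
from below through 1 - f, so that [moments_taylor] serves both sides. *)
Lemma lindeberg_swap d (T : measurableType d) (P : probability T R)
    (g : T -> R) (s l : R) (f : R -> R) (C x : R) :
  (0 < s)%R -> moments P g (s ^+ 2) l ->
  measurable_fun setT f -> (forall y, 0 <= f y <= 1)%R ->
  (0 <= C)%R -> taylor3 f C ->
  \int[P]_t (f (x + g t)%R)%:E <=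
  \int[N s]_y (f (x + y)%R)%:E + (C * (l + 64 * s ^+ 3))%:E.
Proof.
move=> s0 gm mf f01 C0 /(_ x)[a [b fab]].
have mfx : measurable_fun [set: R] (fun y => f (x + y)%R).
  by apply: measurableT_comp => //; exact: measurable_funD.
have mf1 : measurable_fun [set: R] (fun y => 1 - f (x + y))%R.
  exact: measurable_funB.
have fle y : (f (x + y) <= f x + a * y + b * y ^+ 2 + C * `|y| ^+ 3)%R.
  by have := fab y; rewrite ler_norml => /andP[_]; lra.
have fge y : (1 - f (x + y) <= 1 - f x + (- a) * y + (- b) * y ^+ 2 + C * `|y| ^+ 3)%R.
  by have := fab y; rewrite ler_norml => /andP[+ _]; lra.
have f0 y : (0 <= f (x + y))%R by have /andP[] := f01 (x + y)%R.
have f1 y : (0 <= 1 - f (x + y))%R by have /andP[] := f01 (x + y)%R; lra.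
apply: (le_trans (moments_taylor gm mfx f0 C0 fle)).
have Nle := moments_taylor (moments_normal s0) mf1 f1 C0 fge.
have Nf : \int[N s]_y (f (x + y)%R)%:E + \int[N s]_y (1 - f (x + y))%:E = 1.
  rewrite -ge0_integralD//; last 4 first.
  - by move=> y _; rewrite lee_fin.
  - exact/measurable_EFinP.
  - by move=> y _; rewrite lee_fin.
  - exact/measurable_EFinP.
  under eq_integral do rewrite -EFinD addrC subrK.
  exact: integral_probability_cst.
move: Nf Nle; case: (\int[N s]_y (f (x + y)%R)%:E) (\int[N s]_y (1 - f (x + y))%:E) => [u||] [w||]//=.
by rewrite -!EFinD => -[uw]; rewrite !lee_fin; lra.
Qed.

(** Here F k is the integral of f against a Gaussian of variance k h^2, plus the cost of k swaps.
One more draw from P is swapped for a Gaussian, which [normal_convolution] merges with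
the k previous ones. *)
Lemma lindeberg d (T : measurableType d) (P : probability T R)
    (g : T -> R) (l : R) (f : R -> R) (C : R) (n : nat) :
  moments P g 1 l ->
  measurable_fun setT f -> (forall y, 0 <= f y <= 1)%R ->
  (0 <= C)%R -> taylor3 f C -> (0 < n)%N ->
  \int[iid P n]_X (f ((Num.sqrt n%:R)^-1 * \sum_(i < n) g (tnth X i))%R)%:E <=
  \int[N 1]_y (f y)%:E + (C * (l + 64) / Num.sqrt n%:R)%:E.
Proof.
move=> gm mf f01 C0 fC; case: n => // n _.
have [h hE] : exists h : R, h = ((Num.sqrt n.+1%:R)^-1)%R by eexists.
rewrite -hE.
have h0 : (0 < h)%R by rewrite hE invr_gt0 sqrtr_gt0 ltr0n.
have hn1 : (Num.sqrt n.+1%:R * h = 1)%R.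
  by rewrite hE mulfV// gt_eqF// sqrtr_gt0 ltr0n.
have hm : moments P (fun x => h * g x)%R (h ^+ 2)%R (h ^+ 3 * l)%R.
  by have := momentsZ h gm; rewrite mulr1 ger0_norm// ltW.
(* The cost of one swap at scale h, and c k = k e the cost of k swaps. *)
have [e eE] : exists e : R, e = (C * (h ^+ 3 * l + 64 * h ^+ 3))%R by eexists.
have l0 : (0 <= l)%R.
  have [_ _ _ _] := gm; rewrite -lee_fin; apply: le_trans.
  by apply: integral_ge0 => x _; rewrite lee_fin exprn_ge0.
have e0 : (0 <= e)%R by rewrite eE mulr_ge0 ?addr_ge0 ?mulr_ge0 ?exprn_ge0// ltW.
have eE' : (C * (l + 64) * h = n.+1%:R * e)%R.
  rewrite eE; have -> : n.+1%:R = ((h ^+ 2)^-1)%R :> R.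
    by rewrite hE exprVn sqr_sqrtr ?ler0n// invrK.
  by field; rewrite gt_eqF.
have [c [c0 cS c1 cn]] : exists c : nat -> R, [/\ forall k, (0 <= c k)%R,
    forall k, (c k.+1 = e + c k)%R, c 1%N = e & c n.+1 = (C * (l + 64) * h)%R].
  exists (fun k => k%:R * e)%R; split => [k|k||]; last (by rewrite eE'); first by rewrite mulr_ge0.
    by rewrite -natr1 mulrDl mul1r addrC.
  by rewrite mul1r.
rewrite -cn; clear cn eE'.
pose F k (s : R) := if k is 0 then (f s)%:E else
  \int[N (Num.sqrt k%:R * h)%R]_y (f (s + y)%R)%:E + (c k)%:E.
have f0E t : 0 <= (f t)%:E by rewrite lee_fin; have /andP[] := f01 t.
have mfE : measurable_fun setT (EFin \o f) by exact/measurable_EFinP.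
have inner0 (m : nat) t : 0 <= \int[N (Num.sqrt m%:R * h)%R]_y (f (t + y)%R)%:E.
  by apply: integral_ge0 => y _.
have minner (m : nat) : measurable_fun [set: R]
    (fun t => \int[N (Num.sqrt m%:R * h)%R]_y (f (t + y)%R)%:E).
  have := @measurable_fun_fubini_tonelli_F _ _ R (measurableTypeR R) R
    (N (Num.sqrt m%:R * h)%R) (fun xy => (f (xy.1 + xy.2)%R)%:E); apply => //.
  by apply: (measurableT_comp mfE); exact: measurable_funD.
have mF k : measurable_fun setT (F k).
  by case: k => [|k] //=; apply: emeasurable_funD.
have F0 k s : 0 <= F k s.
  by case: k => [|k] //=; apply: adde_ge0; [exact: (inner0 k.+1)|rewrite lee_fin].
have mhg : measurable_fun setT (fun x => h * g x)%R by case: hm.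
have FS k s : \int[P]_x F k (s + h * g x)%R <= F k.+1 s.
  have swap t : \int[P]_x (f (t + h * g x)%R)%:E <=
      \int[N h]_y (f (t + y)%R)%:E + e%:E.
    by rewrite eE; exact: lindeberg_swap.
  case: k => [|k]; first by rewrite /F sqrtr1 mul1r c1; exact: swap.
  rewrite /F; set r := (Num.sqrt k.+1%:R * h)%R; set r' := (Num.sqrt k.+2%:R * h)%R.
  have r0 : (0 < r)%R by rewrite mulr_gt0// sqrtr_gt0 ltr0n.
  have r'0 : (0 < r')%R by rewrite mulr_gt0// sqrtr_gt0 ltr0n.
  have r'E : (r' ^+ 2 = r ^+ 2 + h ^+ 2)%R.
    by rewrite !exprMn !sqr_sqrtr ?ler0n// -[k.+2%:R]natr1 mulrDl mul1r.
  have mr : measurable_fun [set: R] (fun t => \int[N r]_y (f (t + y)%R)%:E) := minner k.+1.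
  have ir t : 0 <= \int[N r]_y (f (t + y)%R)%:E := inner0 k.+1 t.
  clearbody r r'.
  have mshg : measurable_fun setT (fun x => s + h * g x)%R by exact: measurable_funD.
  rewrite ge0_integral_addcst//; last first.
    exact: (measurableT_comp mr mshg).
  have mfxy : measurable_fun [set: T * measurableTypeR R]
      (fun xy => (f (s + h * g xy.1 + xy.2)%R)%:E).
    apply: (measurableT_comp mfE); apply: measurable_funD => //.
    apply: measurable_funD => //; exact: (measurableT_comp mhg).
  rewrite (fubini_tonelli (m2 := N r) (fun xy => (f (s + h * g xy.1 + xy.2)%R)%:E))//=.
  have -> : (c k.+2)%:E = e%:E + (c k.+1)%:E by rewrite cS.
  rewrite [leRHS]addeA; apply: leeD2r.
  have mNh : measurable_fun [set: R] (fun y => \int[N h]_w (f (s + y + w)%R)%:E).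
    have := minner 1%N; rewrite sqrtr1 mul1r => minner1.
    by apply: (measurableT_comp minner1); exact: measurable_funD.
  have mfs : measurable_fun [set: R] (fun z => (f (s + z)%R)%:E).
    by apply: (measurableT_comp mfE); exact: measurable_funD.
  have iNh y : 0 <= \int[N h]_w (f (s + y + w)%R)%:E by exact: integral_ge0.
  have convE := normal_convolution r0 h0 r'0 r'E mfs (fun z => f0E _).
  apply: (@le_trans _ _
      (\int[N r]_y (\int[N h]_w (f (s + y + w)%R)%:E + e%:E))).
    apply: ge0_le_integral.
    - exact: measurableT.
    - by move=> y _; exact: integral_ge0.
    - exact: (measurable_fun_fubini_tonelli_G (m1 := P) _ mfxy).
    - exact: emeasurable_funD.
    - move=> y _; under eq_integral do rewrite addrAC.
      exact: swap.
  rewrite (ge0_integral_addcst (N r) mNh iNh e0) -convE; apply: leeD2r.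
  by under [leRHS]eq_integral do under eq_integral do rewrite addrA.
have := iid_sum_le (fun=> mhg) mF F0 FS n.+1 0%R.
rewrite /F hn1; clear.
under eq_integral do rewrite add0r -mulr_sumr.
by under [X in _ <= X + _]eq_integral do rewrite add0r.
Qed.

End gaussian_central_limit.

(** * The standard normal distribution function *)

(** Markov's inequality. *)
Lemma le_integral_dominating d (T : measurableType d) (R : realType)
    (P : probability T R) (A : set T) (h : T -> \bar R) :
  measurable A -> measurable_fun setT h -> (forall x, 0 <= h x)%E ->
  (forall x, A x -> 1 <= h x)%E -> (P A <= \int[P]_x h x)%E.
Proof.
move=> mA mh h0 Ah; rewrite (_ : P A = \int[P]_x (\1_A x)%:E)%E; last first.
  by rewrite integral_indic// setIT.
apply: ge0_le_integral => //.
- by apply/measurable_EFinP; exact: measurable_indic.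
- move=> x _; rewrite indicE; have [/set_mem/Ah//|_] := boolP (x \in A).
  exact: h0.
Qed.

Section gauss_cdf.
Context (R : realType).
Notation N := (@normal_prob R 0 1).
Implicit Types x y z : R.

Let Nfin (A : set R) : measurable A -> N A \is a fin_num.
Proof. by move=> mA; exact: fin_num_measure. Qed.

Lemma PhiE x : (Phi x)%:E = N `]-oo, x].
Proof. by rewrite /Phi fineK ?Nfin. Qed.

Lemma Phi_tail x : N `]x, +oo[ = (1 - Phi x)%:E.
Proof.
rewrite EFinB PhiE -setCitvl probability_setC//.
Qed.

Lemma Phi_ge0 x : 0 <= Phi x.
Proof. by rewrite -lee_fin PhiE. Qed.

Lemma Phi_le1 x : Phi x <= 1.
Proof. by rewrite -lee_fin PhiE; exact: probability_le1. Qed.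

Lemma Phi_nondecreasing : {homo (@Phi R) : x y / x <= y}.
Proof.
move=> x y xy; rewrite -lee_fin !PhiE; apply: le_measure; rewrite ?inE//.
by move=> t /=; rewrite !in_itv/= => /le_trans; exact.
Qed.

(** The standard normal density is at most 1. *)
Lemma Phi_lipschitz x y : x <= y -> Phi y <= Phi x + (y - x).
Proof.
move=> xy; rewrite -lee_fin EFinD !PhiE.
rewrite (@itv_bndbnd_setU _ _ -oo%O (BRight x) (BRight y))//.
rewrite (le_trans (measureU2 _ _ _))//; rewrite leeD2l//.
rewrite /normal_prob.
apply: (@le_trans _ _ (\int[lebesgue_measure]_(t in `]x, y]) 1%:E)%E).
  apply: ge0_le_integral => //.
  - by move=> t _; rewrite lee_fin normal_pdf_ge0.
  - by apply/measurable_EFinP; apply: measurable_funTS; exact: measurable_normal_pdf.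
  - move=> t _; rewrite lee_fin (le_trans (normal_pdf_ub _ _ _))//.
    rewrite /normal_peak invf_le1 ?sqrtr_gt0.
      rewrite -[leLHS]sqrtr1 ler_wsqrtr// expr1n mul1r mulr2n.
      by have := @pi_ge2 R; lra.
    by rewrite expr1n mul1r mulrn_wgt0// pi_gt0.
rewrite integral_cst//= mul1e lebesgue_measure_itv/= lte_fin.
by case: ifPn => //; rewrite lee_fin subr_ge0.
Qed.

Lemma Phi_continuous : continuous (@Phi R).
Proof.
move=> x; apply/cvgrPdist_le => e e0; near=> y.
have : `|x - y| <= e by near: y; exact: cvgr_dist_le.
rewrite !ler_norml => /andP[h1 h2].
have [xy|yx] := leP x y.
  by have := Phi_lipschitz xy; have := Phi_nondecreasing xy; lra.
by have := Phi_lipschitz (ltW yx); have := Phi_nondecreasing (ltW yx); lra.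
Unshelve. all: by end_near. Qed.

Let mz2 z : measurable_fun [set: R] (fun x => (z ^- 2 * x ^+ 2)%:E).
Proof.
by apply/measurable_EFinP; apply: measurable_funM => //; exact: measurable_funX.
Qed.

Let z20 z x : (0 <= (z ^- 2 * x ^+ 2)%:E)%E.
Proof. by rewrite lee_fin mulr_ge0 ?invr_ge0 ?sqr_ge0. Qed.

Let chebyshevN z (A : set R) : measurable A ->
  (forall x, A x -> 1 <= z ^- 2 * x ^+ 2) -> (N A <= (z ^- 2)%:E)%E.
Proof.
move=> mA Az; have := @le_integral_dominating _ _ _ N A _ mA (@mz2 z) (@z20 z) Az.
move/le_trans; apply.
under eq_integral do rewrite EFinM.
rewrite ge0_integralZl//; last 3 first.
- by apply/measurable_EFinP; exact: measurable_funX.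
- by move=> x _; rewrite lee_fin sqr_ge0.
- by rewrite lee_fin invr_ge0 sqr_ge0.
by rewrite normal_sqr// expr1n mule1.
Qed.

(** Chebyshev's inequality; with [Phi_lower_tail] it locates the values 0 and 1 at infinity,
which the intermediate value theorem needs. *)
Lemma Phi_upper_tail z : 0 < z -> 1 - Phi z <= z ^- 2.
Proof.
move=> z0; rewrite -lee_fin -Phi_tail; apply: chebyshevN => // x /=.
rewrite in_itv/= andbT => zx; rewrite mulrC ler_pdivlMr ?exprn_gt0// mul1r.
by rewrite lerXn2r ?nnegrE ?ltW// (lt_trans z0).
Qed.

Lemma Phi_lower_tail z : 0 < z -> Phi (- z) <= z ^- 2.
Proof.
move=> z0; rewrite -lee_fin PhiE; apply: chebyshevN => // x /=.
rewrite in_itv/= => zx; rewrite mulrC ler_pdivlMr ?exprn_gt0// mul1r -(sqrrN x).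
by rewrite lerXn2r ?nnegrE//; lra.
Qed.

Lemma Phi_surjective (b : R) : 0 < b < 1 -> exists x : R, Phi x = b.
Proof.
move=> /andP[b0 b1].
have [z [z0 zb zb1]] : exists z : R, [/\ 0 < z, z ^- 2 <= b & z ^- 2 <= 1 - b].
  (* Any z with z^2 at least 1 / b and 1 / (1 - b) will do. *)
  exists (1 + b^-1 + (1 - b)^-1).
  have i0 : 0 < b^-1 by rewrite invr_gt0.
  have i1 : 0 < (1 - b)^-1 by rewrite invr_gt0 subr_gt0.
  split; first lra.
  - rewrite -[leRHS]invrK lef_pV2 ?posrE ?exprn_gt0//; nra.
  - rewrite -[leRHS]invrK lef_pV2 ?posrE ?exprn_gt0//; nra.
have zz : - z <= z by lra.
have cPhi : {within `[- z, z], continuous (@Phi R)}.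
  by apply: continuous_subspaceT; exact: Phi_continuous.
have [|x _ xb] := IVT zz cPhi (v := b); last by exists x.
have := Phi_upper_tail z0; have := Phi_lower_tail z0 => h1 h2.
by rewrite ge_min le_max; apply/andP; split; apply/orP; [left|right]; lra.
Qed.

Lemma Phi_gauss_quantile (b : R) : 0 < b < 1 -> Phi (gauss_quantile b) = b.
Proof.
move=> b01; have [x0 x0b] := Phi_surjective b01.
have [y yb] : exists y : R, Phi y < b.
  have [|y yb] := @Phi_surjective (b / 2); first by lra.
  by exists y; rewrite yb; lra.
have Ax0 : [set x : R | b <= Phi x] x0 by rewrite /= x0b.
have lbA : lbound [set x : R | b <= Phi x] y.
  move=> x /= bx; rewrite leNgt; apply/negP => xy.
  by have := Phi_nondecreasing (ltW xy); lra.
have hA : has_inf [set x : R | b <= Phi x] by split; [exists x0|exists y].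
rewrite /gauss_quantile; set q := inf _.
apply/eqP; rewrite eq_le; apply/andP; split.
  by rewrite -[leRHS]x0b Phi_nondecreasing// ge_inf//; exists y.
apply/ler_addgt0Pr => e e0.
have [x /= bx xq] := inf_adherent e0 hA.
have qx : q <= x by rewrite ge_inf//; exists y.
by have := Phi_lipschitz qx; rewrite -/q in xq; lra.
Qed.

End gauss_cdf.

(** * Smooth steps *)

Section smooth_step.
Context (R : realType).
Implicit Types (x y z : R) (f g : R -> R).

Let pos3 x := Num.max x 0 ^+ 3.

Let pos3_ge x : 0 <= x -> pos3 x = x ^+ 3.
Proof. by move=> x0; rewrite /pos3 max_l. Qed.

Let pos3_le x : x <= 0 -> pos3 x = 0.
Proof. by move=> x0; rewrite /pos3 max_r// expr0n. Qed.

(** The second derivative 6 max (x, 0) of the truncated cube is 6-Lipschitz. *)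
Let taylor3_pos3 : taylor3 pos3 1.
Proof.
move=> x; exists (3 * Num.max x 0 ^+ 2), (3 * Num.max x 0) => y.
rewrite mul1r -normrX /pos3.
have cube u v : 0 <= u -> u <= v -> u ^+ 3 <= v ^+ 3 :> R.
  by move=> u0 uv; rewrite lerXn2r// nnegrE// (le_trans u0).
have [x0|x0] := leP 0 x; have [xy0|xy0] := leP 0 (x + y).
- by rewrite le_eqVlt; apply/orP; left; apply/eqP; congr `| _ |; ring.
- have uv := cube (- (x + y)) (- y).
  have u0 : 0 <= (- (x + y)) ^+ 3 by rewrite exprn_ge0//; lra.
  rewrite expr0n/= (_ : _ - _ = (- (x + y)) ^+ 3 - (- y) ^+ 3); last by ring.
  have -> : `|y ^+ 3| = (- y) ^+ 3.
    by rewrite normrX ltr0_norm//; lra.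
  by rewrite ler_norml; apply/andP; split; lra.
- have uv := cube (x + y) y.
  have u0 : 0 <= (x + y) ^+ 3 by rewrite exprn_ge0.
  rewrite expr0n/= (_ : _ - _ = (x + y) ^+ 3); last by ring.
  by rewrite normrX (ger0_norm xy0) [leRHS]normrX ger0_norm; lra.
- rewrite (_ : _ - _ = 0); last by ring.
  by rewrite normr0.
Qed.

Lemma taylor3D f g C D : taylor3 f C -> taylor3 g D ->
  taylor3 (fun x => f x + g x) (C + D).
Proof.
move=> fC gD x; have [a [b fab]] := fC x; have [a' [b' gab]] := gD x.
exists (a + a'), (b + b') => y; rewrite [leRHS]mulrDl.
apply: (le_trans _ (lerD (fab y) (gab y))); apply: (le_trans _ (ler_normD _ _)).
by rewrite le_eqVlt; apply/orP; left; apply/eqP; congr `| _ |; ring.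
Qed.

Lemma taylor3_affine f C c k s : taylor3 f C ->
  taylor3 (fun x => c * f (k * x + s)) (`|c| * C * `|k| ^+ 3).
Proof.
move=> fC x; have [a [b fab]] := fC (k * x + s).
exists (c * a * k), (c * b * k ^+ 2) => y.
have := ler_wpM2l (normr_ge0 c) (fab (k * y)).
rewrite -normrM (_ : k * x + s + k * y = k * (x + y) + s); last by ring.
rewrite (_ : `|c| * (C * _) = `|c| * C * `|k| ^+ 3 * `|y| ^+ 3); last first.
  by rewrite normrM; ring.
move=> h; apply: (le_trans _ h).
by rewrite le_eqVlt; apply/orP; left; apply/eqP; congr `| _ |; ring.
Qed.

(** The integral of the quadratic B-spline with knots 0, 1, 2, 3, as a third difference of
truncated cubes: it is 0 to the left of all knots and, third differences of a cubic
being constant, 1 to the right of them. *)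
Let step01 x : R :=
  6^-1 * pos3 (1 * x + 0) + - 2^-1 * pos3 (1 * x + -1) +
  (2^-1 * pos3 (1 * x + -2) + - 6^-1 * pos3 (1 * x + -3)).

Let taylor3_step01 : taylor3 step01 2.
Proof.
have := taylor3D
  (taylor3D (taylor3_affine 6^-1 1 0 taylor3_pos3) (taylor3_affine (- 2^-1) 1 (-1) taylor3_pos3))
  (taylor3D (taylor3_affine 2^-1 1 (-2) taylor3_pos3) (taylor3_affine (- 6^-1) 1 (-3) taylor3_pos3)).
move=> h x; have [a [b hab]] := h x; exists a, b => y; apply: (le_trans (hab y)).
rewrite ler_wpM2r ?exprn_ge0// !normrN normr1 expr1n !mulr1 !ger0_norm//.
by rewrite le_eqVlt; lra.
Qed.

Let step01_le0 x : x <= 0 -> step01 x = 0.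
Proof. by move=> x0; rewrite /step01 !pos3_le; lra. Qed.

Let step01_ge3 x : 3 <= x -> step01 x = 1.
Proof. by move=> x3; rewrite /step01 !pos3_ge; try lra; field. Qed.

Let step01_bounds x : 0 <= step01 x <= 1.
Proof.
have [x0|x0] := leP x 0; first by rewrite step01_le0// lexx ler01.
have [x3|x3] := leP 3 x; first by rewrite step01_ge3// lexx ler01.
rewrite /step01 (pos3_ge (x := 1 * x + 0)); last by lra.
rewrite (pos3_le (x := 1 * x + -3)); last by lra.
have [x1|x1] := leP x 1.
  by rewrite !pos3_le; [apply/andP; split; nra|lra|lra].
rewrite (pos3_ge (x := 1 * x + -1)); last by lra.
have [x2|x2] := leP x 2.
  rewrite pos3_le; last by lra.
  have h1 : 0 <= (x - 1) ^+ 2 * (2 - x) by rewrite mulr_ge0 ?sqr_ge0//; lra.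
  have h2 : 0 <= (2 - x) ^+ 2 * (x - 1) by rewrite mulr_ge0 ?sqr_ge0//; lra.
  have h3 := sqr_ge0 (x - 1); have h4 := sqr_ge0 (2 - x).
  by apply/andP; split; nra.
rewrite pos3_ge; last by lra.
have u0 : 0 <= (3 - x) ^+ 3 by rewrite exprn_ge0//; lra.
have u1 : (3 - x) ^+ 3 <= 1 by rewrite exprn_ile1//; lra.
by apply/andP; split; nra.
Qed.

Lemma smooth_step (z h : R) : 0 < h -> exists f : R -> R,
  [/\ measurable_fun setT f, forall x, 0 <= f x <= 1,
      taylor3 f (2 / h ^+ 3), forall x, z <= x -> f x = 1 &
      forall x, x <= z - 3 * h -> f x = 0].
Proof.
move=> h0; exists (fun x => step01 (h^-1 * x + (3 - z / h))); split.
- have mpos3 c s : measurable_fun [set: R] (fun x => c * pos3 (1 * x + s)).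
    apply: measurable_funM => //; apply: measurable_funX; apply: measurable_maxr => //.
    by apply: measurable_funD => //; exact: measurable_funM.
  have m01 : measurable_fun [set: R] step01.
    by apply: measurable_funD; apply: measurable_funD; exact: mpos3.
  apply: (measurableT_comp m01); apply: measurable_funD => //; exact: measurable_funM.
- by move=> x; exact: step01_bounds.
- have := taylor3_affine 1 h^-1 (3 - z / h) taylor3_step01.
  rewrite normr1 mul1r ger0_norm ?invr_ge0 ?ltW// exprVn.
  by move=> H x; have [a [b hab]] := H x; exists a, b => y; have := hab y; rewrite !mul1r.
- move=> x zx; apply: step01_ge3; rewrite mulrC.
  by have : z / h <= x / h; [rewrite ler_pM2r ?invr_gt0|lra].
- move=> x zx; apply: step01_le0; rewrite mulrC.
  have : x / h <= (z - 3 * h) / h by rewrite ler_pM2r ?invr_gt0.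
  by rewrite mulrBl mulfK ?gt_eqF//; lra.
Qed.

End smooth_step.

(** * A central limit theorem and weak laws with rates *)

Section huber.
Context (R : realType).
Implicit Types (x y u w : R).

(** Quadratic near 0 and linear at infinity. The squares g^2 have finite moments only up to
order 3/2, so that Chebyshev's argument for their mean must use a function that grows
more slowly than the square. *)
Definition huber x : R := if `|x| <= 1 then x ^+ 2 else 2 * `|x| - 1.

Lemma huber_ge0 x : 0 <= huber x.
Proof. by rewrite /huber; have [x1|x1] := leP `|x| 1; [exact: sqr_ge0|lra]. Qed.

Lemma huber_ge_sqr x d : 0 < d <= 1 -> d <= `|x| -> d ^+ 2 <= huber x.
Proof.
move=> /andP[d0 d1] dx; rewrite /huber; have [x1|x1] := leP `|x| 1; last by nra.
by rewrite -(real_normK (num_real x)) lerXn2r// nnegrE ltW.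
Qed.

Lemma measurable_huber : measurable_fun [set: R] huber.
Proof.
apply: measurable_fun_ifT.
- by apply: measurable_fun_ler => //; exact: normr_measurable.
- exact: measurable_funX.
- by apply: measurable_funB => //; apply: measurable_funM => //; exact: normr_measurable.
Qed.

(** The Huber function is the minimum of this right-hand side over y. *)
Let huber_le x y : huber x <= y ^+ 2 + 2 * `|x - y|.
Proof.
rewrite /huber; have [x1|x1] := leP `|x| 1; last first.
  have := ler_normD (x - y) y; rewrite subrK -(real_normK (num_real y)).
  by have := sqr_ge0 (`|y| - 1); nra.
have [y1|y1] := leP `|y| 1; last first.
  have : `|x| ^+ 2 <= `|y| ^+ 2 by rewrite lerXn2r// ?nnegrE// (le_trans x1 (ltW y1)).
  by rewrite !real_normK ?num_real//; have := normr_ge0 (x - y); lra.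
move: x1 y1; rewrite !ler_norml => /andP[x1 x2] /andP[y1 y2].
by have [xy|xy] := ger0P (x - y); nra.
Qed.

(** At the minimizer c of the variational formula for huber u, the competitors c + w and c for
huber (u + w) give the quadratic and the linear bound. *)
Lemma huber_taylor u : exists a, forall w,
  huber (u + w) <= huber u + a * w + Num.min (w ^+ 2) (4 * `|w|).
Proof.
(* The minimizer: u itself near 0, and the sign of u at infinity. *)
have [c [c1 huE]] : exists c, `|c| <= 1 /\ huber u = c ^+ 2 + 2 * `|u - c|.
  rewrite /huber; have [u1|u1] := leP `|u| 1.
    by exists u; rewrite subrr normr0 mulr0 addr0.
  have [u0|u0] := leP 0 u.
    exists 1; rewrite normr1; split => //.
    by move: u1; rewrite ger0_norm// => u1; rewrite ger0_norm; lra.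
  exists (- 1); rewrite normrN1; split => //.
  by move: u1; rewrite ltr0_norm// => u1; rewrite ltr0_norm; lra.
exists (2 * c) => w; rewrite huE; move: c1; rewrite ler_norml => /andP[c1 c2].
rewrite -lerBlDl le_min; apply/andP; split.
  have := huber_le (u + w) (c + w).
  rewrite (_ : u + w - (c + w) = u - c); last by ring.
  by lra.
have := huber_le (u + w) c; have := ler_normD (u - c) w.
rewrite (_ : u - c + w = u + w - c); last by ring.
by have [w0|w0] := ger0P w; nra.
Qed.

(** The minimum of w^2 and 4 |w| is at most 4 |w|^(3/2), which is cubic in y when w is quadratic
in y; it is thus integrable against a law with three moments. *)
Lemma huber_sqr_taylor u h : 0 < h -> exists a, forall y,
  huber (u + h ^+ 2 * (y ^+ 2 - 1)) <=
  huber u + a * (h ^+ 2 * (y ^+ 2 - 1)) + 16 * h ^+ 3 * (1 + `|y| ^+ 3).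
Proof.
move=> h0; have [a ha] := huber_taylor u; exists a => y.
apply: (le_trans (ha _)); rewrite lerD2l.
(* |w| <= B^2 for w = h^2 (y^2 - 1), hence min (w^2, 4 |w|) <= 4 B^3 by cases on B <= 4. *)
pose B := h * (`|y| + 1).
have B0 : 0 < B by rewrite mulr_gt0// ltr_wpDl.
have wB : `|h ^+ 2 * (y ^+ 2 - 1)| <= B ^+ 2.
  rewrite /B exprMn normrM ger0_norm ?sqr_ge0// ler_pM2l ?exprn_gt0//.
  rewrite -(real_normK (num_real y)) ler_norml.
  by have := normr_ge0 y; move: `|y| => t t0; apply/andP; split; nra.
have w2B : (h ^+ 2 * (y ^+ 2 - 1)) ^+ 2 <= B ^+ 4.
  rewrite -(real_normK (num_real (_ * _))) (_ : B ^+ 4 = (B ^+ 2) ^+ 2); last by ring.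
  by rewrite lerXn2r// nnegrE sqr_ge0.
apply: (@le_trans _ _ (4 * B ^+ 3)).
  have [B4|B4] := leP B 4; rewrite ge_min; apply/orP; [left|right].
    apply: (le_trans w2B); rewrite exprS ler_wpM2r// exprn_ge0// ltW//.
  have : 4 * B ^+ 2 <= 4 * B ^+ 3.
    by rewrite ler_pM2l// [leRHS]exprS ler_peMl ?sqr_ge0//; lra.
  by apply: le_trans; rewrite ler_pM2l.
rewrite /B exprMn (_ : 16 * h ^+ 3 * _ = 4 * (h ^+ 3 * (4 * (1 + `|y| ^+ 3)))); last by ring.
rewrite !ler_pM2l ?exprn_gt0//.
have := normr_ge0 y; move: `|y| => t t0.
have := mulr_ge0 (sqr_ge0 (t - 1)) t0; have := sqr_ge0 (t - 1); nra.
Qed.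

End huber.

Section limit_theorems.
Context d (T : measurableType d) (R : realType) (P : probability T R).
Context (g : T -> R) (l : R) (n : nat).
Context (gm : moments P g 1 l) (n0 : (0 < n)%N).

Let mg : measurable_fun setT g. Proof. by case: gm. Qed.

Let h : R := (Num.sqrt n%:R)^-1.
Let h0 : 0 < h. Proof. by rewrite invr_gt0 sqrtr_gt0 ltr0n. Qed.
Let h2 : h ^+ 2 = n%:R^-1. Proof. by rewrite exprVn sqr_sqrtr. Qed.

Let mS (f : T -> R) : measurable_fun setT f ->
  measurable_fun setT (fun X : n.-tuple T => \sum_(i < n) f (tnth X i)).
Proof. by move=> mf; apply: (measurable_sum_tnth (h := fun=> f)). Qed.

(** The smooth step is 1 beyond z and 0 before z - 3 e. The cost of its steepness is the
constant 2 / e^3. *)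
Lemma clt_tail (z e : R) : 0 < e ->
  (iid P n [set X | (z <= h * \sum_(i < n) g (tnth X i))%R] <=
   (1 - Phi (z - 3 * e) + 2 / e ^+ 3 * (l + 64) / Num.sqrt n%:R)%:E)%E.
Proof.
move=> e0; have [f [mf f01 f3 f1 f0]] := smooth_step z e0.
have mfE : measurable_fun setT (EFin \o f) by exact/measurable_EFinP.
have C0 : 0 <= 2 / e ^+ 3 by rewrite divr_ge0// exprn_ge0// ltW.
apply: (@le_trans _ _
   (\int[iid P n]_X (f (h * \sum_(i < n) g (tnth X i)))%:E)%E).
  apply: le_integral_dominating.
  - rewrite -[X in measurable X]setTI; apply: measurable_fun_ler => //.
    by apply: measurable_funM => //; exact: mS.
  - by apply: (measurableT_comp mfE); apply: measurable_funM => //; exact: mS.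
  - by move=> X; rewrite lee_fin; have /andP[] := f01 (h * \sum_(i < n) g (tnth X i)).
  - by move=> X /= zX; rewrite lee_fin f1.
apply: (le_trans (lindeberg gm mf f01 C0 f3 n0)).
rewrite EFinD leeD2r// -Phi_tail.
rewrite (_ : normal_prob 0 1 _ = \int[normal_prob 0 1]_x (\1_`]z - 3 * e, +oo[ x)%:E)%E; last first.
  by rewrite integral_indic// setIT.
apply: ge0_le_integral => //.
- by move=> x _; rewrite lee_fin; have /andP[] := f01 x.
- by apply/measurable_EFinP; exact: measurable_indic.
move=> x _; rewrite lee_fin indicE mem_setE in_itv/= andbT.
by have [zx|xz] := ltP; [have /andP[] := f01 x|rewrite f0].
Qed.

(** Here F k s is proportional to s^2 plus the variance of the k summands to come. *)
Lemma sum_chebyshev (M : R) : 0 < M ->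
  (iid P n [set X | (M <= `|h * \sum_(i < n) g (tnth X i)|)%R] <= (M ^- 2)%:E)%E.
Proof.
move=> M0.
pose F (k : nat) (s : R) := (M ^- 2 * (s ^+ 2 + k%:R * h ^+ 2))%:E.
have mF k : measurable_fun setT (F k).
  apply/measurable_EFinP; apply: measurable_funM => //.
  by apply: measurable_funD => //; exact: measurable_funX.
have i0 : 0 <= M ^- 2 by rewrite invr_ge0 sqr_ge0.
have sq0 s k : 0 <= s ^+ 2 + k%:R * h ^+ 2.
  by apply: addr_ge0; [exact: sqr_ge0|apply: mulr_ge0 => //; exact: sqr_ge0].
have F0 k s : (0 <= F k s)%E.
  by rewrite lee_fin mulr_ge0.
have mhg : measurable_fun setT (fun x => h * g x) by exact: measurable_funM.
have FS k s : (\int[P]_x F k (s + h * g x)%R <= F k.+1 s)%E.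
  have := @moments_taylor _ _ _ P g 1 l (fun y => M ^- 2 * ((s + h * y) ^+ 2 + k%:R * h ^+ 2))
    (M ^- 2 * (s ^+ 2 + k%:R * h ^+ 2)) (M ^- 2 * (2 * s * h)) (M ^- 2 * h ^+ 2) 0 gm.
  rewrite mul0r addr0 mulr1 -mulrDr -addrA -[X in s ^+ 2 + (_ + X)]mul1r -mulrDl natr1.
  apply => //.
  - apply: measurable_funM => //; apply: measurable_funD => //.
    by apply: measurable_funX; apply: measurable_funD => //; exact: measurable_funM.
  - by move=> y; rewrite mulr_ge0.
  - by move=> y; rewrite le_eqVlt; apply/orP; left; apply/eqP; ring.
have := iid_sum_le (fun=> mhg) mF F0 FS n 0.
rewrite {2}/F h2 mulfV ?pnatr_eq0 -?lt0n// expr0n/= add0r mulr1.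
apply: le_trans; under eq_integral do rewrite add0r -mulr_sumr.
apply: le_integral_dominating.
- rewrite -[X in measurable X]setTI; apply: measurable_fun_ler => //.
  by apply: measurableT_comp => //; apply: measurable_funM => //; exact: mS.
- by apply: (measurableT_comp (mF 0%N)); apply: measurable_funM => //; exact: mS.
- by move=> X; exact: F0.
move=> X /= MX; rewrite /F mul0r addr0 lee_fin mulrC ler_pdivlMr ?exprn_gt0// mul1r.
by rewrite -[leRHS]real_normK ?num_real// lerXn2r// nnegrE ltW.
Qed.

(** The Huber analogue of Chebyshev's inequality: each summand h^2 (g^2 - 1), with
h = n^(-1/2), costs a multiple of h^3 by [huber_sqr_taylor], so that n of them cost a
multiple of n^(-1/2). *)
Lemma sum_sqr_lln (e : R) : 0 < e <= 1 ->
  (iid P n [set X | (e <= `|h ^+ 2 * \sum_(i < n) g (tnth X i) ^+ 2 - 1|)%R] <=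
   (16 * (1 + l) / e ^+ 2 / Num.sqrt n%:R)%:E)%E.
Proof.
move=> e01; have /andP[e0 e1] := e01.
have i0 : 0 <= e ^- 2 by rewrite invr_ge0 sqr_ge0.
have l0 : 0 <= l.
  have [_ _ _ _] := gm; rewrite -lee_fin; apply: le_trans.
  by apply: integral_ge0 => x _; rewrite lee_fin exprn_ge0.
pose F (k : nat) (s : R) := (e ^- 2 * (huber s + k%:R * (16 * h ^+ 3 * (1 + l))))%:E.
have mF k : measurable_fun setT (F k).
  apply/measurable_EFinP; apply: measurable_funM => //.
  by apply: measurable_funD => //; exact: measurable_huber.
have c0 : 0 <= 16 * h ^+ 3 * (1 + l).
  by rewrite mulr_ge0 ?addr_ge0// mulr_ge0// exprn_ge0// ltW.
have F0 k s : (0 <= F k s)%E.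
  by rewrite lee_fin mulr_ge0// addr_ge0 ?huber_ge0// mulr_ge0.
have mg2 : measurable_fun setT (fun x => h ^+ 2 * (g x ^+ 2 - 1)).
  by apply: measurable_funM => //; apply: measurable_funB => //; exact: measurable_funX.
have FS k s : (\int[P]_x F k (s + h ^+ 2 * (g x ^+ 2 - 1))%R <= F k.+1 s)%E.
  have [a ha] := huber_sqr_taylor s h0.
  have := @moments_taylor _ _ _ P g 1 l
    (fun y => e ^- 2 * (huber (s + h ^+ 2 * (y ^+ 2 - 1)) + k%:R * (16 * h ^+ 3 * (1 + l))))
    (e ^- 2 * (huber s + k%:R * (16 * h ^+ 3 * (1 + l)) - a * h ^+ 2 + 16 * h ^+ 3)) 0
    (e ^- 2 * (a * h ^+ 2)) (e ^- 2 * (16 * h ^+ 3)) gm.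
  have -> : F k.+1 s = (e ^- 2 * (huber s + k%:R * (16 * h ^+ 3 * (1 + l)) -
      a * h ^+ 2 + 16 * h ^+ 3) + e ^- 2 * (a * h ^+ 2) * 1 +
      e ^- 2 * (16 * h ^+ 3) * l)%:E.
    by rewrite /F -natr1; congr EFin; ring.
  apply => //.
  - apply: measurable_funM => //; apply: measurable_funD => //.
    have mi : measurable_fun [set: R] (fun y => s + h ^+ 2 * (y ^+ 2 - 1)).
      apply: measurable_funD => //; apply: measurable_funM => //.
      by apply: measurable_funB => //; exact: measurable_funX.
    exact: (measurableT_comp (@measurable_huber R) mi).
  - by move=> y; rewrite mulr_ge0// addr_ge0 ?huber_ge0// mulr_ge0.
  - by rewrite mulr_ge0// mulr_ge0// exprn_ge0// ltW.
  - move=> y; have := ler_wpM2l i0 (ha y); lra.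
have := iid_sum_le (fun=> mg2) mF F0 FS n 0.
rewrite {2}/F.
rewrite (_ : e ^- 2 * _ = 16 * (1 + l) / e ^+ 2 / Num.sqrt n%:R); last first.
  rewrite /huber normr0 ler01 expr0n/= add0r -/h.
  have -> : n%:R = (h ^+ 2)^-1 by rewrite h2 invrK.
  by field; rewrite !gt_eqF.
apply: le_trans.
apply: le_integral_dominating.
- rewrite -[X in measurable X]setTI; apply: measurable_fun_ler => //.
  apply: measurableT_comp => //; apply: measurable_funB => //; apply: measurable_funM => //.
  by apply: (mS (f := fun x => g x ^+ 2)); exact: measurable_funX.
- by apply: (measurableT_comp (mF 0%N)); apply: measurable_funD => //; exact: (mS mg2).
- by move=> X; exact: F0.
move=> X /= eX; rewrite /F mul0r addr0 lee_fin mulrC ler_pdivlMr ?exprn_gt0// mul1r.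
apply: huber_ge_sqr => //; rewrite add0r -mulr_sumr sumrB mulrBr sumr_const card_ord.
by rewrite {2}h2 mulVf// pnatr_eq0 -lt0n.
Qed.

End limit_theorems.

(** * The studentized mean *)

Section studentized.
Context (R : realType).

Definition studentized n (y : 'I_n -> R) : R :=
  let m := n%:R^-1 * \sum_(i < n) y i in
  Num.sqrt n%:R * m / Num.sqrt (n%:R^-1 * \sum_(i < n) (y i - m) ^+ 2).

(** Location and scale are separated from the normalized variables. S is their normalized sum,
and the argument of the last square root is their mean of squares minus the square of
their mean. *)
Lemma studentizedE n (g : 'I_n -> R) (a s : R) : (0 < n)%N -> 0 < s ->
  let h := (Num.sqrt n%:R)^-1 in let S := h * \sum_(i < n) g i in
  studentized (fun i => a + s * g i) =
  (a / (s * h) + S) / Num.sqrt (h ^+ 2 * (\sum_(i < n) g i ^+ 2) - (h * S) ^+ 2).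
Proof.
move=> n0 s0 h S.
have h0 : 0 < h by rewrite invr_gt0 sqrtr_gt0 ltr0n.
have h2 : h ^+ 2 = n%:R^-1 by rewrite exprVn sqr_sqrtr.
have hI : Num.sqrt n%:R = h^-1 by rewrite invrK.
have nI : n%:R = (h ^+ 2)^-1 by rewrite h2 invrK.
rewrite /studentized hI -h2.
have -> : h ^+ 2 * \sum_(i < n) (a + s * g i) = a + s * h * S.
  rewrite big_split /= sumr_const card_ord -mulr_sumr -mulr_natr nI /S.
  by field; rewrite gt_eqF.
have -> : h ^+ 2 * \sum_(i < n) (a + s * g i - (a + s * h * S)) ^+ 2 =
    s ^+ 2 * (h ^+ 2 * (\sum_(i < n) g i ^+ 2) - (h * S) ^+ 2).
  have -> : \sum_(i < n) (a + s * g i - (a + s * h * S)) ^+ 2 =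
     s ^+ 2 * \sum_(i < n) g i ^+ 2 - 2 * s ^+ 2 * h * S * \sum_(i < n) g i +
     n%:R * (s * h * S) ^+ 2.
    transitivity (\sum_(i < n) (s ^+ 2 * g i ^+ 2 - (2 * s ^+ 2 * h * S) * g i + (s * h * S) ^+ 2)).
      by apply: eq_bigr => i _; ring.
    rewrite big_split sumrB /= sumr_const card_ord -!mulr_sumr.
    by rewrite -[X in _ + X]mulr_natl.
  have -> : \sum_(i < n) g i = h^-1 * S by rewrite /S mulKf ?gt_eqF.
  by rewrite nI; field; rewrite gt_eqF.
rewrite sqrtrM ?sqr_ge0// sqrtr_sqr gtr0_norm//.
rewrite invfM; move: (Num.sqrt _)^-1 => r.
by field; rewrite !gt_eqF.
Qed.

(** With a variance Q - w close to 1, exceeding z forces the numerator to exceed almost z. *)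
Lemma studentized_bound (z e S Q w : R) : 0 < e <= 4^-1 ->
  `|Q - 1| < e -> 0 <= w <= e -> z <= S / Num.sqrt (Q - w) ->
  z - 2 * `|z| * e <= S.
Proof.
move=> /andP[e0 e1]; rewrite ltr_norml => /andP[Q1 Q2] /andP[w0 we].
have D0 : 0 < Q - w by lra.
rewrite ler_pdivlMr ?sqrtr_gt0// => /(le_trans _); apply.
set r := Num.sqrt _.
have r0 : 0 <= r by exact: sqrtr_ge0.
have r2 : r ^+ 2 = Q - w by rewrite sqr_sqrtr// ltW.
have r1 : 1 - 2 * e <= r by nra.
have r1' : r <= 1 + 2 * e by nra.
by have [z0|z0] := ger0P z; nra.
Qed.

Lemma studentized_power_bound (z K M S Q w : R) :
  2 * `|z| + M < K -> `|Q - 1| < 4^-1 -> 0 <= w <= 4^-1 -> `|S| < M ->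
  z < (K + S) / Num.sqrt (Q - w).
Proof.
move=> Kz; rewrite ltr_norml => /andP[Q1 Q2] /andP[w0 we].
rewrite ltr_norml => /andP[S1 S2].
have D0 : 0 < Q - w by lra.
rewrite ltr_pdivlMr ?sqrtr_gt0//; set r := Num.sqrt _.
have r0 : 0 <= r by exact: sqrtr_ge0.
have r2 : r ^+ 2 = Q - w by rewrite sqr_sqrtr// ltW.
have r1' : r <= 2 by nra.
by move: Kz; have [z0|z0] := ger0P z => Kz; nra.
Qed.

Lemma measurable_sqrtV : measurable_fun [set: R] (fun x : R => (Num.sqrt x)^-1).
Proof.
rewrite (_ : (fun _ => _) = (fun x : R => powR (powR (Num.max x 0) 2^-1) (-1))).
  apply: (measurableT_comp (measurable_powR _)).
  by apply: (measurableT_comp (measurable_powR _)); exact: measurable_maxr.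
apply/funext => x; rewrite powR12_sqrt ?le_max ?lexx ?orbT// powR_inv1 ?sqrtr_ge0//.
have [x0|x0] := leP 0 x; first by [].
by rewrite ltr0_sqrtr// sqrtr0.
Qed.

Lemma measurable_studentized d (T : measurableType d) n (Y : 'I_n -> T -> R) :
  (forall i, measurable_fun setT (Y i)) ->
  measurable_fun setT (fun x => studentized (fun i => Y i x)).
Proof.
move=> mY.
have mm : measurable_fun setT (fun x => n%:R^-1 * \sum_(i < n) Y i x).
  by apply: measurable_funM => //; exact: measurable_sum.
apply: measurable_funM; first exact: measurable_funM.
apply: (measurableT_comp measurable_sqrtV); apply: measurable_funM => //.
apply: measurable_sum => i; apply: measurable_funX; exact: measurable_funB.
Qed.

(** A uniform version of Slutsky's theorem. Off the events A2 and A3 the denominator is close to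
1, and there the event implies A1, whose probability is controlled by [clt_tail]. *)
Lemma studentized_tail (l z e : R) : 0 <= l -> 0 < e ->
  exists n0 : nat, forall n, (n0 <= n)%N ->
  forall d (T : measurableType d) (P : probability T R) (g : T -> R),
    moments P g 1 l ->
  (iid P n [set X | (z <= studentized (fun i => g (tnth X i)))%R] <=
    (1 - Phi z + e)%:E)%E.
Proof.
move=> l0 e0.
(* Tolerance for the denominator; it moves the threshold z by at most e / 4. *)
pose b := Num.min 4^-1 (e / (8 * (`|z| + 1))).
have zz : 0 <= `|z| by exact: normr_ge0.
have b0 : 0 < b by rewrite lt_min invr_gt0 ltr0n/= divr_gt0// mulr_gt0//; lra.
have b4 : b <= 4^-1 by rewrite ge_min lexx.
have bz : 2 * `|z| * b <= e / 4.
  have : b <= e / (8 * (`|z| + 1)) by rewrite ge_min lexx orbT.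
  rewrite ler_pdivlMr; last by lra.
  by move: zz; move: `|z| => t t0; nra.
(* The smoothing shifts z by 3 q = e / 4. *)
pose q := e / 12.
have q0 : 0 < q by rewrite divr_gt0.
(* The three error terms add up to at most K n^(-1/2). *)
pose K := 2 / q ^+ 3 * (l + 64) + 16 * (1 + l) / b ^+ 2 + b^-1.
have i0 : 0 <= b^-1 by rewrite invr_ge0 ltW.
have K0 : 0 <= K.
  have k1 : 0 <= 2 / q ^+ 3 * (l + 64).
    by rewrite mulr_ge0 ?divr_ge0 ?exprn_ge0// ?ltW//; lra.
  have k2 : 0 <= 16 * (1 + l) / b ^+ 2 by rewrite divr_ge0 ?sqr_ge0//; lra.
  by rewrite /K; lra.
exists (Num.bound ((2 * K / e) ^+ 2)).+1 => n nn0 d T P g gm.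
have n0 : (0 < n)%N by exact: leq_ltn_trans nn0.
pose h := (Num.sqrt n%:R)^-1 : R.
have h0 : 0 < h by rewrite invr_gt0 sqrtr_gt0 ltr0n.
have h2 : h ^+ 2 = n%:R^-1 by rewrite exprVn sqr_sqrtr.
have Kh : K * h <= e / 2.
  have : (2 * K / e) ^+ 2 <= n%:R.
    have := archi_boundP (sqr_ge0 (2 * K / e)).
    move=> /ltW/le_trans; apply; rewrite ler_nat; exact: leq_trans nn0.
  have r2 : (Num.sqrt n%:R) ^+ 2 = n%:R :> R by rewrite sqr_sqrtr.
  have Ke0 : 0 <= 2 * K / e by rewrite divr_ge0 ?mulr_ge0//; exact: ltW.
  rewrite -r2 ler_pXn2r ?nnegrE ?sqrtr_ge0// ler_pdivrMr// => hK.
  by rewrite ler_pdivrMr ?sqrtr_gt0 ?ltr0n//; lra.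
have h1 : h <= 1.
  by rewrite invf_le1 ?sqrtr_gt0 ?ltr0n// -[leLHS]sqrtr1 ler_wsqrtr// ler1n.
have mg : measurable_fun setT g by case: gm.
have mS (f : T -> R) : measurable_fun setT f ->
    measurable_fun setT (fun X : n.-tuple T => \sum_(i < n) f (tnth X i)).
  by move=> mf; apply: (measurable_sum_tnth (h := fun=> f)).
pose S (X : n.-tuple T) := h * \sum_(i < n) g (tnth X i).
pose Q (X : n.-tuple T) := h ^+ 2 * \sum_(i < n) g (tnth X i) ^+ 2.
have mSS : measurable_fun setT S by apply: measurable_funM => //; exact: mS.
have mQ : measurable_fun setT Q.
  apply: measurable_funM => //; apply: (mS (fun x => g x ^+ 2)); exact: measurable_funX.
pose z' := z - 2 * `|z| * b.
(* |S| < M means that the square of the mean is less than b. *)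
pose M := Num.sqrt b / h.
have M0 : 0 < M by rewrite divr_gt0// sqrtr_gt0.
pose A1 := [set X | z' <= S X].
pose A2 := [set X | M <= `|S X|].
pose A3 := [set X | b <= `|Q X - 1|].
have mA1 : measurable A1.
  by rewrite -[X in measurable X]setTI; exact: measurable_fun_ler.
have mA2 : measurable A2.
  rewrite -[X in measurable X]setTI; apply: measurable_fun_ler => //.
  exact: measurableT_comp.
have mA3 : measurable A3.
  rewrite -[X in measurable X]setTI; apply: measurable_fun_ler => //.
  by apply: measurableT_comp => //; exact: measurable_funB.
apply: (@le_trans _ _ (iid P n (A1 `|` A2 `|` A3))).
  apply: le_measure; rewrite ?inE.
  - rewrite -[X in measurable X]setTI; apply: measurable_fun_ler => //.
    apply: (measurable_studentized (Y := fun i X => g (tnth X i))) => i.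
    exact: (measurableT_comp mg (measurable_tnth i)).
  - by apply: measurableU => //; exact: measurableU.
  move=> X /= zX.
  have [h3|h3] := leP b `|Q X - 1|; first by right.
  have [h4|h4] := leP M `|S X|; first by left; right.
  left; left; move: zX.
  have := studentizedE (fun i => g (tnth X i)) 0 n0 ltr01.
  rewrite /= -/h mul0r add0r.
  under [X in studentized X = _]eq_fun do rewrite add0r mul1r.
  move=> ->; apply: studentized_bound; [by rewrite b0|exact: h3|].
  apply/andP; split; first exact: sqr_ge0.
  rewrite -/(S X) -(real_normK (num_real (h * S X))) -(sqr_sqrtr (ltW b0)).
  rewrite ler_pXn2r ?nnegrE ?sqrtr_ge0// normrM gtr0_norm//.
  by rewrite mulrC -ler_pdivlMr// ltW.
apply: (le_trans (measureU2 _ (measurableU _ _ mA1 mA2) mA3)).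
apply: (le_trans (leeD2r _ (measureU2 _ mA1 mA2))).
apply: (le_trans (leeD (leeD (clt_tail gm n0 _ q0) (sum_chebyshev gm n0 M0))
  (sum_sqr_lln gm n0 _))).
  by rewrite b0/=; lra.
rewrite -!EFinD lee_fin -/h.
have PhiL : Phi z <= Phi (z' - 3 * q) + e / 2.
  have : z' - 3 * q <= z by rewrite /z' /q; have := mulr_ge0 (mulr_ge0 (ler0n R 2) zz) (ltW b0); lra.
  by move=> /Phi_lipschitz; rewrite /z' /q; lra.
have M2 : M ^- 2 <= b^-1 * h.
  have -> : M ^- 2 = b^-1 * h ^+ 2.
    by rewrite /M expr_div_n (sqr_sqrtr (ltW b0)) invf_div mulrC.
  by rewrite ler_pM2l ?invr_gt0// expr2 ler_piMr// ltW.
have KhE : K * h = 2 / q ^+ 3 * (l + 64) * h + 16 * (1 + l) / b ^+ 2 * h + b^-1 * h.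
  by rewrite /K; ring.
move: Kh M2 PhiL; rewrite KhE.
move: (2 / q ^+ 3 * _ * h) (16 * _ / _ * h) (b^-1 * h) (M ^- 2) (Phi _) => *.
lra.
Qed.

(** A drift a / s that is a large multiple of n^(-1/2) beats the fluctuations, which are of
order n^(-1/2) by Chebyshev's inequality, while the denominator is at most 2 with large
probability. *)
Lemma studentized_power (l z e : R) : 0 <= l -> 0 < e ->
  exists (n0 : nat) (K : R), forall n, (n0 <= n)%N ->
  forall d (T : measurableType d) (P : probability T R) (g : T -> R) (a s : R),
    moments P g 1 l -> 0 < s -> K < Num.sqrt n%:R * (a / s) ->
  (iid P n [set X | (studentized (fun i => (a + s * g (tnth X i))%R) <= z)%R] <=
    e%:E)%E.
Proof.
move=> l0 e0.
(* Chebyshev's inequality at M costs e / 2. *)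
pose M := Num.sqrt (2 / e).
have M0 : 0 < M by rewrite sqrtr_gt0 divr_gt0.
have M2 : M ^+ 2 = 2 / e by rewrite sqr_sqrtr// divr_ge0// ltW.
pose c := 16 * (1 + l) / (4^-1) ^+ 2.
pose B := 2 * c / e.
have c0 : 0 <= c by rewrite divr_ge0 ?sqr_ge0//; lra.
have B0 : 0 <= B by apply: divr_ge0; [exact: mulr_ge0|exact: ltW].
exists (Num.bound (B ^+ 2 + 4 * M ^+ 2)).+1, (2 * `|z| + M).
move=> n nn0 d T P g a s gm s0 Kas.
have n0 : (0 < n)%N by exact: leq_ltn_trans nn0.
pose h := (Num.sqrt n%:R)^-1 : R.
have h0 : 0 < h by rewrite invr_gt0 sqrtr_gt0 ltr0n.
have h2 : h ^+ 2 = n%:R^-1 by rewrite exprVn sqr_sqrtr.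
have Bn : B ^+ 2 + 4 * M ^+ 2 <= n%:R.
  have := archi_boundP (addr_ge0 (sqr_ge0 B) (mulr_ge0 (ler0n R 4) (sqr_ge0 M))).
  move=> /ltW/le_trans; apply; rewrite ler_nat; exact: leq_trans nn0.
have Bh : B * h <= 1.
  have r2 : (Num.sqrt n%:R) ^+ 2 = n%:R :> R by rewrite sqr_sqrtr.
  rewrite ler_pdivrMr ?sqrtr_gt0 ?ltr0n// mul1r.
  rewrite -(ler_pXn2r (n := 2)) ?nnegrE ?sqrtr_ge0// r2.
  by have := sqr_ge0 M; lra.
have Mh : (h * M) ^+ 2 <= 4^-1.
  rewrite exprMn h2 mulrC ler_pdivrMr ?ltr0n//.
  by have := sqr_ge0 B; lra.
have mg : measurable_fun setT g by case: gm.
have mS (f : T -> R) : measurable_fun setT f ->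
    measurable_fun setT (fun X : n.-tuple T => \sum_(i < n) f (tnth X i)).
  by move=> mf; apply: (measurable_sum_tnth (h := fun=> f)).
pose S (X : n.-tuple T) := h * \sum_(i < n) g (tnth X i).
pose Q (X : n.-tuple T) := h ^+ 2 * \sum_(i < n) g (tnth X i) ^+ 2.
have mSS : measurable_fun setT S by apply: measurable_funM => //; exact: mS.
have mQ : measurable_fun setT Q.
  apply: measurable_funM => //; apply: (mS (fun x => g x ^+ 2)); exact: measurable_funX.
pose A2 := [set X | M <= `|S X|].
pose A3 := [set X | 4^-1 <= `|Q X - 1|].
have mA2 : measurable A2.
  rewrite -[X in measurable X]setTI; apply: measurable_fun_ler => //.
  exact: measurableT_comp.
have mA3 : measurable A3.
  rewrite -[X in measurable X]setTI; apply: measurable_fun_ler => //.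
  by apply: measurableT_comp => //; exact: measurable_funB.
apply: (@le_trans _ _ (iid P n (A2 `|` A3))).
  apply: le_measure; rewrite ?inE.
  - rewrite -[X in measurable X]setTI; apply: measurable_fun_ler => //.
    apply: (measurable_studentized (Y := fun i X => a + s * g (tnth X i))) => i.
    apply: measurable_funD => //; apply: measurable_funM => //.
    exact: (measurableT_comp mg (measurable_tnth i)).
  - exact: measurableU.
  move=> X /= Xz.
  have [h3|h3] := leP 4^-1 `|Q X - 1|; first by right.
  have [h4|h4] := leP M `|S X|; first by left.
  move: Xz; rewrite leNgt => /negP[].
  rewrite (studentizedE _ _ n0 s0) -/h.
  apply: (studentized_power_bound (M := M)); [|exact: h3| |exact: h4].
    by move: Kas; rewrite invfM /h invrK [_^-1 * _]mulrC mulrCA.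
  apply/andP; split; first exact: sqr_ge0.
  apply: le_trans Mh; rewrite -/(S X) -(real_normK (num_real (h * S X))).
  have hM0 : 0 <= h * M by rewrite mulr_ge0// ltW.
  rewrite ler_pXn2r ?nnegrE// normrM gtr0_norm//.
  by rewrite ler_pM2l// ltW.
apply: (le_trans (measureU2 _ mA2 mA3)).
apply: (le_trans (leeD (sum_chebyshev gm n0 M0) (sum_sqr_lln gm n0 _))); first lra.
rewrite -EFinD lee_fin -/h M2 invf_div.
rewrite -/c (_ : c * h = e / 2 * (B * h)); last by rewrite /B; field; rewrite gt_eqF.
by nra.
Qed.

End studentized.

(** * The test given the second part of the sample *)

Section measurability_of_the_test.
Context (R : realType) (d n m : nat).
Notation XT := (n.-tuple (d.-tuple R)).

Lemma measurable_sum_cond (U : pred 'I_n) dT (T : measurableType dT) (h : 'I_n -> T -> R) :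
  (forall i, measurable_fun setT (h i)) ->
  measurable_fun setT (fun X => \sum_(i < n | U i) h i X).
Proof.
move=> mh; rewrite (_ : (fun _ => _) = fun X => \sum_(i < n) if U i then h i X else 0).
  by apply: measurable_sum => i; case: (U i).
by apply/funext => X; rewrite big_mkcond.
Qed.

(** The preimage of a Boolean value is a finite union of finite intersections of tests. The
argmax has this form, because pick sees nothing but the comparisons of coordinates. *)
Lemma measurable_finite_choice dT (T : measurableType dT) (I : finType)
    (c : I -> T -> bool) (G : {ffun I -> bool} -> bool) :
  (forall i, measurable_fun setT (c i)) ->
  measurable_fun setT (fun x => G [ffun i => c i x]).
Proof.
move=> mc; apply: (measurable_fun_bool true); rewrite setTI.
rewrite (_ : _ @^-1` _ = \bigcup_(b in [set b | G b]) \bigcap_i (c i @^-1` [set b i])).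
  apply: fin_bigcup_measurable; first exact: finite_finset.
  move=> b _; apply: fin_bigcap_measurable; first exact: finite_finset.
  by move=> i _; rewrite -[X in measurable X]setTI; exact: mc.
apply/seteqP; split => [x /= Gx|x /= [b Gb bx]].
  by exists [ffun i => c i x] => //= i _; rewrite /= ffunE.
rewrite (_ : [ffun i => _] = b)//; apply/ffunP => i; rewrite ffunE.
exact: bx.
Qed.

Lemma measurable_coord (i : 'I_n) (j : 'I_d) :
  measurable_fun setT (fun X : XT => tnth (tnth X i) j).
Proof. exact: (measurableT_comp (measurable_tnth j) (measurable_tnth i)). Qed.

Lemma measurable_muhat2 (j : 'I_d) :
  measurable_fun setT (fun X : XT => muhat2 m X j).
Proof.
apply: measurable_funM => //.
apply: (measurable_sum_cond _ (h := fun i (X : XT) => tnth (tnth X i) j)) => i.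
exact: measurable_coord.
Qed.

Lemma measurable_istar (j : 'I_d) :
  measurable_fun setT (fun X : XT => istar m X == Some j).
Proof.
pose c (jk : 'I_d * 'I_d) (X : XT) := `|muhat2 m X jk.2| <= `|muhat2 m X jk.1|.
pose G (b : {ffun 'I_d * 'I_d -> bool}) := [pick j | [forall k, b (j, k)]] == Some j.
rewrite (_ : (fun _ => _) = fun X => G [ffun jk => c jk X]).
  apply: measurable_finite_choice => jk.
  by apply: measurable_fun_ler; apply: measurableT_comp => //; exact: measurable_muhat2.
apply/funext => X; rewrite /G /istar; congr (_ == _); apply: eq_pick => i /=.
by apply: eq_forallb => k; rewrite ffunE.
Qed.

Lemma measurable_vhat (j : 'I_d) :
  measurable_fun setT (fun X : XT => tnth (vhat m X) j).
Proof.
rewrite (_ : (fun _ => _) =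
    fun X => if istar m X == Some j then Num.sg (muhat2 m X j) else 0); last first.
  by apply/funext => X; rewrite tnth_mktuple.
apply: measurable_fun_ifT => //; first exact: measurable_istar.
have msg : measurable_fun [set: R] (@Num.sg R).
  apply: measurable_fun_ifT => //; first exact: measurable_fun_eqr.
  by apply: measurable_fun_ifT => //; exact: measurable_fun_ltr.
exact: (measurableT_comp msg (measurable_muhat2 j)).
Qed.

Lemma measurable_fsparse (i : 'I_n) :
  measurable_fun setT (fun X : XT => fsparse m X (tnth X i)).
Proof.
apply: measurable_sum => j; apply: measurable_funM.
  exact: measurable_vhat.
exact: measurable_coord.
Qed.

Lemma measurable_Tsparse : measurable_fun setT (fun X : XT => Tsparse m X).
Proof.
have mb : measurable_fun setT (fun X : XT => fbar m X).
  apply: measurable_funM => //.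
  by apply: (measurable_sum_cond _ (h := fun i (X : XT) => fsparse m X (tnth X i))) => i;
    exact: measurable_fsparse.
apply: measurable_funM; first exact: measurable_funM.
apply: (measurableT_comp (@measurable_sqrtV R)); apply: measurable_funM => //.
apply: (measurable_sum_cond _
  (h := fun i (X : XT) => (fsparse m X (tnth X i) - fbar m X) ^+ 2)) => i.
by apply: measurable_funX; apply: measurable_funB => //; exact: measurable_fsparse.
Qed.

End measurability_of_the_test.

Section sample_split.
Context (R : realType) (d : nat).

Definition basis_vec (j : 'I_d) : d.-tuple R := [tuple (i == j)%:R | i < d].

Lemma dotv_basis_vec j (x : d.-tuple R) : dotv (basis_vec j) x = tnth x j.
Proof.
rewrite /dotv (bigD1 j)//= big1 ?addr0 => [|i ij].
  by rewrite tnth_mktuple eqxx mul1r.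
by rewrite tnth_mktuple (negbTE ij) mul0r.
Qed.

Lemma unit_sphere_basis_vec j : unit_sphere (basis_vec j).
Proof. by rewrite /unit_sphere /= dotv_basis_vec tnth_mktuple eqxx. Qed.

Lemma muhat2_cat m k (Z : m.-tuple (d.-tuple R)) (W : k.-tuple (d.-tuple R)) j :
  muhat2 m (cat_tuple Z W) j = k%:R^-1 * \sum_(i < k) tnth (tnth W i) j.
Proof.
rewrite /muhat2 addKn; congr (_ * _).
rewrite big_split_ord /= [X in X + _]big_pred0 ?add0r; last first.
  by move=> i; rewrite leqNgt ltn_ord.
apply: eq_big => i; first by rewrite /= leq_addr.
by rewrite tnth_rshift.
Qed.

Lemma vhat_cat m k (Z : m.-tuple (d.-tuple R)) (W : k.-tuple (d.-tuple R)) :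
  vhat m (cat_tuple Z W) = vhat 0 W.
Proof.
have E : muhat2 m (cat_tuple Z W) =1 muhat2 0 W.
  by move=> j; rewrite muhat2_cat /muhat2 subn0.
have iE : istar m (cat_tuple Z W) = istar 0 W.
  by apply: eq_pick => j; apply: eq_forallb => l; rewrite !E.
by apply: eq_from_tnth => j; rewrite !tnth_mktuple iE E.
Qed.

(** The direction is a function of W alone, so that for a fixed W the statistic is a
function of i.i.d. real variables. The independence from the dimension rests on this. *)
Lemma Tsparse_cat m k (Z : m.-tuple (d.-tuple R)) (W : k.-tuple (d.-tuple R)) :
  Tsparse m (cat_tuple Z W) = studentized (fun i => dotv (vhat 0 W) (tnth Z i)).
Proof.
have S (F : d.-tuple R -> R) :
    \sum_(i < m + k | (i < m)%N) F (tnth (cat_tuple Z W) i) = \sum_(i < m) F (tnth Z i).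
  rewrite big_split_ord /= [X in _ + X]big_pred0 ?addr0; last first.
    by move=> i; rewrite ltnNge leq_addr.
  by apply: eq_big => i; [rewrite /= ltn_ord|rewrite tnth_lshift].
have fE : fbar m (cat_tuple Z W) = m%:R^-1 * \sum_(i < m) dotv (vhat 0 W) (tnth Z i).
  by rewrite /fbar /fsparse vhat_cat (S (dotv (vhat 0 W))).
rewrite /Tsparse /studentized fE /fsparse vhat_cat.
by rewrite (S (fun x => (dotv (vhat 0 W) x - m%:R^-1 * \sum_(i < m) dotv (vhat 0 W) (tnth Z i)) ^+ 2)).
Qed.

Lemma vhatP k (W : k.-tuple (d.-tuple R)) : (0 < d)%N ->
  exists j, (forall i, `|muhat2 0 W i| <= `|muhat2 0 W j|) /\
    forall x, dotv (vhat 0 W) x = Num.sg (muhat2 0 W j) * tnth x j.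
Proof.
move=> d0.
have [j jP] : exists j, istar 0 W = Some j.
  rewrite /istar; case: pickP => [j _|noj]; first by exists j.
  pose j := [arg max_(j > Ordinal d0) `|muhat2 0 W j|]%O.
  have := noj j; rewrite /j; case: Order.TotalTheory.arg_maxP => // i _ imax.
  by move=> /negbT/forallPn[l] /negP[]; exact: imax.
exists j; split.
  move: jP; rewrite /istar; case: pickP => // i /forallP imax [<-] l; exact: imax.
move=> x; rewrite /dotv (bigD1 j)//= big1 ?addr0 => [|i ij].
  by rewrite tnth_mktuple jP eqxx.
by rewrite tnth_mktuple jP (inj_eq Some_inj) eq_sym (negbTE ij) mul0r.
Qed.

End sample_split.

(** * Moments of the coordinates *)

Section coordinate_marginals.
Context (R : realType).
Local Open Scope ereal_scope.

Lemma lebesgue_vec_set0 d : lebesgue_vec R d set0 = 0.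
Proof.
elim: d => [|d IH] /=; first by rewrite diracE in_set0.
rewrite /pushforward preimage_set0 /product_measure1.
by under eq_integral do rewrite /= xsection0 IH; exact: integral0.
Qed.

(** By induction on the dimension: either all slices lie in a hyperplane of lower dimension, or
they are empty for all but one value of the first coordinate. *)
Lemma lebesgue_vec_hyperplane d (j : 'I_d) (c : R) (B : set (d.-tuple R)) :
  measurable B -> B `<=` [set x | tnth x j = c] -> lebesgue_vec R d B = 0.
Proof.
elim: d j B => [[]//|d IH] j B mB Bc /=; rewrite /pushforward /product_measure1.
have mB' : measurable (@tcons _ R d @^-1` B).
  by rewrite -[X in measurable X]setTI; exact: measurable_tcons.
have sec y : xsection (@tcons _ R d @^-1` B) y `<=` [set t | tnth (tcons (y, t)) j = c].
  by move=> t; rewrite /xsection /= => /set_mem/Bc.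
case: (unliftP ord0 j) => [i ij|j0].
  under eq_integral => y _.
    rewrite /= (IH i); first over.
    - exact: measurable_xsection.
    - by move=> t /sec /=; rewrite ij tnthS.
  exact: integral0.
rewrite -(integral_set1 (lebesgue_vec R d \o xsection (@tcons _ R d @^-1` B)) c).
rewrite [RHS]integral_mkcond; apply: eq_integral => y _.
rewrite patchE; case: ifPn => // yc /=.
rewrite (_ : xsection _ y = set0) ?lebesgue_vec_set0//.
rewrite -subset0 => t /sec /=; rewrite j0 => yE.
by move: yc; rewrite notin_setE => /(_ yE).
Qed.

Lemma hyperplane_null d (P : probability (d.-tuple R) R) (j : 'I_d) (c : R) :
  P `<< lebesgue_vec R d -> P [set x | tnth x j = c] = 0.
Proof.
have mA : measurable [set x : d.-tuple R | tnth x j = c].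
  rewrite (_ : [set x | _] = (@tnth _ _ ^~ j) @^-1` [set c])//.
  by rewrite -[X in measurable X]setTI; exact: measurable_tnth.
move=> /(_ [set x | tnth x j = c]); apply => // B mB BA.
exact: lebesgue_vec_hyperplane BA.
Qed.

End coordinate_marginals.

Section class_moments.
Context (R : realType) (d : nat) (P : probability (d.-tuple R) R) (L : R)
  (mu : d.-tuple R).
Context (L0 : 0 <= L) (PL : calP L mu P).
Local Open Scope ereal_scope.
Context (j : 'I_d).

Let Y (x : d.-tuple R) : R := (tnth x j - tnth mu j)%R.

Let mY : measurable_fun setT Y.
Proof. by apply: measurable_funB => //; exact: measurable_tnth. Qed.

Let u := basis_vec R j.

Let projE (p : R) :
  proj_norm P mu u p = (\int[P]_x (`|Y x| `^ p)%:E) `^ p^-1.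
Proof.
rewrite /proj_norm unlock /=; congr (_ `^ _); apply: eq_integral => x _.
by rewrite !dotv_basis_vec.
Qed.

(** The ratio that defines the class is used at the basis vector of coordinate j. A vanishing
variance would put all the mass of P on the hyperplane where coordinate j equals its mean,
which is a null set. *)
Lemma calP_moments : exists2 s : R, (0 < s)%R & moments P Y (s ^+ 2)%R (L * s ^+ 3)%R.
Proof.
have [Pac Pmean P3 PLe] := PL.
pose A := \int[P]_x (`|Y x| ^+ 3)%:E; pose V := \int[P]_x (Y x ^+ 2)%:E.
have mA : measurable_fun [set: d.-tuple R] (fun x => (`|Y x| ^+ 3)%:E).
  by apply/measurable_EFinP; apply: measurable_funX; exact: measurableT_comp.
have mV : measurable_fun [set: d.-tuple R] (fun x => (Y x ^+ 2)%:E).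
  by apply/measurable_EFinP; exact: measurable_funX.
have A0 : 0 <= A by apply: integral_ge0 => x _; rewrite lee_fin exprn_ge0.
have V0 : 0 <= V by apply: integral_ge0 => x _; rewrite lee_fin sqr_ge0.
have p3 : proj_norm P mu u 3 = A `^ 3^-1.
  rewrite projE; congr (_ `^ _); apply: eq_integral => x _.
  by rewrite -powR_mulrn.
have p2 : proj_norm P mu u 2 = V `^ 2^-1.
  rewrite projE; congr (_ `^ _); apply: eq_integral => x _.
  by rewrite powR_mulrn// real_normK ?num_real.
have Afin : A < +oo.
  have := P3 _ (unit_sphere_basis_vec R j); rewrite p3 !ltey; apply: contraNN => /eqP ->.
  by rewrite poweRyr// invr_eq0.
have Vfin : V < +oo.
  apply: (@le_lt_trans _ _ (\int[P]_x ((`|Y x| ^+ 3)%:E + 1%:E))); last first.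
    rewrite ge0_integral_addcst//.
    exact: lte_add_pinfty Afin (ltry _).
  apply: ge0_le_integral => //.
  - by move=> x _; rewrite lee_fin sqr_ge0.
  - exact: emeasurable_funD.
  - move=> x _; rewrite -EFinD lee_fin -real_normK ?num_real//.
    have := normr_ge0 (Y x); move: (`|Y x|)%R => t t0.
    by have := mulr_ge0 t0 (sqr_ge0 (t - 1)); have := sqr_ge0 (t - 1); nra.
have Vn0 : V != 0.
  apply/eqP => V00.
  have : \int[P]_x `|(Y x ^+ 2)%:E| = 0.
    by rewrite -V00; apply: eq_integral => x _; rewrite gee0_abs// lee_fin sqr_ge0.
  move/(ae_eq_integral_abs P measurableT mV) => [N [mN N0 subN]].
  have mH : measurable [set x : d.-tuple R | tnth x j = tnth mu j].
    rewrite (_ : [set x | _] = (@tnth _ _ ^~ j) @^-1` [set tnth mu j])//.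
    by rewrite -[X in measurable X]setTI; exact: measurable_tnth.
  have : P setT <= P (N `|` [set x : d.-tuple R | tnth x j = tnth mu j]).
    apply: le_measure; rewrite ?inE//; first exact: measurableU.
    move=> x _; have [xj|xj] := eqVneq (tnth x j) (tnth mu j); first by right.
    left; apply: subN => /= /(_ Logic.I) [] /eqP.
    by rewrite sqrf_eq0 subr_eq0 (negbTE xj).
  have : P setT = 1 by exact: probability_setT.
  have eqle (x y : \bar R) : x = y -> x <= y by move=> ->.
  move=> -> /le_trans/(_ (measureU2 _ mN mH)).
  move=> /le_trans/(_ (leeD (eqle _ _ N0) (eqle _ _ (hyperplane_null j (tnth mu j) Pac)))).
  by rewrite adde0 leNgt lte01.
have ratio : A `^ 3^-1 / V `^ 2^-1 <= (L `^ 3^-1)%R%:E.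
  apply: le_trans PLe; rewrite -p3 -p2; apply: ereal_sup_ubound.
  by exists u => //; exact: unit_sphere_basis_vec.
have [mint mexp] := Pmean j.
have intY : P.-integrable setT (EFin \o Y).
  apply: eq_integrable (integrableB measurableT mint
    (finite_measure_integrable_cst P (tnth mu j) measurableT)) => // x _.
have intY0 : \int[P]_x (Y x)%:E = 0.
  under eq_integral do rewrite EFinB.
  rewrite integralB//; last exact: finite_measure_integrable_cst.
  move: mexp; rewrite unlock => ->.
  by rewrite integral_probability_cst subee.
have [a AE] : exists a : R, A = a%:E.
  by exists (fine A); rewrite fineK// ge0_fin_numE.
have [v VE] : exists v : R, V = v%:E.
  by exists (fine V); rewrite fineK// ge0_fin_numE.
have a0 : (0 <= a)%R by rewrite -lee_fin -AE.
have v0 : (0 < v)%R by rewrite lt0r -eqe -lee_fin -VE Vn0 V0.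
exists (Num.sqrt v); first by rewrite sqrtr_gt0.
split => //; first by rewrite sqr_sqrtr ?ltW.
rewrite -/A AE lee_fin.
move: ratio; rewrite AE VE !poweR_EFin (powR12_sqrt (ltW v0)).
rewrite inver gt_eqF ?sqrtr_gt0// -EFinM lee_fin ler_pdivrMr ?sqrtr_gt0// => ratio.
have cube (x : R) : (0 <= x -> (x `^ 3^-1) ^+ 3 = x)%R.
  by move=> x0; rewrite -powR_mulrn ?powR_ge0// -powRrM mulVf// powRr1.
rewrite -(cube a)// -{1}(cube L)// -exprMn.
by rewrite lerXn2r// nnegrE ?mulr_ge0 ?powR_ge0 ?sqrtr_ge0.
Qed.

End class_moments.

(** * The level *)

Section level.
Context (R : realType).

Lemma PhiN (z : R) : Phi (- z) = 1 - Phi z.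
Proof.
apply: EFin_inj; rewrite -Phi_tail PhiE.
have mi : measurable_fun [set: R] (fun x => (\1_`]-oo, (- z)] x)%:E : \bar R).
  by apply/measurable_EFinP; exact: measurable_indic.
transitivity (normal_prob 0 1 `[z, +oo[); last first.
  rewrite /normal_prob integral_itv_obnd_cbnd//.
  by apply/measurable_EFinP/measurable_funTS; exact: measurable_normal_pdf.
transitivity (\int[normal_prob 0 1]_x (\1_`]-oo, (- z)] x)%:E)%E.
  by rewrite integral_indic// setIT.
rewrite -(@ge0_normal_reflection R 1)//.
transitivity (\int[normal_prob 0 1]_x (\1_`[z, +oo[ x)%:E)%E.
  apply: eq_integral => x _; congr EFin; rewrite !indicE; congr (_%:R).
  by rewrite !mem_setE !in_itv/= andbT lerN2.
by rewrite integral_indic// setIT.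
Qed.

Lemma studentizedZ n (g : 'I_n -> R) (s : R) : (0 < n)%N -> 0 < s ->
  studentized (fun i => s * g i) = studentized g.
Proof.
move=> n0 s0.
have := studentizedE g 0 n0 s0; have := studentizedE g 0 n0 ltr01.
rewrite /= !mul0r !add0r => E1.
under [X in studentized X = _ -> _]eq_fun do rewrite add0r.
move=> ->; rewrite -E1; congr studentized.
by apply/funext => i; rewrite add0r mul1r.
Qed.

Lemma studentizedN n (g : 'I_n -> R) :
  studentized (fun i => - g i) = - studentized g.
Proof.
rewrite /studentized sumrN !mulrN mulNr; congr (- (_ / Num.sqrt (_ * _))).
by apply: eq_bigr => i _; rewrite -opprD sqrrN.
Qed.

(** Given all the draws but the first, the sum is prescribed by one coordinate of the first
draw, which is a null event. *)
Lemma iid_sum_hyperplane_null d (P : probability (d.-tuple R) R) k (j : 'I_d) (c : R) :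
  P `<< lebesgue_vec R d -> (0 < k)%N ->
  iid P k [set W | \sum_(i < k) tnth (tnth W i) j = c] = 0%E.
Proof.
move=> Pac; case: k => // k _.
have mB : measurable [set W : k.+1.-tuple (d.-tuple R) | \sum_(i < k.+1) tnth (tnth W i) j = c].
  have ms : measurable_fun setT (fun W : k.+1.-tuple (d.-tuple R) => \sum_(i < k.+1) tnth (tnth W i) j).
    by apply: (measurable_sum_tnth (h := fun _ => (@tnth _ _)^~ j)) => i; exact: measurable_tnth.
  rewrite (_ : [set W | _] = (fun W : k.+1.-tuple (d.-tuple R) => \sum_(i < k.+1) tnth (tnth W i) j) @^-1` [set c])//.
  by rewrite -[X in measurable X]setTI; exact: ms.
set B := [set W | _] in mB *.
transitivity (\int[iid P k.+1]_W (\1_B W)%:E)%E; first by rewrite integral_indic// setIT.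
have mBE : measurable_fun setT (fun W => (\1_B W)%:E : \bar R).
  by apply/measurable_EFinP; exact: measurable_indic.
rewrite integral_iidS//.
rewrite (fubini_tonelli (m2 := iid P k) (fun xW => (\1_B (tcons xW))%:E))//; last first.
  by apply: (measurableT_comp mBE); exact: measurable_tcons.
rewrite (eq_integral (cst 0%E)); first exact: integral0.
move=> W _.
  rewrite (eq_integral (fun x => (\1_[set x : d.-tuple R | tnth x j = (c - \sum_(i < k) tnth (tnth W i) j)%R] x)%:E)); last first.
    move=> x _; congr EFin; rewrite !indicE; congr (nat_of_bool _)%:R.
    have E : \sum_(i < k.+1) tnth (tnth (tcons (x, W)) i) j =
        tnth x j + \sum_(i < k) tnth (tnth W i) j.
      by rewrite big_ord_recl; congr (_ + _); apply: eq_bigr => i _; rewrite tnthS.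
    apply/idP/idP => /set_mem h; apply/mem_set; move: h; rewrite /B /= E.
      by move=> <-; rewrite addrK.
    by move=> ->; rewrite subrK.
  rewrite integral_indic//; last first.
    rewrite (_ : [set x | _] = (@tnth d R ^~ j) @^-1` [set (c - \sum_(i < k) tnth (tnth W i) j)%R])//.
    by rewrite -[X in measurable X]setTI; exact: measurable_tnth.
by rewrite setIT; exact: hyperplane_null.
Qed.

Section level_bound.
Context (L : R) (z e : R).
Context (L0 : 0 <= L) (e0 : 0 < e).

(** The event B that one fixed coordinate of the second mean vanishes is null. Off B the
largest coordinate does not vanish, so that the direction is a signed basis vector:
projecting gives a centred variable, which is
normalized to variance 1. The lower tail is the upper tail of the opposite variable. *)
Lemma level_bound : exists m0 : nat, forall m k d, (m0 <= m)%N -> (0 < m)%N ->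
  (0 < k)%N -> (0 < d)%N -> forall P, @calP0 R d L P ->
  (iid P (m + k) [set X | (z <= Tsparse m X)%R] <= (1 - Phi z + e)%:E)%E /\
  (iid P (m + k) [set X | (Tsparse m X <= z)%R] <= (Phi z + e)%:E)%E.
Proof.
have [n1 H1] := studentized_tail z L0 e0.
have [n2 H2] := studentized_tail (- z) L0 e0.
exists (maxn n1 n2) => m k d; rewrite geq_max => /andP[nm1 nm2] m0 k0 d0 P PL.
have [Pac _ _ _] := PL.
pose j0 := Ordinal d0.
pose B := [set W : k.-tuple (d.-tuple R) | \sum_(i < k) tnth (tnth W i) j0 = 0].
have mB : measurable B.
  have ms : measurable_fun setT (fun W : k.-tuple (d.-tuple R) => \sum_(i < k) tnth (tnth W i) j0).
    by apply: (measurable_sum_tnth (h := fun _ => (@tnth _ _)^~ j0)) => i; exact: measurable_tnth.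
  rewrite (_ : B = (fun W : k.-tuple (d.-tuple R) => \sum_(i < k) tnth (tnth W i) j0) @^-1` [set 0])//.
  by rewrite -[X in measurable X]setTI; exact: ms.
have PB : iid P k B = 0%E by exact: iid_sum_hyperplane_null.
have std W : ~ B W -> exists g, moments P g 1 L /\ forall Z : m.-tuple (d.-tuple R),
    Tsparse m (cat_tuple Z W) = studentized (fun i => g (tnth Z i)).
  move=> BW; have [j [jmax vE]] := vhatP W d0.
  have mj0 : muhat2 0 W j != 0.
    apply: contra_notN BW => /eqP mj; have := jmax j0; rewrite mj normr0 normr_le0.
    rewrite /muhat2 subn0 mulf_eq0 invr_eq0 pnatr_eq0 (gtn_eqF k0)/= => /eqP.
    by rewrite /B /=.
  have [s s0 sm] := calP_moments L0 PL j.
  (* The sign of the direction and the normalization to variance 1. *)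
  pose c := Num.sg (muhat2 0 W j) / s.
  have c2 : c ^+ 2 * s ^+ 2 = 1.
    by rewrite /c expr_div_n mulfVK ?sqr_sg ?mj0// expf_neq0// gt_eqF.
  have c3 : `|c| ^+ 3 * (L * s ^+ 3) = L.
    rewrite /c normrM normr_sg mj0 mul1r gtr0_norm ?invr_gt0// exprVn.
    by field; rewrite gt_eqF.
  exists (fun x => c * (tnth x j - tnth [tuple 0 | _ < d] j)); split.
    by have := momentsZ c sm; rewrite c2 c3.
  move=> Z; rewrite Tsparse_cat -[RHS](studentizedZ _ m0 s0); congr studentized.
  apply/funext => i; rewrite vE tnth_mktuple subr0 /c; field.
  by rewrite gt_eqF.
have mT := @measurable_Tsparse R d (m + k) m.
split.
- rewrite -[leRHS]adde0 -PB; apply: iid_cat_le => //.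
  + by rewrite -[X in measurable X]setTI; exact: measurable_fun_ler.
  + by rewrite addr_ge0 ?subr_ge0 ?Phi_le1// ltW.
  move=> W /std[g [gm gE]].
  rewrite (_ : [set Z | _] = [set Z : m.-tuple (d.-tuple R) | (z <= studentized (fun i => g (tnth Z i)))%R]).
    exact: H1.
  by apply/seteqP; split => Z /=; rewrite gE.
- rewrite -[leRHS]adde0 -PB; apply: iid_cat_le => //.
  + by rewrite -[X in measurable X]setTI; exact: measurable_fun_ler.
  + by rewrite addr_ge0 ?Phi_ge0// ltW.
  move=> W /std[g [gm gE]].
  have gNm : moments P (fun x => - 1 * g x) 1 L.
    by have := momentsZ (- 1) gm; rewrite sqrrN normrN1 !expr1n !mul1r.
  rewrite (_ : [set Z | _] = [set Z : m.-tuple (d.-tuple R) | (- z <= studentized (fun i => - 1 * g (tnth Z i)))%R]).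
    by have := H2 m nm2 _ _ _ _ gNm; rewrite PhiN opprB addrCA subrr addr0.
  have NE (Z : m.-tuple (d.-tuple R)) : studentized (fun i => - 1 * g (tnth Z i)) =
      - studentized (fun i => g (tnth Z i)).
    by rewrite -studentizedN; congr studentized; apply/funext => i; rewrite mulN1r.
  by apply/seteqP; split => Z /=; rewrite gE NE lerN2.
Qed.

End level_bound.
End level.

(** * The uniform law on the cube *)

Section uniform_sample.
Context (R : realType).
Local Open Scope ereal_scope.
Notation mu := (@lebesgue_measure R).

Let ab : (-1 < 1 :> R)%R. Proof. by lra. Qed.

(** Carries the uniform law from the copy of R that bears Lebesgue measure to R with its
Borel sets. *)
Definition unif_id (x : measurableTypeR R) : R := x.

Lemma measurable_unif_id : measurable_fun setT unif_id.
Proof. by move=> _ A mA; rewrite setTI; exact: mA. Qed.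

HB.instance Definition _ :=
  @isMeasurableFun.Build _ _ _ _ unif_id measurable_unif_id.

Definition unif : probability R R := distribution (uniform_prob ab) unif_id.

Lemma ge0_integral_unif (f : R -> \bar R) :
  measurable_fun setT f -> (forall x, 0 <= f x) ->
  \int[unif]_x f x = (2^-1)%:E * \int[mu]_(x in `[(-1)%R, 1%R]) f x.
Proof.
move=> mf f0; rewrite ge0_integral_distribution// integral_uniform//.
by congr (_%:E * _); congr (_^-1)%R; ring.
Qed.

Lemma integral_unif_le (f : R -> \bar R) :
  measurable_fun setT f -> (forall x, 0 <= f x) ->
  \int[unif]_x f x <= \int[mu]_x f x.
Proof.
move=> mf f0; rewrite ge0_integral_unif//.
apply: (@le_trans _ _ (1 * \int[mu]_(x in `[(-1)%R, 1%R]) f x)).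
  by apply: lee_wpmul2r; [exact: integral_ge0|rewrite lee_fin; lra].
rewrite mul1e; exact: ge0_subset_integral.
Qed.

Lemma integral_unif_poly (c0 c1 c2 c3 c4 : R) :
  let f x := (c0 + c1 * x + c2 * x ^+ 2 + c3 * x ^+ 3 + c4 * x ^+ 4)%R in
  (forall x, 0 <= f x)%R ->
  \int[unif]_x (f x)%:E = (c0 + c2 / 3 + c4 / 5)%:E.
Proof.
move=> f f0.
pose F (x : R) := (c0 * x + c1 / 2 * x ^+ 2 + c2 / 3 * x ^+ 3 + c3 / 4 * x ^+ 4 + c4 / 5 * x ^+ 5)%R.
have dF (x : R) : is_derive x (1%R : R) F (f x).
  apply: is_derive_eq.
  by rewrite -![_ *: _]/(_ * _)%R /f; field.
have df (x : R) : is_derive x (1%R : R) f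
    (c1 + 2 * c2 * x + 3 * c3 * x ^+ 2 + 4 * c4 * x ^+ 3)%R.
  apply: is_derive_eq.
  by rewrite -![_ *: _]/(_ * _)%R; ring.
have cf : continuous f by move=> x; exact: is_derive_continuous (df x).
have mf : measurable_fun [set: R] f by exact: continuous_measurable_fun.
rewrite ge0_integral_unif//; last exact/measurable_EFinP.
rewrite (@continuous_FTC2 _ f F _ _ ab (continuous_subspaceT cf)).
- by rewrite -EFinM; congr EFin; rewrite /F; field.
- split.
  + by move=> x _; have [] := dF x.
  + exact/cvg_at_right_filter/(is_derive_continuous (dF _)).
  + exact/cvg_at_left_filter/(is_derive_continuous (dF _)).
- by move=> x _; rewrite derive1E; have [_ ->] := dF x.
Qed.

(** It is applied with g built from sections of lebesgue_vec, a mere set function; the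
comparison holds for the suprema over simple functions, without any
measurability. *)
Lemma ge0_le_integral_simple (f g : R -> \bar R) : (forall x, 0 <= f x) ->
  (forall x, f x <= g x) -> \int[mu]_x f x <= \int[mu]_x g x.
Proof.
move=> f0 fg; have g0 x : 0 <= g x by exact: le_trans (f0 x) (fg x).
rewrite !ge0_integralTE//; apply: ereal_sup_le => _ [h hf <-].
by exists h => // x; exact: le_trans (hf x) (fg x).
Qed.

(** Each factor has a density, which is at most 1. *)
Lemma iid_unif_le_lebesgue_vec d (B : set (d.-tuple R)) :
  measurable B -> iid unif d B <= lebesgue_vec R d B.
Proof.
elim: d B => [//|d IH] B mB.
have mB' : measurable (@tcons _ R d @^-1` B).
  by rewrite -[X in measurable X]setTI; exact: measurable_tcons.
have mBE : measurable_fun setT (fun W => (\1_B W)%:E : \bar R).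
  by apply/measurable_EFinP; exact: measurable_indic.
have -> : iid unif d.+1 B = \int[iid unif d.+1]_X (\1_B X)%:E.
  by rewrite integral_indic// setIT.
rewrite integral_iidS//.
have secE x : [set W | B (tcons (x, W))] = xsection (@tcons _ R d @^-1` B) x.
  by apply/seteqP; split => t; rewrite /xsection /= inE.
have mc x : measurable [set W | B (tcons (x, W))].
  by rewrite secE; exact: measurable_xsection.
have inner x : \int[iid unif d]_W (\1_B (tcons (x, W)))%:E =
    iid unif d [set W | B (tcons (x, W))].
  rewrite (eq_integral (fun W => (\1_[set W | B (tcons (x, W))] W)%:E))//.
  by rewrite integral_indic// setIT.
apply: (@le_trans _ _ (\int[mu]_x \int[iid unif d]_W (\1_B (tcons (x, W)))%:E)).
  apply: integral_unif_le; last by move=> x; exact: integral_ge0.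
  apply: (measurable_fun_fubini_tonelli_F (m2 := iid unif d)
    (fun xW => (\1_B (tcons xW))%:E)) => [|xW]; last by rewrite lee_fin.
  by apply: (measurableT_comp mBE); exact: measurable_tcons.
rewrite /= /pushforward /product_measure1.
apply: ge0_le_integral_simple => x; first exact: integral_ge0.
rewrite inner secE.
by apply: IH; exact: measurable_xsection.
Qed.

Lemma iid_unif_dominates d : iid unif d `<< lebesgue_vec R d.
Proof.
move=> A A0 B mB BA; apply/eqP; rewrite eq_le measure_ge0 andbT.
by rewrite -(A0 B mB BA); exact: iid_unif_le_lebesgue_vec.
Qed.

Section linear_forms.
Context (d : nat) (u : d.-tuple R).

Let w k : R := nth 0%R u (d - k.+1).
Let a k : R := \sum_(l < k) w l ^+ 2.
Let aS k : (a k.+1 = a k + w k ^+ 2)%R. Proof. by rewrite /a big_ord_recr. Qed.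
Let a0 k : (0 <= a k)%R. Proof. by apply: sumr_ge0 => i _; exact: sqr_ge0. Qed.

Let dotE (X : d.-tuple R) : dotv u X = (\sum_(i < d) w (d - i.+1) * tnth X i)%R.
Proof.
apply: eq_bigr => i _; rewrite /w subnSK// subKn ?(ltnW (ltn_ord i))//.
by rewrite (tnth_nth 0%R).
Qed.

Let ad : (a d = dotv u u)%R.
Proof.
rewrite /a (reindex_inj rev_ord_inj)/=; apply: eq_bigr => i _.
rewrite /w subnSK// subKn ?(ltnW (ltn_ord i))// -expr2.
by rewrite (tnth_nth 0%R).
Qed.

Let mw k : measurable_fun [set: R] (fun x => w k * x)%R.
Proof. exact: measurable_funM. Qed.

(** Each coordinate has variance 1/3, and a k is the squared length of the coefficients of the
last k coordinates. *)
Lemma iid_unif_sqr (s : R) :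
  \int[iid unif d]_X ((s + dotv u X) ^+ 2)%:E = (s ^+ 2 + dotv u u / 3)%:E.
Proof.
pose F k (s : R) := (s ^+ 2 + a k / 3)%:E.
have F0 k t : 0 <= F k t by rewrite lee_fin addr_ge0 ?sqr_ge0// divr_ge0.
have mF k : measurable_fun setT (F k).
  by apply/measurable_EFinP; apply: measurable_funD => //; exact: measurable_funX.
have FS k t : \int[unif]_x F k (t + w k * x)%R = F k.+1 t.
  have E x : ((t + w k * x) ^+ 2 + a k / 3 = (t ^+ 2 + a k / 3) + (2 * t * w k) * x +
      w k ^+ 2 * x ^+ 2 + 0 * x ^+ 3 + 0 * x ^+ 4)%R by ring.
  rewrite /F; under eq_integral do rewrite E.
  rewrite integral_unif_poly => [|x]; last by rewrite -E addr_ge0 ?sqr_ge0// divr_ge0.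
  by congr EFin; rewrite aS; field.
have := iid_sum_eq mw mF F0 FS d s.
rewrite {2}/F ad => <-; apply: eq_integral => X _; rewrite dotE /F.
by rewrite /a big_ord0 mul0r addr0.
Qed.

(** For Gaussian coordinates of variance 1/3, F would satisfy the recursion exactly; the fourth
moment 1/5 of the uniform law is smaller than 1/3, which leaves an inequality. *)
Lemma iid_unif_pow4 :
  \int[iid unif d]_X (dotv u X ^+ 4)%:E <= (dotv u u ^+ 2 / 3)%:E.
Proof.
pose F k (s : R) := (s ^+ 4 + 2 * a k * s ^+ 2 + a k ^+ 2 / 3)%:E.
have p0 k (t : R) : (0 <= t ^+ 4 + 2 * a k * t ^+ 2 + a k ^+ 2 / 3)%R.
  have t4 : (0 <= t ^+ 4)%R.
    by rewrite (_ : t ^+ 4 = (t ^+ 2) ^+ 2)%R; [exact: sqr_ge0|ring].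
  apply: addr_ge0; last by rewrite divr_ge0 ?sqr_ge0.
  by apply: addr_ge0 => //; apply: mulr_ge0; [exact: mulr_ge0|exact: sqr_ge0].
have F0 k t : 0 <= F k t by rewrite lee_fin.
have mF k : measurable_fun setT (F k).
  apply/measurable_EFinP; apply: measurable_funD => //; apply: measurable_funD.
    exact: measurable_funX.
  by apply: measurable_funM => //; exact: measurable_funX.
have FS k t : \int[unif]_x F k (t + w k * x)%R <= F k.+1 t.
  have E x : ((t + w k * x) ^+ 4 + 2 * a k * (t + w k * x) ^+ 2 + a k ^+ 2 / 3 =
      (t ^+ 4 + 2 * a k * t ^+ 2 + a k ^+ 2 / 3) +
      (4 * t ^+ 3 * w k + 4 * a k * t * w k) * x +
      (6 * t ^+ 2 * w k ^+ 2 + 2 * a k * w k ^+ 2) * x ^+ 2 +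
      (4 * t * w k ^+ 3) * x ^+ 3 + w k ^+ 4 * x ^+ 4)%R by ring.
  rewrite /F; under eq_integral do rewrite E.
  rewrite integral_unif_poly => [|x]; last by rewrite -E.
  rewrite lee_fin aS -subr_ge0.
  rewrite (_ : (_ - _)%R = (2 / 15 * (w k ^+ 2) ^+ 2)%R); last by field.
  by rewrite mulr_ge0 ?sqr_ge0.
have := iid_sum_le mw mF F0 FS d 0%R.
rewrite {2}/F ad !expr0n/= mulr0 !add0r; apply: le_trans.
rewrite le_eqVlt; apply/orP; left; apply/eqP.
apply: eq_integral => X _; rewrite dotE /F.
by rewrite /a big_ord0 !add0r mulr0 mul0r expr0n/= mul0r !addr0.
Qed.

End linear_forms.
End uniform_sample.

(** * Nonemptiness of the null class *)

Section nonempty.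
Context (R : realType) (d : nat) (L : R).
Context (L2 : 2 <= L).
Local Open Scope ereal_scope.

Let P := iid (@unif R) d.
Let zero : d.-tuple R := [tuple 0%R | _ < d].

Let dotv0 (u : d.-tuple R) : dotv u zero = 0%R.
Proof. by rewrite /dotv big1// => i _; rewrite tnth_mktuple mulr0. Qed.

Let mdot (u : d.-tuple R) : measurable_fun setT (dotv u).
Proof.
apply: measurable_sum => i; apply: measurable_funM => //.
exact: measurable_tnth.
Qed.

Let sqrE u : unit_sphere u -> \int[P]_X (dotv u X ^+ 2)%:E = (3^-1)%:E.
Proof.
move=> u1; have := iid_unif_sqr u 0%R.
by under eq_integral do rewrite add0r; rewrite expr0n/= add0r u1 mul1r.
Qed.

Let abs3 u : unit_sphere u -> exists a : R, [/\ (0 <= a)%R, (a <= 3^-1)%R &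
  \int[P]_X (`|dotv u X| ^+ 3)%:E = a%:E].
Proof.
move=> u1.
have A0 : 0 <= \int[P]_X (`|dotv u X| ^+ 3)%:E.
  by apply: integral_ge0 => X _; rewrite lee_fin exprn_ge0.
have Ale : \int[P]_X (`|dotv u X| ^+ 3)%:E <= (3^-1)%:E.
  apply: (@le_trans _ _ (\int[P]_X ((2^-1)%:E * (dotv u X ^+ 4)%:E +
      (2^-1)%:E * (dotv u X ^+ 2)%:E))).
    apply: ge0_le_integral => //.
    - by apply/measurable_EFinP; apply: measurable_funX; exact: measurableT_comp.
    - apply: emeasurable_funD; apply: emeasurable_funM => //; apply/measurable_EFinP;
        exact: measurable_funX.
    - move=> X _; rewrite -!EFinM -EFinD lee_fin.
      have -> : (dotv u X ^+ 4 = (dotv u X ^+ 2) ^+ 2)%R by ring.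
      rewrite -(real_normK (num_real (dotv u X))).
      have := normr_ge0 (dotv u X); move: (`|dotv u X|)%R => t t0.
      by have := mulr_ge0 (sqr_ge0 t) (sqr_ge0 (t - 1)); nra.
  have p4 X : 0 <= (dotv u X ^+ 4)%:E.
    by rewrite lee_fin (_ : dotv u X ^+ 4 = (dotv u X ^+ 2) ^+ 2)%R; [exact: sqr_ge0|ring].
  have m4 : measurable_fun setT (fun X => (dotv u X ^+ 4)%:E).
    by apply/measurable_EFinP; exact: measurable_funX.
  have m2 : measurable_fun setT (fun X => (dotv u X ^+ 2)%:E).
    by apply/measurable_EFinP; exact: measurable_funX.
  rewrite ge0_integralD//; last 4 first.
  - by move=> X _; rewrite mule_ge0// lee_fin.
  - exact: emeasurable_funM.
  - by move=> X _; rewrite mule_ge0// lee_fin sqr_ge0.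
  - exact: emeasurable_funM.
  rewrite !ge0_integralZl//; last by move=> X _; rewrite lee_fin sqr_ge0.
  rewrite sqrE//; have := iid_unif_pow4 u; rewrite u1 expr1n mul1r => h4.
  apply: (@le_trans _ _ ((2^-1)%:E * (3^-1)%:E + (2^-1)%:E * (3^-1)%:E)).
    by apply: leeD2r; apply: lee_wpmul2l => //; rewrite lee_fin.
  by rewrite -!EFinM -EFinD lee_fin; lra.
have Afin : \int[P]_X (`|dotv u X| ^+ 3)%:E \is a fin_num.
  by rewrite ge0_fin_numE//; exact: le_lt_trans Ale (ltry _).
exists (fine (\int[P]_X (`|dotv u X| ^+ 3)%:E)); split.
- by rewrite -lee_fin fineK.
- by rewrite -lee_fin fineK.
- by rewrite fineK.
Qed.

Let projE u (p : R) :
  proj_norm P zero u p = (\int[P]_x (`|dotv u x| `^ p)%:E) `^ p^-1.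
Proof.
rewrite /proj_norm unlock /=; congr (_ `^ _); apply: eq_integral => x _.
by rewrite dotv0 subr0.
Qed.

Let proj3 u : unit_sphere u ->
  exists2 a : R, (0 <= a <= 3^-1)%R & proj_norm P zero u 3 = (a `^ 3^-1)%:E.
Proof.
move=> /abs3[a [a0 a1 aE]]; exists a; first by rewrite a0.
rewrite projE -poweR_EFin -aE; congr (_ `^ _); apply: eq_integral => x _.
by rewrite -powR_mulrn.
Qed.

Let proj2 u : unit_sphere u -> proj_norm P zero u 2 = (Num.sqrt 3^-1)%:E.
Proof.
move=> u1; rewrite projE -powR12_sqrt// -poweR_EFin -(sqrE u1).
congr (_ `^ _); apply: eq_integral => x _.
by rewrite powR_mulrn// real_normK ?num_real.
Qed.

Let mean0 : has_mean P zero.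
Proof.
move=> j; rewrite tnth_mktuple.
have mj : measurable_fun [set: d.-tuple R] (fun x => tnth x j) by exact: measurable_tnth.
have E s : \int[P]_X ((s + tnth X j) ^+ 2)%:E = (s ^+ 2 + 3^-1)%:E.
  have := iid_unif_sqr (basis_vec R j) s.
  rewrite (unit_sphere_basis_vec R j) mul1r => <-.
  by under [RHS]eq_integral do rewrite dotv_basis_vec.
have i2 s : P.-integrable setT (fun X => ((s + tnth X j) ^+ 2)%:E).
  apply/integrableP; split.
    by apply/measurable_EFinP; apply: measurable_funX; exact: measurable_funD.
  under eq_integral do rewrite gee0_abs ?lee_fin ?sqr_ge0//.
  by rewrite E ltry.
have lin (X : d.-tuple R) : (tnth X j)%:E = (2^-1)%:E * (((1 + tnth X j) ^+ 2)%:E - ((0 + tnth X j) ^+ 2)%:E - 1%:E).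
  by rewrite -!EFinB -EFinM; congr EFin; field.
have ic : P.-integrable setT (cst 1%:E) by exact: finite_measure_integrable_cst.
have i12 := integrableB measurableT (i2 1%R) (i2 0%R).
have i123 := integrableB measurableT i12 ic.
have i1 : P.-integrable setT (fun x => (tnth x j)%:E).
  by apply: eq_integrable (integrableZl measurableT 2^-1 i123) => // X _; rewrite lin.
split => //; rewrite unlock; under eq_integral do rewrite lin.
rewrite integralZl// integralB// integralB// !E integral_probability_cst.
by rewrite -!EFinB -EFinM; congr EFin; field.
Qed.

(** The uniform law on the cube is a witness in every dimension. In a unit direction its second
moment is 1/3 and its third absolute moment is at most 1/3, as t^3 <= (t^2 + t^4) / 2; the
cube of the ratio of the norms is thus at most sqrt 3, which is less than 2. *)
Lemma calP0_nonempty : @calP0 R d L !=set0.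
Proof.
exists P; split => //.
- exact: iid_unif_dominates.
- by move=> u /proj3[a _ ->]; rewrite ltry.
apply: ge_ereal_sup => _ [u u1 <-].
have [a /andP[a0 a1] ->] := proj3 u1; rewrite proj2//.
have s0 : (0 < Num.sqrt 3^-1 :> R)%R by rewrite sqrtr_gt0.
rewrite inver gt_eqF// -EFinM lee_fin ler_pdivrMr//.
have cube (x : R) : (0 <= x -> (x `^ 3^-1) ^+ 3 = x)%R.
  by move=> x0; rewrite -powR_mulrn ?powR_ge0// -powRrM mulVf// powRr1.
rewrite -(ler_pXn2r (n := 3)) ?nnegrE ?mulr_ge0 ?powR_ge0// ?(ltW s0)//.
have L2' : (2 <= L)%R := L2.
rewrite exprMn !cube//; last by lra.
have : ((Num.sqrt 3^-1) ^+ 2 = 3^-1 :> R)%R by rewrite sqr_sqrtr.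
move: s0; move: (Num.sqrt _)%R => r r0 r2.
have r12 : (2^-1 <= r)%R by nra.
by rewrite (_ : r ^+ 3 = 3^-1 * r)%R; [nra|rewrite -r2; ring].
Qed.

End nonempty.

(** * Sub-Gaussian coordinates *)

Lemma union_bound d (T : measurableType d) (R : realType)
    (P : {measure set T -> \bar R}) n (A : 'I_n -> set T) (c : R) :
  (forall i, measurable (A i)) -> (forall i, P (A i) <= c%:E)%E ->
  (P (\bigcup_i A i) <= (n%:R * c)%:E)%E.
Proof.
move=> mA Ac.
have -> : \bigcup_i A i = \big[setU/set0]_(i <- enum 'I_n) A i.
  apply/seteqP; split => [x [i _ Aix]|x].
    by rewrite -bigcup_seq; exists i => //=; rewrite mem_enum.
  by rewrite -bigcup_seq => -[i _ Aix]; exists i.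
have H s : (P (\big[setU/set0]_(i <- s) A i) <= ((size s)%:R * c)%:E)%E.
  elim: s => [|i s IH]; first by rewrite big_nil measure0 mul0r.
  rewrite big_cons; apply: (le_trans (measureU2 _ _ _)) => //.
    by apply: bigsetU_measurable.
  by rewrite /= -natr1 mulrDl mul1r addrC EFinD; apply: leeD.
by have := H (enum 'I_n); rewrite size_enum_ord.
Qed.

Section subgaussian_means.
Context d (T : measurableType d) (R : realType) (P : probability T R).
Context (g : T -> R) (sigma : R).
Context (sigma0 : 0 < sigma) (mg : measurable_fun setT g)
  (gsub : forall lambda, (\int[P]_x (expR (lambda * g x))%:E <=
    (expR (lambda ^+ 2 * sigma ^+ 2))%:E)%E).
Local Open Scope ereal_scope.

Let mexp (c : R) : measurable_fun setT (fun x => (expR (c * g x))%:E).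
Proof.
apply/measurable_EFinP; apply: measurableT_comp => //; exact: measurable_funM.
Qed.

(** Apply y^2 <= 2 (exp y + exp (- y)) to y = g / sigma. *)
Lemma subgaussian_sqr (v : R) : \int[P]_x (g x ^+ 2)%:E = v%:E ->
  (v <= 4 * expR 1 * sigma ^+ 2)%R.
Proof.
move=> gv; have s0 : (0 < sigma)%R := sigma0.
have := gsub (sigma^-1); have := gsub (- sigma^-1).
rewrite sqrrN exprVn mulVf ?expf_neq0 ?gt_eqF// => hm hp.
rewrite -lee_fin -gv.
apply: (@le_trans _ _ (\int[P]_x ((2 * sigma ^+ 2)%:E * ((expR (sigma^-1 * g x))%:E +
    (expR (- sigma^-1 * g x))%:E)))).
  apply: ge0_le_integral => //.
  - by move=> x _; rewrite lee_fin sqr_ge0.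
  - by apply/measurable_EFinP; exact: measurable_funX.
  - by apply: emeasurable_funM => //; apply: emeasurable_funD; exact: mexp.
  move=> x _; rewrite -EFinD -EFinM lee_fin.
  pose y := (sigma^-1 * g x)%R.
  have -> : (g x = sigma * y)%R by rewrite /y mulVKf// gt_eqF.
  rewrite mulKf ?gt_eqF// mulNr mulKf ?gt_eqF// exprMn.
  suff : (y ^+ 2 <= 2 * (expR y + expR (- y)))%R.
    by have := exprn_gt0 2 s0; nra.
  have e0 := expR_gt0 y; have e1 := expR_gt0 (- y).
  have [y0|y0] := leP 0%R y.
    by have := expR_ge1Dxn 1 y0; rewrite (_ : 2`! = 2)%N//; lra.
  have y0' : (0 <= - y)%R by lra.
  by have := expR_ge1Dxn 1 y0'; rewrite (_ : 2`! = 2)%N// sqrrN; lra.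
rewrite ge0_integralZl//; last 3 first.
- by apply: emeasurable_funD; exact: mexp.
- by move=> x _; rewrite -EFinD lee_fin addr_ge0// expR_ge0.
- by rewrite lee_fin mulr_ge0// sqr_ge0.
rewrite ge0_integralD//.
rewrite (_ : (4 * expR 1 * sigma ^+ 2)%:E =
    (2 * sigma ^+ 2)%:E * ((expR 1)%:E + (expR 1)%:E)); last first.
  by rewrite -EFinD -EFinM; congr EFin; ring.
apply: lee_wpmul2l; first by rewrite lee_fin mulr_ge0// sqr_ge0.
exact: leeD.
Qed.

(** The Chernoff bound, where F k s bounds the exponential moment when k summands are to come. *)
Lemma subgaussian_mean_tail k (t : R) : (0 < t)%R -> (0 < k)%N ->
  iid P k [set W | (t <= k%:R^-1 * \sum_(i < k) g (tnth W i))%R] <=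
  (expR (- (k%:R * t ^+ 2 / (4 * sigma ^+ 2))))%:E.
Proof.
move=> t0 k0; have s0 : (0 < sigma)%R := sigma0.
have kR : (0 < k%:R :> R)%R by rewrite ltr0n.
(* The minimizer of l^2 sigma^2 - l t. *)
pose l : R := (t / (2 * sigma ^+ 2))%R.
have ss0 : (0 < sigma ^+ 2)%R by exact: exprn_gt0.
have l0 : (0 < l)%R by rewrite divr_gt0// mulr_gt0.
pose F n (s : R) := (expR (l * s + n%:R * (l ^+ 2 * sigma ^+ 2) - l * k%:R * t))%:E.
have mF n : measurable_fun setT (F n).
  apply/measurable_EFinP; apply: measurableT_comp => //; apply: measurable_funB => //.
  by apply: measurable_funD => //; exact: measurable_funM.
have F0 n s : 0 <= F n s by rewrite lee_fin expR_ge0.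
have FS n s : \int[P]_x F n (s + g x)%R <= F n.+1 s.
  have E x : F n (s + g x)%R = F n s * (expR (l * g x))%:E.
    by rewrite /F -EFinM -expRD; congr (expR _)%:E; ring.
  under eq_integral do rewrite E.
  rewrite ge0_integralZl//.
  apply: (le_trans (lee_wpmul2l (F0 n s) (gsub l))).
  rewrite /F -EFinM -expRD lee_fin ler_expR -natr1.
  by rewrite le_eqVlt; apply/orP; left; apply/eqP; ring.
have := iid_sum_le (fun=> mg) mF F0 FS k 0%R.
have -> : F k 0%R = (expR (- (k%:R * t ^+ 2 / (4 * sigma ^+ 2))))%:E.
  by rewrite /F /l; congr (expR _)%:E; field; rewrite gt_eqF.
apply: le_trans; have mS : measurable_fun setT (fun W : k.-tuple T => \sum_(i < k) g (tnth W i))%R.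
  exact: (measurable_sum_tnth (h := fun=> g)).
apply: le_integral_dominating.
- rewrite -[X in measurable X]setTI; apply: measurable_fun_ler => //.
  exact: measurable_funM.
- by apply: (measurableT_comp (mF 0%N)); exact: measurable_funD.
- by move=> W; exact: F0.
move=> W /= tW; rewrite /F add0r mul0r addr0 lee_fin -[X in (X <= _)%R]expR0 ler_expR subr_ge0.
by rewrite -mulrA ler_pM2l// -(ler_pdivlMl _ _ kR).
Qed.

End subgaussian_means.

(** * The power *)

Section power_bound.
Context (R : realType).

Lemma supnorm_attained d (mu : d.-tuple R) : 0 < supnorm mu ->
  exists i, supnorm mu = `|tnth mu i|.
Proof.
have : supnorm mu = 0 \/ exists i, supnorm mu = `|tnth mu i|.
  rewrite /supnorm; elim/big_ind: _ => [|x y hx hy|i _]; first by left.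
    by rewrite /Num.max; case: ifP.
  by right; exists i.
by case=> // ->; rewrite ltxx.
Qed.

Lemma muhat2_centered d k (W : k.-tuple (d.-tuple R)) (j : 'I_d) (c : R) :
  (0 < k)%N ->
  k%:R^-1 * \sum_(i < k) (tnth (tnth W i) j - c) = muhat2 0 W j - c.
Proof.
move=> k0; rewrite /muhat2 subn0 sumrB mulrBr sumr_const card_ord.
rewrite -[c *+ k]mulr_natl mulKf ?pnatr_eq0 ?gtn_eqF//.
Qed.

(** A union bound over the two signs and the d coordinates. *)
Lemma muhat2_deviation d k (P : probability (d.-tuple R) R) (mu : d.-tuple R)
    (sigma t : R) : 0 < sigma -> subgaussian P mu sigma -> 0 < t -> (0 < k)%N ->
  exists B : set (k.-tuple (d.-tuple R)), [/\ measurable B,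
    (iid P k B <= (d%:R * (2 * expR (- (k%:R * t ^+ 2 / (4 * sigma ^+ 2)))))%:E)%E &
    forall W, ~ B W -> forall j, `|muhat2 0 W j - tnth mu j| < t].
Proof.
move=> s0 Psub t0 k0.
pose g (j : 'I_d) (x : d.-tuple R) := tnth x j - tnth mu j.
have mg j : measurable_fun setT (g j).
  by apply: measurable_funB => //; exact: measurable_tnth.
have mgN j : measurable_fun setT (fun x => - g j x) by exact: measurableT_comp.
have gsub j l : (\int[P]_x (expR (l * g j x))%:E <= (expR (l ^+ 2 * sigma ^+ 2))%:E)%E.
  by have := Psub l j; rewrite unlock.
have gNsub j l : (\int[P]_x (expR (l * - g j x))%:E <= (expR (l ^+ 2 * sigma ^+ 2))%:E)%E.
  have := gsub j (- l); rewrite sqrrN; apply: le_trans.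
  by under eq_integral do rewrite mulrN -mulNr.
pose A (h : d.-tuple R -> R) : set (k.-tuple (d.-tuple R)) :=
  [set W | t <= k%:R^-1 * \sum_(i < k) h (tnth W i)].
have mA h : measurable_fun setT h -> measurable (A h).
  move=> mh; rewrite -[X in measurable X]setTI; apply: measurable_fun_ler => //.
  apply: measurable_funM => //; exact: (measurable_sum_tnth (h := fun=> h)).
pose B j := A (g j) `|` A (fun x => - g j x).
exists (\bigcup_j B j); split.
- apply: fin_bigcup_measurable => // j _.
  by apply: measurableU; exact: mA.
- apply: union_bound => j; first by apply: measurableU; exact: mA.
  apply: (le_trans (measureU2 _ _ _)); [exact: mA|exact: mA|].
  rewrite mulr_natl mulr2n EFinD; apply: leeD.
    exact: subgaussian_mean_tail.
  exact: (subgaussian_mean_tail (g := fun x => - g j x)).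
move=> W BW j; rewrite ltNge; apply/negP => h; apply: BW; exists j => //.
move: h; rewrite ler_normr => /orP[h|h]; [left|right]; rewrite /A /=.
  by rewrite muhat2_centered.
by rewrite sumrN mulrN muhat2_centered.
Qed.

(** Off the exceptional event of [muhat2_deviation] with t = M / 4, where M is the sup norm of mu,
some coordinate of the second mean exceeds 3 M / 4 in absolute value, hence so does the
selected one. Its true mean then has the same sign and is at least M / 2 in absolute value,
so that the projected variable has a positive drift. *)
Lemma power_bound (L sigma z e : R) : 0 <= L -> 0 < sigma -> 0 < e ->
  exists (m0 : nat) (K : R), forall m k d, (m0 <= m)%N -> (0 < k)%N -> (0 < d)%N ->
  forall (P : probability (d.-tuple R) R) (mu : d.-tuple R), calP L mu P ->
    subgaussian P mu sigma -> 0 < supnorm mu ->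
    K < Num.sqrt m%:R * supnorm mu ->
  (iid P (m + k) [set X | (Tsparse m X <= z)%R] <= (e +
    d%:R * (2 * expR (- (k%:R * (supnorm mu / 4) ^+ 2 / (4 * sigma ^+ 2)))))%:E)%E.
Proof.
move=> L0 s0 e0; have [m0 [K HK]] := studentized_power z L0 e0.
(* Standard deviations are at most c sigma, by the bound on the variance in [subgaussian_sqr]. *)
pose c : R := Num.sqrt (4 * expR 1).
have c0 : 0 < c by rewrite sqrtr_gt0 mulr_gt0// expR_gt0.
have c2 : c ^+ 2 = 4 * expR 1 by rewrite sqr_sqrtr// mulr_ge0// expR_ge0.
clearbody c.
exists m0, (K * (2 * c * sigma)) => m k d mm0 k0 d0 P mu PL Psub M0 KM.
set M := supnorm mu in M0 KM *.
have M40 : 0 < M / 4 by rewrite divr_gt0.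
have [B [mB PB BN]] := muhat2_deviation s0 Psub M40 k0.
have mT := @measurable_Tsparse R d (m + k) m.
rewrite EFinD; apply: le_trans (leeD (lexx _) PB).
apply: iid_cat_le => //.
- by rewrite -[X in measurable X]setTI; exact: measurable_fun_ler.
- exact: ltW.
move=> W /BN near_mu; have [j [jmax vE]] := vhatP W d0.
have [i0 Mi0] := supnorm_attained M0.
have [s sp sm] := calP_moments L0 PL j.
have {jmax} hatj : 3 * (M / 4) < `|muhat2 0 W j|.
  have := lerB_dist (tnth mu i0) (tnth mu i0 - muhat2 0 W i0).
  rewrite subKr -Mi0 => h; have := near_mu i0; have := jmax i0.
  by rewrite distrC; move: h; rewrite -/M; lra.
have a_ge : M / 2 <= Num.sg (muhat2 0 W j) * tnth mu j.
  have := near_mu j; rewrite ltr_norml => /andP[h1 h2].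
  have [p|p|p] := ltrgt0P (muhat2 0 W j).
  - by rewrite gtr0_sg// mul1r; rewrite gtr0_norm// in hatj; lra.
  - by rewrite ltr0_sg// mulN1r; rewrite ltr0_norm// in hatj; lra.
  - by rewrite p normr0 in hatj; lra.
have sg0 : muhat2 0 W j != 0 by rewrite -normr_gt0; lra.
have s_le : s <= c * sigma.
  rewrite -(@ler_pXn2r _ 2)// ?nnegrE ?(ltW sp) ?mulr_ge0 ?(ltW c0) ?(ltW s0)//.
  rewrite exprMn c2; have [my _ _ yv _] := sm.
  apply: (subgaussian_sqr (P := P) (g := fun x => tnth x j - tnth mu j)) => //.
  by move=> l; have := Psub l j; rewrite unlock.
pose b := Num.sg (muhat2 0 W j) / s.
have b2 : b ^+ 2 * s ^+ 2 = 1.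
  by rewrite /b expr_div_n mulfVK ?sqr_sg ?sg0// expf_neq0// gt_eqF.
have b3 : `|b| ^+ 3 * (L * s ^+ 3) = L.
  rewrite /b normrM normr_sg sg0 mul1r gtr0_norm ?invr_gt0// exprVn.
  by field; rewrite gt_eqF.
have gm := momentsZ b sm; rewrite b2 b3 in gm.
have Km : K < Num.sqrt m%:R * (Num.sg (muhat2 0 W j) * tnth mu j / s).
  have h : M / 2 / (c * sigma) <= Num.sg (muhat2 0 W j) * tnth mu j / s.
    apply: ler_pM => //; rewrite ?invr_ge0 ?divr_ge0 ?(ltW M0) ?mulr_ge0 ?(ltW c0) ?(ltW s0)//.
    by rewrite lef_pV2// posrE mulr_gt0.
  apply: lt_le_trans (ler_wpM2l (sqrtr_ge0 _) h).
  have -> : Num.sqrt m%:R * (M / 2 / (c * sigma)) = Num.sqrt m%:R * M / (2 * c * sigma).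
    by field; rewrite !gt_eqF.
  by rewrite ltr_pdivlMr// !mulr_gt0.
have := HK m mm0 _ _ P _ _ _ gm sp Km.
congr (iid P m _ <= _)%E; apply/seteqP.
have E (Z : m.-tuple (d.-tuple R)) : Tsparse m (cat_tuple Z W) = studentized (fun i =>
    Num.sg (muhat2 0 W j) * tnth mu j +
    s * (b * (tnth (tnth Z i) j - tnth mu j))).
  rewrite Tsparse_cat; congr studentized; apply/funext => i; rewrite vE /b.
  by field; rewrite gt_eqF.
by split => Z /=; rewrite E.
Qed.

End power_bound.

(** * Passage to the limit *)

Section limits.
Context (R : realType).

(** One set of indices on which the bound holds is a competitor in the infimum. *)
Lemma limn_esup_near_le (u : (\bar R)^nat) (x : \bar R) :
  (\forall n \near \oo, u n <= x)%E -> (limn_esup u <= x)%E.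
Proof.
move=> h; rewrite /limn_esup /limf_esup.
apply: (@le_trans _ _ (ereal_sup (u @` [set n | u n <= x]%E))).
  by apply: ereal_inf_lbound; exists [set n | u n <= x]%E.
by apply: ge_ereal_sup => _ [n /= nx <-].
Qed.

Lemma sup_dist_le (S : set R) (a e : R) : S !=set0 ->
  (forall x, S x -> `|a - x| <= e) -> `|a - sup S| <= e.
Proof.
move=> [x0 Sx0] Se.
have ub : ubound S (a + e).
  by move=> x /Se; rewrite distrC ler_distl => /andP[].
have h1 : sup S <= a + e by apply: ge_sup => //; exists x0.
have h2 : x0 <= sup S by apply: ub_le_sup => //; exists (a + e).
have := Se _ Sx0; rewrite distrC ler_distl => /andP[h3 h4].
by rewrite distrC ler_distl; lra.
Qed.

Lemma indic_pred (T : Type) (b : pred T) x :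
  \1_[set y | b y] x = (b x)%:R :> R.
Proof.
rewrite indicE; congr (nat_of_bool _)%:R.
by apply/idP/idP => [/set_mem|bx]; last exact/mem_set.
Qed.

End limits.

Section rejection_probabilities.
Context (R : realType) (n m d : nat) (P : probability (d.-tuple R) R) (alpha : R).

Let z : R := gauss_quantile (1 - alpha).

Let mT := @measurable_Tsparse R d n m.

Let mle : measurable [set X : n.-tuple (d.-tuple R) | Tsparse m X <= z].
Proof. by rewrite -[X in measurable X]setTI; exact: measurable_fun_ler. Qed.

Let mlt : measurable [set X : n.-tuple (d.-tuple R) | z < Tsparse m X].
Proof. by rewrite -[X in measurable X]setTI; exact: measurable_fun_ltr. Qed.

Lemma Rintegral_accept : \int[iid P n]_X (1 - phi_sparse m alpha X) =
  fine (iid P n [set X | Tsparse m X <= z]).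
Proof.
rewrite /Rintegral; congr fine.
transitivity (\int[iid P n]_X (\1_[set X | Tsparse m X <= z] X)%:E)%E; last first.
  by rewrite integral_indic// setIT.
apply: eq_integral => X _; congr EFin; rewrite indic_pred /phi_sparse -/z.
by rewrite leNgt; case: (z < _)%R; rewrite /= ?subrr ?subr0.
Qed.

Lemma Rintegral_reject : \int[iid P n]_X phi_sparse m alpha X =
  fine (iid P n [set X | z < Tsparse m X]).
Proof.
rewrite /Rintegral; congr fine.
transitivity (\int[iid P n]_X (\1_[set X | z < Tsparse m X] X)%:E)%E; last first.
  by rewrite integral_indic// setIT.
by apply: eq_integral => X _; congr EFin; rewrite indic_pred.
Qed.

Lemma reject_accept : fine (iid P n [set X | z < Tsparse m X]) =
  1 - fine (iid P n [set X | Tsparse m X <= z]).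
Proof.
have -> : [set X : n.-tuple (d.-tuple R) | z < Tsparse m X] =
    ~` [set X | Tsparse m X <= z].
  by apply/seteqP; split => X /=; rewrite ltNge => /negP.
have := probability_setC (iid P n) mle.
have fin : (iid P n [set X | Tsparse m X <= z]) \is a fin_num by exact: fin_num_measure.
by move=> ->; rewrite fineB.
Qed.

End rejection_probabilities.

Section asymptotics.
Context (R : realType) (L sigma kappa_lo kappa_hi : R) (m1 : nat -> nat).
Context (hL : 1 < L) (hsigma : 0 < sigma) (hkappa_lo : 0 < kappa_lo)
  (hm1 : forall n : nat, (1 < n)%N -> (0 < m1 n < n)%N)
  (hratio : forall n : nat, (1 < n)%N -> kappa_lo <= (m1 n)%:R / n%:R <= kappa_hi).

Let L0 : 0 <= L. Proof. exact: le_trans (ltW hL). Qed.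

Lemma first_split_infty (m0 : nat) : \forall n \near \oo, (1 < n)%N /\ (m0 <= m1 n)%N.
Proof.
have klo := hkappa_lo.
have x0 : 0 <= m0%:R / kappa_lo by rewrite divr_ge0// ltW.
exists (maxn 2 (Num.bound (m0%:R / kappa_lo))) => // n /=.
rewrite geq_max => /andP[n1 nb]; split => //.
have /andP[h _] := hratio n1.
have nR : (0 < n%:R :> R) by rewrite ltr0n (leq_trans _ n1).
rewrite -(ler_nat R); move: h; rewrite ler_pdivlMr//; apply: le_trans.
rewrite -ler_pdivrMl// mulrC.
by apply: (le_trans (ltW (archi_boundP x0))); rewrite ler_nat.
Qed.

(** With [level_bound] stated for samples of length m + k, it remains to let m be the size of the
first part, which tends to infinity with n. *)
Lemma level_near (z e : R) : 0 < e -> \forall n \near \oo, forall d, (0 < d)%N ->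
  forall P, @calP0 R d L P ->
  (iid P n [set X | (z <= Tsparse (m1 n) X)%R] <= (1 - Phi z + e)%:E)%E /\
  (iid P n [set X | (Tsparse (m1 n) X <= z)%R] <= (Phi z + e)%:E)%E.
Proof.
move=> e0; have [m0 H] := level_bound z L0 e0.
apply: filterS (first_split_infty m0) => n [n1 m0n] d d0 P PL.
have /andP[m1n mn] := hm1 n1.
have [k k0 nE] : exists2 k, (0 < k)%N & n = (m1 n + k)%N.
  by exists (n - m1 n)%N; rewrite ?subn_gt0// subnKC// ltnW.
have := H _ k _ m0n m1n k0 d0 P PL; move: (m1 n) nE => m nE.
by rewrite nE.
Qed.

(** The signal dominates sqrt (log d / n) by a factor K n tending to infinity. This makes both
the drift of the statistic and the Chernoff exponent, relative to log d, tend to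
infinity; as log d >= log 2, this is uniform in d. *)
Lemma power_near (z e : R) (d : nat -> nat) (eps K : nat -> R) : 0 < e ->
  kappa_hi < 1 -> (forall n, (1 < d n)%N) -> K n @[n --> \oo] --> +oo ->
  (forall n : nat, (1 < n)%N ->
      K n * sigma * Num.sqrt (n%:R^-1 * ln (d n)%:R) <= eps n) ->
  \forall n \near \oo, forall P, @calQ_sparse R (d n) L sigma (eps n) P ->
  (iid P n [set X | (Tsparse (m1 n) X <= z)%R] <= e%:E)%E.
Proof.
move=> e0 khi d1 /cvgryPge Koo Keps; have s0 := hsigma; have klo := hkappa_lo.
have e20 : 0 < e / 2 by rewrite divr_gt0.
have [m0 [Kc H]] := power_bound z L0 s0 e20.
have ln20 : 0 < ln 2 :> R by rewrite ln_gt0// ltr1n.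
pose q := sigma * Num.sqrt (kappa_lo * ln 2).
have q0 : 0 < q by rewrite mulr_gt0// sqrtr_gt0 mulr_gt0.
(* K n >= 1 and K n >= A make the exponent at least (1 + 4 / (e log 2)) log d, with the factor
   64 = 4^2 * 4 from the threshold M / 4 and the Chernoff bound; then 2 d exp (- exponent)
   is at most 2 exp (- 4 / e) <= e / 2. *)
pose A := 64 / (1 - kappa_hi) * (1 + 4 / (e * ln 2)).
near=> n => P [mu [PL epsmu Psub]].
have [n1 m0n] : (1 < n)%N /\ (m0 <= m1 n)%N by near: n; exact: first_split_infty.
have K1 : 1 <= K n by near: n; exact: Koo.
have KKc : (`|Kc| + 1) / q <= K n by near: n; exact: Koo.
have KA : A <= K n by near: n; exact: Koo.
have KE := Keps _ n1; have /andP[rlo rhi] := hratio n1; have /andP[m1n mn] := hm1 n1.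
have nR : 0 < n%:R :> R by rewrite ltr0n (leq_trans _ n1).
have dd : 2 <= (d n)%:R :> R by rewrite ler_nat.
have lnd : ln 2 <= ln (d n)%:R :> R by rewrite ler_ln// posrE// (lt_le_trans _ dd).
have lnd0 : 0 < ln (d n)%:R :> R by exact: lt_le_trans lnd.
set ld := ln _ in KE lnd lnd0.
have w0 : 0 < n%:R^-1 * ld by rewrite mulr_gt0// invr_gt0.
have muE := le_trans KE epsmu.
have K0 : 0 < K n by exact: lt_le_trans K1.
have M0 : 0 < supnorm mu.
  by apply: lt_le_trans muE; rewrite !mulr_gt0// sqrtr_gt0.
have [k k0 nE] : exists2 k, (0 < k)%N & n = (m1 n + k)%N.
  by exists (n - m1 n)%N; rewrite ?subn_gt0// subnKC// ltnW.
have KM : Kc < Num.sqrt (m1 n)%:R * supnorm mu.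
  apply: (@lt_le_trans _ _ (K n * q)).
    move: KKc; rewrite ler_pdivrMr//; apply: lt_le_trans.
    by rewrite ltr_pwDr// ler_norm.
  apply: le_trans (ler_wpM2l (sqrtr_ge0 _) muE).
  have -> : Num.sqrt (m1 n)%:R * (K n * sigma * Num.sqrt (n%:R^-1 * ld)) =
      K n * (sigma * (Num.sqrt (m1 n)%:R * Num.sqrt (n%:R^-1 * ld))) by ring.
  rewrite ler_pM2l//.
  rewrite /q ler_pM2l// -sqrtrM ?ler0n//.
  rewrite ler_wsqrtr// mulrA; apply: ler_pM => //; exact: ltW.
have kR : (1 - kappa_hi) * n%:R <= k%:R.
  have -> : k%:R = n%:R - (m1 n)%:R :> R by rewrite [in n%:R]nE natrD addrC addKr.
  by move: rhi; rewrite ler_pdivrMr//; lra.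
have ex : A / 64 * (1 - kappa_hi) * ld <=
    k%:R * (supnorm mu / 4) ^+ 2 / (4 * sigma ^+ 2).
  have M2 : (K n * sigma) ^+ 2 * (n%:R^-1 * ld) <= supnorm mu ^+ 2.
    rewrite -[X in _ * X <= _](sqr_sqrtr (ltW w0)) -exprMn.
    by rewrite ler_pXn2r// nnegrE ?(ltW M0)// !mulr_ge0// ltW.
  rewrite ler_pdivlMr ?mulr_gt0 ?exprn_gt0// expr_div_n [k%:R * (_ / _)]mulrA ler_pdivlMr//.
  apply: le_trans (ler_pM _ _ kR M2); last 2 first.
  - by rewrite mulr_ge0// subr_ge0 ltW.
  - by rewrite mulr_ge0 ?sqr_ge0// ltW.
  have -> : (1 - kappa_hi) * n%:R * ((K n * sigma) ^+ 2 * (n%:R^-1 * ld)) =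
      K n ^+ 2 * ((1 - kappa_hi) * sigma ^+ 2 * ld).
    by field; rewrite gt_eqF.
  have -> : A / 64 * (1 - kappa_hi) * ld * (4 * sigma ^+ 2) * 4 ^+ 2 =
      A * ((1 - kappa_hi) * sigma ^+ 2 * ld) by field.
  apply: ler_wpM2r; first by rewrite !mulr_ge0 ?sqr_ge0 ?subr_ge0// ltW.
  by apply: (le_trans KA); rewrite expr2 ler_peMr// ltW.
have A64 : A / 64 * (1 - kappa_hi) = 1 + 4 / (e * ln 2).
  by rewrite /A; field; rewrite !gt_eqF// subr_gt0.
rewrite A64 in ex.
have dexp : (d n)%:R * (2 * expR (- (k%:R * (supnorm mu / 4) ^+ 2 / (4 * sigma ^+ 2)))) <= e / 2.
  set B := _ / (4 * sigma ^+ 2) in ex *.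
  rewrite -[(d n)%:R](@lnK R) ?posrE ?(lt_le_trans _ dd)// -/ld mulrCA -expRD.
  have y0 : 4 / e <= B - ld.
    have : 4 / (e * ln 2) * ln 2 <= 4 / (e * ln 2) * ld.
      by rewrite ler_wpM2l// divr_ge0// mulr_ge0// ltW.
    have -> : 4 / (e * ln 2) * ln 2 = 4 / e by field; rewrite !gt_eqF.
    by move: ex; rewrite mulrDl mul1r; lra.
  have := expR_ge1Dx (B - ld) => E.
  have -> : ld + - B = - (B - ld) by ring.
  rewrite expRN -ler_pdivlMl//.
  have -> : 2^-1 * (e / 2) = (4 / e)^-1 by field; rewrite gt_eqF.
  rewrite lef_pV2 ?posrE ?expR_gt0 ?divr_gt0//.
  by apply: le_trans y0 _; apply: le_trans E; lra.
have := H _ k _ m0n k0 (ltnW (d1 n)) P mu PL Psub M0 KM.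
move/le_trans => /(_ e%:E); rewrite lee_fin.
move/(_ ltac:(lra)).
have transport D (Q : probability (D.-tuple R) R) N m l : N = (m + l)%N ->
    (iid Q (m + l) [set X | (Tsparse m X <= z)%R] <= e%:E)%E ->
    (iid Q N [set X | (Tsparse m X <= z)%R] <= e%:E)%E by move=> ->.
exact: transport.
Unshelve. all: by end_near. Qed.

End asymptotics.

Section conclusions.
Context (R : realType) (L sigma kappa_lo kappa_hi : R) (m1 : nat -> nat).
Context (hL : 1 < L) (hsigma : 0 < sigma) (hkappa_lo : 0 < kappa_lo)
  (hm1 : forall n : nat, (1 < n)%N -> (0 < m1 n < n)%N)
  (hratio : forall n : nat, (1 < n)%N -> kappa_lo <= (m1 n)%:R / n%:R <= kappa_hi).

(** Both tails of [level_near] at the quantile squeeze every rejection probability; a member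
of the class is needed for the supremum to inherit the lower bound. *)
Lemma asymptotic_level (alpha : R) (d : nat -> nat) : 0 < alpha < 1 ->
  (forall n : nat, (0 < d n)%N) ->
  (L < 2 -> \forall n \near \oo, @calP0 R (d n) L !=set0) ->
  sup [set \int[iid P n]_X phi_sparse (m1 n) alpha X
      | P in @calP0 R (d n) L] @[n --> \oo] --> alpha.
Proof.
move=> /andP[a0 a1] d0 ne.
have ne' : \forall n \near \oo, @calP0 R (d n) L !=set0.
  have [|L2] := ltP L 2; first exact: ne.
  by near=> n; exact: calP0_nonempty.
have PhiZ : Phi (gauss_quantile (1 - alpha)) = 1 - alpha.
  by apply: Phi_gauss_quantile; rewrite subr_gt0 a1 gtrBl.
apply/cvgrPdist_le => e e0; near=> n.
apply: sup_dist_le.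
  have [P PL] : @calP0 R (d n) L !=set0 by near: n.
  by eexists; exists P.
move=> _ [P PL <-]; rewrite Rintegral_reject.
have [hup hlo] : (iid P n [set X | (gauss_quantile (1 - alpha) <= Tsparse (m1 n) X)%R]
      <= (1 - Phi (gauss_quantile (1 - alpha)) + e)%:E)%E /\
    (iid P n [set X | (Tsparse (m1 n) X <= gauss_quantile (1 - alpha))%R] <=
      (Phi (gauss_quantile (1 - alpha)) + e)%:E)%E.
  by move: (d n) (d0 n) P PL; near: n; exact: (level_near hL hkappa_lo hm1 hratio).
rewrite PhiZ in hup hlo; set z := gauss_quantile _ in hup hlo *.
have mT := @measurable_Tsparse R (d n) n (m1 n).
have lo : 1 - (1 - alpha + e) <= fine (iid P n [set X | z < Tsparse (m1 n) X]).
  rewrite reject_accept lerD2l lerN2 -lee_fin fineK//.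
  by apply: fin_num_measure; rewrite -[X in measurable X]setTI; exact: measurable_fun_ler.
have up : fine (iid P n [set X | z < Tsparse (m1 n) X]) <= 1 - (1 - alpha) + e.
  rewrite -lee_fin fineK; last first.
    by apply: fin_num_measure; rewrite -[X in measurable X]setTI; exact: measurable_fun_ltr.
  apply: le_trans hup; apply: le_measure; rewrite ?inE.
  - by rewrite -[X in measurable X]setTI; exact: measurable_fun_ltr.
  - by rewrite -[X in measurable X]setTI; exact: measurable_fun_ler.
  by move=> X /=; exact: ltW.
by rewrite ler_norml; lra.
Unshelve. all: by end_near. Qed.

Lemma asymptotic_power (alpha : R) (d : nat -> nat) (eps K : nat -> R) :
  kappa_hi < 1 -> (forall n, (1 < d n)%N) -> K n @[n --> \oo] --> +oo ->
  (forall n : nat, (1 < n)%N ->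
      K n * sigma * Num.sqrt (n%:R^-1 * ln (d n)%:R) <= eps n) ->
  sup [set \int[iid P n]_X (1 - phi_sparse (m1 n) alpha X)
      | P in @calQ_sparse R (d n) L sigma (eps n)] @[n --> \oo] --> (0 : R).
Proof.
move=> khi d1 Koo Keps; apply/cvgrPdist_le => e e0; near=> n.
set S := [set _ | _ in _].
have [S0|/nonemptyPn ->] := pselect (S !=set0); last by rewrite sup0 subrr normr0 ltW.
apply: sup_dist_le => //.
move=> _ [P PQ <-]; rewrite Rintegral_accept sub0r normrN ger0_norm ?fine_ge0//.
rewrite -lee_fin fineK; last first.
  apply: fin_num_measure; rewrite -[X in measurable X]setTI.
  by apply: measurable_fun_ler => //; exact: measurable_Tsparse.
move: P PQ; near: n.
exact: (power_near hL hsigma hkappa_lo hm1 hratio _ e0 khi d1 Koo Keps).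
Unshelve. all: by end_near. Qed.

(** A p-value of at most a forces the statistic above any z with Phi z < 1 - a. At
a = 0 no z satisfies Phi z = 1 - a, so the level is approached from below. *)
Lemma asymptotic_pvalue (d : nat -> nat) (a : R) : (forall n : nat, (0 < d n)%N) ->
  0 <= a <= 1 ->
  (limn_esup (fun n : nat =>
        ereal_sup [set iid P n [set X | (pvalue (m1 n) X <= a)%R]
                  | P in @calP0 R (d n) L]) <= a%:E)%E.
Proof.
move=> d0 /andP[a0 a1].
have mp n m l (P : probability (l.-tuple R) R) :
    measurable [set X : n.-tuple (l.-tuple R) | pvalue m X <= a].
  rewrite -[X in measurable X]setTI; apply: measurable_fun_ler => //.
  apply: measurable_funB => //; apply: measurableT_comp; last exact: measurable_Tsparse.
  by apply: continuous_measurable_fun; exact: Phi_continuous.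
have [a1'|a_lt1] := leP 1 a.
  apply: limn_esup_near_le; near=> n; apply: ge_ereal_sup => _ [P _ <-].
  have -> : a = 1 by apply/eqP; rewrite eq_le a1.
  by apply: probability_le1; have := mp n (m1 n) _ P; rewrite (_ : a = 1)//; apply/eqP; rewrite eq_le a1.
apply/lee_addgt0Pr => e e0.
(* Small enough for 2 h <= e and for 1 - a - h to lie in the open unit interval. *)
pose h := Num.min (e / 2) ((1 - a) / 2).
have h0 : 0 < h by rewrite lt_min !divr_gt0// subr_gt0.
have he : h <= e / 2 by rewrite ge_min lexx.
have ha : h <= (1 - a) / 2 by rewrite ge_min lexx orbT.
have [|z Phiz] := @Phi_surjective R (1 - a - h); first by lra.
rewrite -EFinD; apply: limn_esup_near_le; near=> n.
apply: ge_ereal_sup => _ [P PL <-].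
have [hup _] : (iid P n [set X | (z <= Tsparse (m1 n) X)%R] <= (1 - Phi z + h)%:E)%E /\
    (iid P n [set X | (Tsparse (m1 n) X <= z)%R] <= (Phi z + h)%:E)%E.
  by move: (d n) (d0 n) P PL; near: n; exact: (level_near hL hkappa_lo hm1 hratio).
apply: (@le_trans _ _ (1 - Phi z + h)%:E); last by rewrite lee_fin Phiz; lra.
apply: le_trans hup; apply: le_measure; rewrite ?inE.
- exact: mp.
- rewrite -[X in measurable X]setTI; apply: measurable_fun_ler => //.
  exact: measurable_Tsparse.
move=> X /=; rewrite /pvalue => pa; rewrite leNgt; apply/negP => /ltW /Phi_nondecreasing.
by rewrite Phiz; lra.
Unshelve. all: by end_near. Qed.

End conclusions.

Unset Implicit Arguments.
Set Strict Implicit.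

Theorem theorem2p12 (R : realType) (L sigma kappa_lo kappa_hi : R)
  (m1 : nat -> nat)
  (hL : 1 < L) (hsigma : 0 < sigma)
  (hkappa_lo : 0 < kappa_lo) (hkappa_hi : 0 < kappa_hi)
  (hm1 : forall n : nat, (1 < n)%N -> (0 < m1 n < n)%N)
  (hratio : forall n : nat, (1 < n)%N ->
    kappa_lo <= (m1 n)%:R / n%:R <= kappa_hi) :
  (forall (alpha : R) (d : nat -> nat) (eps K : nat -> R),
    0 < alpha < 1 ->
    (forall n : nat, (0 < d n)%N) ->
    (forall n : nat, 0 < K n) ->
    nondecreasing_seq K ->
    K n @[n --> \oo] --> +oo ->
    (forall n : nat, (1 < n)%N ->
      K n * sigma * Num.sqrt (n%:R^-1 * ln (d n)%:R) <= eps n) ->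
    ((L < 2 -> \forall n \near \oo, @calP0 R (d n) L !=set0) ->
      sup [set \int[iid P n]_X phi_sparse (m1 n) alpha X
          | P in @calP0 R (d n) L] @[n --> \oo] --> alpha) /\
    (kappa_hi < 1 -> (forall n : nat, (1 < d n)%N) ->
      sup [set \int[iid P n]_X (1 - phi_sparse (m1 n) alpha X)
          | P in @calQ_sparse R (d n) L sigma (eps n)] @[n --> \oo]
        --> (0 : R))) /\
  (forall d : nat -> nat, (forall n : nat, (0 < d n)%N) ->
    forall a : R, 0 <= a <= 1 ->
      (limn_esup (fun n : nat =>
        ereal_sup [set iid P n [set X | (pvalue (m1 n) X <= a)%R]
                  | P in @calP0 R (d n) L]) <= a%:E)%E).
Proof.
split=> [alpha d eps K alpha01 d0 K0 Kmono Koo Keps|d d0 a a01].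
  split=> [ne|khi d1]; first exact: (asymptotic_level hL hkappa_lo hm1 hratio).
  exact: (asymptotic_power hL hsigma hkappa_lo hm1 hratio _ khi d1 Koo Keps).
exact: (asymptotic_pvalue hL hkappa_lo hm1 hratio).
Qed.
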